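(* Let $0<d<\pi/2$, $\mathscr{D}_d=\{\zeta\in\mathbb{C}:|\Im\zeta|<d\}$, and $\psi(t)=e^{(\pi/2)\sinh t}$. Assume $f$ is analytic on $\psi(\mathscr{D}_d)$ and there are constants $K,\alpha,\beta>0$ with $|f(z)|\le K\left|\frac{z^{\alpha-1}}{(1+z^2)^{(\alpha+\beta)/2}}\right|$ for all $z\in\psi(\mathscr{D}_d)$. Let $\mu=\min\{\alpha,\beta\}$, $\nu=\max\{\alpha,\beta\}$, let $n$ be a positive integer, $h=\log(8dn/\mu)/n$, and let $M=n$, $N=n-\lfloor\log(\beta/\alpha)/h\rfloor$ if $\mu=\alpha$, and $N=n$, $M=n-\lfloor\log(\alpha/\beta)/h\rfloor$ if $\mu=\beta$. Suppose $n\ge\nu e/(8d)$, $Mh\ge x_{\alpha/2}$ and $Nh\ge x_{\beta/2}$. Then \[ \left|\int_{0}^{\infty}f(t)\,dt-h\sum_{k=-M}^{N}f(\psi(kh))\psi'(kh)\right|\le C_2e^{-2\pi dn/\log(8dn/\mu)}, \] with $C_2=\frac{2K}{\mu}\left\{\frac{2}{(1-e^{-\pi\mu e/4})\{\cos(\frac{\pi}{2}\sin d)\}^{(\alpha+\beta)/2}\cos d}+e^{\pi\nu/4}\right\}$.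
   Context: For $\gamma>0$, $x_\gamma=\operatorname{arcsinh}\!\left(\frac{\sqrt{1+\sqrt{1-(2\pi\gamma)^2}}}{2\pi\gamma}\right)$ if $0<\gamma<1/(2\pi)$, and $x_\gamma=\operatorname{arcsinh}(1)$ if $\gamma\ge1/(2\pi)$. Complex powers use principal branches. *)

(* Defs.v *)
From Stdlib Require Import Reals ZArith.
From Coquelicot Require Import Coquelicot.
Open Scope R_scope.

Definition Cexp (z : C) : C :=
  (exp (Re z) * cos (Im z), exp (Re z) * sin (Im z)).

Definition Csinh (z : C) : C := ((Cexp z - Cexp (- z)) / 2)%C.

Definition psiC (z : C) : C := Cexp (RtoC (PI / 2) * Csinh z)%C.

Definition psiR (t : R) : R := exp (PI / 2 * sinh t).

Definition strip (d : R) (z : C) : Prop := Rabs (Im z) < d.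

Definition psi_strip (d : R) (z : C) : Prop :=
  exists zeta : C, strip d zeta /\ z = psiC zeta.

(* principal argument, in (-pi, pi] *)
Definition Carg (z : C) : R :=
  let x := Re z in let y := Im z in
  if Rlt_dec 0 x then atan (y / x)
  else if Rlt_dec x 0 then
    (if Rle_dec 0 y then atan (y / x) + PI else atan (y / x) - PI)
  else if Rlt_dec 0 y then PI / 2
  else if Rlt_dec y 0 then - (PI / 2)
  else 0.

Definition Clog (z : C) : C := (ln (Cmod z), Carg z).

Definition Cppow (z w : C) : C :=
  if Req_EM_T (Cmod z) 0 then 0%C else Cexp (w * Clog z)%C.

Definition x_gamma (g : R) : R :=
  if Rlt_dec g (1 / (2 * PI)) then
    arcsinh (sqrt (1 + sqrt (1 - (2 * PI * g) ^ 2)) / (2 * PI * g))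
  else arcsinh 1.

Definition zsum (a : Z -> C) (lo hi : Z) : C :=
  if Z.ltb hi lo then 0%C
  else sum_n_m (fun j : nat => a (lo + Z.of_nat j)%Z) 0 (Z.to_nat (hi - lo)).

Definition analytic_on (U : C -> Prop) (f : C -> C) : Prop :=
  forall z, U z -> ex_derive (K := C_AbsRing) (V := C_NormedModule) f z.

(* Main.v *)
Require Import Defs.
From Stdlib Require Import Reals ZArith.
From Coquelicot Require Import Coquelicot.
From Stdlib Require Import Lra Lia Psatz Classical ClassicalEpsilon.
Open Scope R_scope.

(** With [F z = f (psi z) * psi' z], the integral of [f] is that of [F] over the real line, and [F] is holomorphic on the strip.
    The function [w z = 1 / (1 - exp (- 2 i pi z / h))] has its poles at the sampling points, so Cauchy's theorem on a rectangle of height [2 Y] cut into cells with one pole each expresses [h * Sum F (k h)] as a contour integral of [F * w].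
    On the upper side [w] is exponentially small, on the lower side [w - 1] is; hence sum and integral differ by the line integrals of [|F|] at height [Y] and [- Y] divided by [exp (2 pi Y / h) - 1], and [Y] tends to [d].

    Along these lines [F] decays doubly exponentially because [|1 + psi^2| >= (1 + |psi|^2) cos ((pi / 2) sin y)], which comes from bounding the sine by its tangent line and from the concavity of [(pi^2 / 4 - u^2) sin u - u cos u] on [0, pi / 2].

    The truncated terms are compared with the integral of [cosh x * exp (- c sinh x)].
    The threshold [x_gamma] is smaller than the maximiser of this function, so it decreases beyond [x_gamma] only up to a factor close to 1; that factor is absorbed by the gap between the true truncation error, of order [exp (- 2 pi d n)], and the bound claimed. *)

(** * Complex derivatives *)

(** Why [h], [M] and [N] fit together: if the decay rate on one side is [sigma] ([alpha] on the
    left, [beta] on the right), the terms cut off beyond [X] add up to about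
    [exp (- (pi / 2) sigma sinh X)]. The choice of [M] and [N] makes [X >= ln (8 d n / sigma)] on
    both sides, so this exponent is at least [2 pi d n - pi sigma / 4] whatever the rate; hence the
    term [e^(pi nu / 4)] of the constant. The exponent of the discretisation error is
    [2 pi d / h = 2 pi d n / ln (8 d n / mu)], and it decides the rate of the theorem.

    The factor [cos d] of the constant appears because at height [Y] the decay rate [sigma] is
    reduced to [sigma cos Y], and the integral of [cosh x exp (- c sinh x)] over a half-line is
    [1 / c].

    The hypothesis controls [f] on the image of the open strip only, so no contour can be placed at
    height [d]: every estimate is made at some [Y < d], with a bound that is continuous in [Y]. *)

Definition is_Cderive (f : C -> C) (z l : C) : Prop :=
  forall eps : R, 0 < eps -> exists delta : R, 0 < delta /\
    forall w : C, Cmod (w - z)%C < delta ->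
      Cmod (f w - f z - l * (w - z))%C <= eps * Cmod (w - z)%C.

Definition ex_Cderive (f : C -> C) (z : C) : Prop := exists l, is_Cderive f z l.

Notation is_derive_C := (@is_derive C_AbsRing (AbsRing_NormedModule C_AbsRing)).

(* [analytic_on] differentiates into [C_NormedModule], whereas the algebraic rules of Coquelicot are about [AbsRing_NormedModule C_AbsRing]. *)
Lemma is_Cderive_of_derive (f : C -> C) (z l : C) :
  @is_derive C_AbsRing C_NormedModule f z l -> is_Cderive f z l.
Proof.
  intros [_ Hd] eps Heps.
  specialize (Hd z (fun P H => H) (mkposreal eps Heps)).
  destruct Hd as [delta Hdelta].
  exists delta; split; [apply cond_pos|].
  intros w Hw. specialize (Hdelta w Hw).
  simpl in Hdelta.
  replace (f w - f z - l * (w - z))%C with (minus (minus (f w) (f z)) (scal (minus w z) l) : C).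
  exact Hdelta.
  change (f w - f z - (w - z) * l = f w - f z - l * (w - z))%C. ring.
Qed.

Lemma is_derive_is_Cderive (f : C -> C) (z l : C) :
  is_derive_C f z l -> is_Cderive f z l.
Proof.
  intros [_ Hd] eps Heps.
  specialize (Hd z (fun P H => H) (mkposreal eps Heps)).
  destruct Hd as [delta Hdelta].
  exists delta; split; [apply cond_pos|].
  intros w Hw. specialize (Hdelta w Hw).
  simpl in Hdelta.
  replace (f w - f z - l * (w - z))%C with (minus (minus (f w) (f z)) (scal (minus w z) l) : C).
  exact Hdelta.
  change (f w - f z - (w - z) * l = f w - f z - l * (w - z))%C. ring.
Qed.

(** With the converse above, this imports the algebraic rules of differentiation, while estimates
    such as Goursat's work on the epsilon-delta form. *)
Lemma is_Cderive_is_derive (f : C -> C) (z l : C) :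
  is_Cderive f z l -> is_derive_C f z l.
Proof.
  intros Hf; split.
  - apply is_linear_scal_l.
  - intros x Hx eps.
    assert (x = z) as ->.
    { symmetry. exact (@is_filter_lim_locally_unique C_AbsRing (AbsRing_NormedModule C_AbsRing) z x Hx). }
    destruct (Hf eps (cond_pos eps)) as [delta [Hd H]].
    exists (mkposreal delta Hd). intros w Hw.
    change (Cmod (f w - f z - (w - z) * l)%C <= eps * Cmod (w - z)%C).
    rewrite (Cmult_comm (w - z)%C l). exact (H w Hw).
Qed.

Lemma is_Cderive_eq (f : C -> C) (z l l' : C) :
  is_Cderive f z l -> l = l' -> is_Cderive f z l'.
Proof. intros H <-; exact H. Qed.

Lemma is_Cderive_const (c z : C) : is_Cderive (fun _ => c) z 0%C.
Proof.
  apply is_derive_is_Cderive, (@is_derive_const C_AbsRing (AbsRing_NormedModule C_AbsRing)).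
Qed.

Lemma is_Cderive_id (z : C) : is_Cderive (fun w => w) z 1%C.
Proof. apply is_derive_is_Cderive, (@is_derive_id C_AbsRing). Qed.

Lemma is_Cderive_plus (f g : C -> C) (z l m : C) :
  is_Cderive f z l -> is_Cderive g z m -> is_Cderive (fun w => f w + g w)%C z (l + m)%C.
Proof.
  intros Hf Hg. apply is_derive_is_Cderive.
  apply (@is_derive_plus C_AbsRing (AbsRing_NormedModule C_AbsRing)); now apply is_Cderive_is_derive.
Qed.

Lemma is_Cderive_opp (f : C -> C) (z l : C) :
  is_Cderive f z l -> is_Cderive (fun w => - f w)%C z (- l)%C.
Proof.
  intros Hf. apply is_derive_is_Cderive.
  apply (@is_derive_opp C_AbsRing (AbsRing_NormedModule C_AbsRing)); now apply is_Cderive_is_derive.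
Qed.

Lemma is_Cderive_minus (f g : C -> C) (z l m : C) :
  is_Cderive f z l -> is_Cderive g z m -> is_Cderive (fun w => f w - g w)%C z (l - m)%C.
Proof.
  intros Hf Hg. apply is_derive_is_Cderive.
  apply (@is_derive_minus C_AbsRing (AbsRing_NormedModule C_AbsRing)); now apply is_Cderive_is_derive.
Qed.

Lemma is_Cderive_mult (f g : C -> C) (z l m : C) :
  is_Cderive f z l -> is_Cderive g z m ->
  is_Cderive (fun w => f w * g w)%C z (l * g z + f z * m)%C.
Proof.
  intros Hf Hg. apply is_derive_is_Cderive.
  apply (@is_derive_mult C_AbsRing).
  - now apply is_Cderive_is_derive.
  - now apply is_Cderive_is_derive.
  - intros; apply Cmult_comm.
Qed.

Lemma is_Cderive_comp (f g : C -> C) (z l m : C) :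
  is_Cderive f (g z) l -> is_Cderive g z m ->
  is_Cderive (fun w => f (g w)) z (m * l)%C.
Proof.
  intros Hf Hg. apply is_derive_is_Cderive.
  apply (@is_derive_comp C_AbsRing (AbsRing_NormedModule C_AbsRing) f g); now apply is_Cderive_is_derive.
Qed.

Lemma is_Cderive_scal (c : C) (f : C -> C) (z l : C) :
  is_Cderive f z l -> is_Cderive (fun w => c * f w)%C z (c * l)%C.
Proof.
  intros Hf. eapply is_Cderive_eq.
  - exact (is_Cderive_mult _ _ _ _ _ (is_Cderive_const c z) Hf).
  - simpl; ring.
Qed.

(** * The complex exponential and the inverse are holomorphic *)

Lemma Cexp_plus (z w : C) : Cexp (z + w)%C = (Cexp z * Cexp w)%C.
Proof.
  unfold Cexp, Cmult, Re, Im; simpl. rewrite exp_plus, cos_plus, sin_plus. f_equal; ring.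
Qed.

Lemma Cexp_0 : Cexp 0%C = 1%C.
Proof. unfold Cexp; simpl. rewrite exp_0, cos_0, sin_0. unfold RtoC. f_equal; ring. Qed.

Lemma Cexp_neq_0 (z : C) : Cexp z <> 0%C.
Proof.
  intros H. assert (E : (Cexp z * Cexp (- z))%C = 1%C).
  { rewrite <- Cexp_plus, <- Cexp_0. f_equal. ring. }
  rewrite H, Cmult_0_l in E. apply RtoC_inj in E. lra.
Qed.

Lemma Cmod_Cexp (z : C) : Cmod (Cexp z) = exp (Re z).
Proof.
  unfold Cmod, Cexp; simpl.
  replace (_ + _) with (Rsqr (exp (Re z)) * (Rsqr (sin (Im z)) + Rsqr (cos (Im z))))
    by (unfold Rsqr; ring).
  rewrite sin2_cos2, Rmult_1_r. apply sqrt_Rsqr. left; apply exp_pos.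
Qed.

(** The upper bound comes from [exp (- x) >= 1 - x], that is [exp x <= 1 / (1 - x)]. *)
Lemma exp_taylor_1 (x : R) : Rabs x <= 1/2 -> Rabs (exp x - 1 - x) <= 2 * x ^ 2.
Proof.
  intros Hx. apply Rabs_le_between in Hx.
  assert (H1 := exp_ineq1_le x). assert (H2 := exp_ineq1_le (-x)).
  rewrite Rabs_pos_eq by lra.
  assert (exp x * exp (-x) = 1) by (rewrite <- exp_plus; replace (x + - x) with 0 by ring; apply exp_0).
  assert (Hp := exp_pos x).
  assert (exp x * (1 - x) <= 1) by nra.
  assert (exp x <= 1 + x + 2 * x ^ 2); [|lra].
  apply Rmult_le_reg_r with (1 - x); [lra|].
  apply Rle_trans with 1; [assumption|]. nra.
Qed.

Lemma Rabs_sin_le (b : R) : Rabs (sin b) <= Rabs b.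
Proof.
  assert (Hp : forall x, 0 <= x -> Rabs (sin x) <= x).
  { intros x Hx. destruct (Rle_dec x 1) as [Hs|Hs].
    - rewrite Rabs_pos_eq.
      + destruct Hx as [Hx| <-]; [left; now apply sin_lt_x | rewrite sin_0; lra].
      + apply sin_ge_0; [exact Hx|]. assert (H := PI2_1). lra.
    - assert (H := SIN_bound x). apply Rabs_le_between. lra. }
  destruct (Rle_dec 0 b) as [H|H].
  - rewrite (Rabs_pos_eq b) by exact H. now apply Hp.
  - rewrite (Rabs_left b) by lra. rewrite <- Rabs_Ropp, <- sin_neg. apply Hp; lra.
Qed.

Lemma cos_ge_1_minus_sqr (b : R) : 0 <= 1 - cos b <= b ^ 2 / 2.
Proof.
  assert (H1 := COS_bound b).
  assert (E : cos b = 1 - 2 * sin (b / 2) * sin (b / 2)).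
  { rewrite <- cos_2a_sin. f_equal. field. }
  assert (Hs := Rabs_sin_le (b / 2)).
  assert (sin (b/2) ^ 2 <= (b/2) ^ 2).
  { rewrite <- !Rsqr_pow2. apply Rsqr_le_abs_1. exact Hs. }
  nra.
Qed.

Lemma sin_taylor_1 (b : R) : Rabs b <= 1 -> Rabs (sin b - b) <= b ^ 2.
Proof.
  assert (Hp : forall x, 0 <= x <= 1 -> Rabs (sin x - x) <= x ^ 2).
  { intros x [Hx Hx1]. assert (HP := PI2_1).
    assert (sin x <= x) by (destruct Hx as [Hx| <-]; [left; now apply sin_lt_x | rewrite sin_0; lra]).
    rewrite Rabs_left1 by lra.
    assert (H2 : x - x ^ 3 / 6 <= sin x).
    { destruct (sin_bound x 0) as [L _]; [lra|lra|].
      unfold sin_approx, sum_f_R0, sin_term in L. simpl in L. simpl. lra. }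
    nra. }
  intros Hb. destruct (Rle_dec 0 b) as [H|H].
  - rewrite Rabs_pos_eq in Hb by exact H. apply Hp; lra.
  - rewrite Rabs_left in Hb by lra.
    specialize (Hp (- b)). rewrite sin_neg in Hp.
    replace (- sin b - - b) with (- (sin b - b)) in Hp by ring.
    rewrite Rabs_Ropp in Hp. replace ((- b) ^ 2) with (b ^ 2) in Hp by ring. apply Hp; lra.
Qed.

(** The constant is generous: the real part of the remainder is at most [3 m^2], the imaginary part
    at most [4 m^2], and passing from the maximum to the modulus costs [sqrt 2 <= 2]. *)
Lemma Cexp_taylor_1 (z : C) : Cmod z <= 1/2 -> Cmod (Cexp z - 1 - z)%C <= 20 * Cmod z ^ 2.
Proof.
  intros Hz. destruct z as [a b].
  assert (Ha := Rmax_Cmod (a, b)). simpl in Ha.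
  assert (A1 : Rabs a <= Cmod (a, b)) by (eapply Rle_trans; [apply Rmax_l|exact Ha]).
  assert (B1 : Rabs b <= Cmod (a, b)) by (eapply Rle_trans; [apply Rmax_r|exact Ha]).
  set (m := Cmod (a, b)) in *.
  assert (Ea := exp_taylor_1 a). assert (Cb := cos_ge_1_minus_sqr b).
  assert (Sb := sin_taylor_1 b). assert (Sb' := Rabs_sin_le b).
  specialize (Ea ltac:(lra)). specialize (Sb ltac:(lra)).
  assert (A2 : a ^ 2 <= m ^ 2) by (rewrite <- (pow2_abs a); apply pow_incr; split; [apply Rabs_pos|exact A1]).
  assert (B2 : b ^ 2 <= m ^ 2) by (rewrite <- (pow2_abs b); apply pow_incr; split; [apply Rabs_pos|exact B1]).
  assert (Hex : 0 < exp a <= 2).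
  { split; [apply exp_pos|]. apply Rabs_le_between in Ea. apply Rabs_le_between in A1. nra. }
  assert (Hm : 0 <= m) by apply Cmod_ge_0.
  replace (Cexp (a, b) - 1 - (a, b))%C with
    ((exp a - 1 - a - exp a * (1 - cos b)), ((exp a - 1) * sin b + (sin b - b))).
  2:{ unfold Cexp, Cminus, Cplus, Copp, RtoC; simpl. f_equal; ring. }
  eapply Rle_trans; [apply Cmod_2Rmax|]. simpl.
  assert (S2 : sqrt 2 <= 2).
  { rewrite <- (sqrt_Rsqr 2) at 2 by lra. apply sqrt_le_1_alt. unfold Rsqr. lra. }
  assert (Q0 : 0 <= sqrt 2) by apply sqrt_pos.
  assert (X1 : Rabs (exp a - 1 - a - exp a * (1 - cos b)) <= 3 * m ^ 2).
  { eapply Rle_trans; [apply Rabs_triang|]. rewrite Rabs_Ropp, (Rabs_pos_eq (exp a * _)) by (apply Rmult_le_pos; lra).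
    nra. }
  assert (X2 : Rabs ((exp a - 1) * sin b + (sin b - b)) <= 4 * m ^ 2).
  { eapply Rle_trans; [apply Rabs_triang|]. rewrite Rabs_mult.
    assert (Rabs (exp a - 1) <= 2 * m).
    { replace (exp a - 1) with ((exp a - 1 - a) + a) by ring.
      eapply Rle_trans; [apply Rabs_triang|]. nra. }
    assert (Rabs (exp a - 1) * Rabs (sin b) <= 2 * m * m).
    { apply Rmult_le_compat; try apply Rabs_pos; lra. }
    nra. }
  assert (Rmax (Rabs (exp a - 1 - a - exp a * (1 - cos b))) (Rabs ((exp a - 1) * sin b + (sin b - b))) <= 4 * m ^ 2).
  { apply Rmax_lub; nra. }
  assert (0 <= Rmax (Rabs (exp a - 1 - a - exp a * (1 - cos b))) (Rabs ((exp a - 1) * sin b + (sin b - b)))).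
  { eapply Rle_trans; [apply Rabs_pos|apply Rmax_l]. }
  nra.
Qed.

(** The functional equation reduces everything to the expansion at 0: the remainder at [z] is
    [Cexp z] times the remainder for [w - z]. *)
Lemma is_Cderive_Cexp (z : C) : is_Cderive Cexp z (Cexp z).
Proof.
  intros eps He.
  assert (Hm : 0 < Cmod (Cexp z)) by apply Cmod_gt_0, Cexp_neq_0.
  set (m := Cmod (Cexp z)) in *.
  assert (Hq : 0 < eps / (20 * m)) by (apply Rdiv_lt_0_compat; lra).
  exists (Rmin (1/2) (eps / (20 * m))). split; [apply Rmin_pos; lra|].
  intros w Hw.
  assert (H1 : Cmod (w - z)%C < 1/2) by (eapply Rlt_le_trans; [exact Hw|apply Rmin_l]).
  assert (H2 : Cmod (w - z)%C < eps / (20 * m)) by (eapply Rlt_le_trans; [exact Hw|apply Rmin_r]).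
  replace (Cexp w - Cexp z - Cexp z * (w - z))%C with (Cexp z * (Cexp (w - z) - 1 - (w - z)))%C.
  2:{ replace (Cexp w) with (Cexp z * Cexp (w - z))%C by (rewrite <- Cexp_plus; f_equal; ring). ring. }
  rewrite Cmod_mult. fold m.
  assert (H3 := Cexp_taylor_1 (w - z)%C ltac:(lra)).
  set (r := Cmod (w - z)%C) in *.
  assert (0 <= r) by apply Cmod_ge_0.
  apply Rle_trans with (m * (20 * r ^ 2)); [apply Rmult_le_compat_l; lra|].
  assert (20 * m * r <= eps).
  { apply Rmult_le_reg_r with (/ (20 * m)); [apply Rinv_0_lt_compat; lra|].
    replace (20 * m * r * / (20 * m)) with r by (field; lra). unfold Rdiv in H2. lra. }
  nra.
Qed.

(** The remainder is exactly [(w - z)^2 / (w z^2)], and [delta] keeps [|w| > |z| / 2]. *)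
Lemma is_Cderive_inv (z : C) : z <> 0%C -> is_Cderive Cinv z (- / (z * z))%C.
Proof.
  intros Hz eps He.
  assert (Hm : 0 < Cmod z) by now apply Cmod_gt_0.
  set (m := Cmod z) in *.
  assert (Hm3 : 0 < m ^ 3) by (apply pow_lt; lra).
  exists (Rmin (m / 2) (eps * m ^ 3 / 2)). split; [apply Rmin_pos; nra|].
  intros w Hw.
  assert (H1 : Cmod (w - z)%C < m / 2) by (eapply Rlt_le_trans; [exact Hw|apply Rmin_l]).
  assert (H2 : Cmod (w - z)%C < eps * m ^ 3 / 2) by (eapply Rlt_le_trans; [exact Hw|apply Rmin_r]).
  assert (Hwm : m / 2 < Cmod w).
  { assert (T := Cmod_triangle w (z - w)%C). replace (w + (z - w))%C with z in T by ring.
    replace (z - w)%C with (- (w - z))%C in T by ring. rewrite Cmod_opp in T. fold m in T. lra. }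
  assert (Hw0 : w <> 0%C) by (apply Cmod_gt_0; lra).
  replace (/ w - / z - - / (z * z) * (w - z))%C with ((w - z) * (w - z) / (w * (z * z)))%C.
  2:{ field. split; assumption. }
  rewrite Cmod_div by (repeat apply Cmult_neq_0; assumption).
  rewrite !Cmod_mult. fold m.
  set (r := Cmod (w - z)%C) in *. set (v := Cmod w) in *.
  assert (0 <= r) by apply Cmod_ge_0.
  apply Rmult_le_reg_r with (v * (m * m)); [apply Rmult_lt_0_compat; [lra|nra]|].
  unfold Rdiv. rewrite Rmult_assoc, Rinv_l by (apply Rgt_not_eq, Rmult_lt_0_compat; [lra|nra]).
  rewrite Rmult_1_r.
  assert (r <= eps * (v * (m * m))).
  { apply Rle_trans with (eps * (m / 2 * (m * m))); [simpl in H2; lra|].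
    apply Rmult_le_compat_l; [lra|]. apply Rmult_le_compat_r; nra. }
  nra.
Qed.

Lemma ex_Cderive_plus (f g : C -> C) (z : C) :
  ex_Cderive f z -> ex_Cderive g z -> ex_Cderive (fun w => f w + g w)%C z.
Proof. intros [l Hl] [m Hm]. eexists. now apply is_Cderive_plus; eauto. Qed.

Lemma ex_Cderive_minus (f g : C -> C) (z : C) :
  ex_Cderive f z -> ex_Cderive g z -> ex_Cderive (fun w => f w - g w)%C z.
Proof. intros [l Hl] [m Hm]. eexists. now apply is_Cderive_minus; eauto. Qed.

Lemma ex_Cderive_mult (f g : C -> C) (z : C) :
  ex_Cderive f z -> ex_Cderive g z -> ex_Cderive (fun w => f w * g w)%C z.
Proof. intros [l Hl] [m Hm]. eexists. now apply is_Cderive_mult; eauto. Qed.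

Lemma ex_Cderive_comp (f g : C -> C) (z : C) :
  ex_Cderive f (g z) -> ex_Cderive g z -> ex_Cderive (fun w => f (g w)) z.
Proof. intros [l Hl] [m Hm]. eexists. now apply is_Cderive_comp; eauto. Qed.

Lemma ex_Cderive_inv (f : C -> C) (z : C) :
  f z <> 0%C -> ex_Cderive f z -> ex_Cderive (fun w => / f w)%C z.
Proof.
  intros Hz Hf. apply ex_Cderive_comp; [|exact Hf]. eexists. now apply is_Cderive_inv.
Qed.

Lemma ex_Cderive_const (c z : C) : ex_Cderive (fun _ => c) z.
Proof. eexists; apply is_Cderive_const. Qed.

Lemma ex_Cderive_id (z : C) : ex_Cderive (fun w => w) z.
Proof. eexists; apply is_Cderive_id. Qed.

Lemma ex_Cderive_Cexp (f : C -> C) (z : C) : ex_Cderive f z -> ex_Cderive (fun w => Cexp (f w)) z.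
Proof. intros Hf. apply ex_Cderive_comp; [|exact Hf]. eexists; apply is_Cderive_Cexp. Qed.

(** The modulus and the product structure on the plane have balls of different shape, so
    neighbourhoods are exchanged through [locally_C]. *)
Lemma ex_Cderive_continuous (f : C -> C) (z : C) :
  ex_Cderive f z -> @continuous C_UniformSpace C_UniformSpace f z.
Proof.
  intros [l Hl].
  assert (Hc : is_derive_C f z l) by now apply is_Cderive_is_derive.
  assert (H := @ex_derive_continuous C_AbsRing (AbsRing_NormedModule C_AbsRing) f z (ex_intro _ l Hc)).
  intros P HP. apply locally_C in HP. apply locally_C. exact (H P HP).
Qed.

(** * Cauchy's theorem on rectangles *)

Definition ex_CInt (f : R -> C) (a b : R) : Prop := @ex_RInt C_R_NormedModule f a b.
Definition CInt (f : R -> C) (a b : R) : C := @RInt C_R_CompleteNormedModule f a b.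
Notation is_CInt := (@is_RInt C_R_NormedModule).
Notation Rcont := (@continuous R_UniformSpace C_UniformSpace).

Lemma CInt_correct (f : R -> C) (a b : R) : ex_CInt f a b -> is_CInt f a b (CInt f a b).
Proof. exact (@RInt_correct C_R_CompleteNormedModule f a b). Qed.

Lemma CInt_unique (f : R -> C) (a b : R) (l : C) : is_CInt f a b l -> CInt f a b = l.
Proof. exact (@is_RInt_unique C_R_CompleteNormedModule f a b l). Qed.

Lemma ex_CInt_cont (f : R -> C) (a b : R) :
  a <= b -> (forall x, a <= x <= b -> Rcont f x) -> ex_CInt f a b.
Proof.
  intros H Hc. apply (@ex_RInt_continuous C_R_CompleteNormedModule).
  rewrite Rmin_left, Rmax_right by exact H. exact Hc.
Qed.

Lemma CInt_Chasles (f : R -> C) (a b c : R) :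
  ex_CInt f a b -> ex_CInt f b c -> CInt f a c = (CInt f a b + CInt f b c)%C.
Proof. intros H1 H2. symmetry. exact (@RInt_Chasles C_R_CompleteNormedModule f a b c H1 H2). Qed.

Lemma CInt_ext (f g : R -> C) (a b : R) :
  a <= b -> (forall x, a <= x <= b -> f x = g x) -> CInt f a b = CInt g a b.
Proof.
  intros Hab H. apply (@RInt_ext C_R_CompleteNormedModule).
  rewrite Rmin_left, Rmax_right by exact Hab. intros x Hx. apply H; lra.
Qed.

Lemma is_CInt_plus (f g : R -> C) (a b : R) (k l : C) :
  is_CInt f a b k -> is_CInt g a b l -> is_CInt (fun x => f x + g x)%C a b (k + l)%C.
Proof. intros; now apply (@is_RInt_plus C_R_NormedModule). Qed.

Lemma is_CInt_minus (f g : R -> C) (a b : R) (k l : C) :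
  is_CInt f a b k -> is_CInt g a b l -> is_CInt (fun x => f x - g x)%C a b (k - l)%C.
Proof. intros; now apply (@is_RInt_minus C_R_NormedModule). Qed.

Lemma is_CInt_pair (f : R -> C) (a b u v : R) :
  is_RInt (fun x => fst (f x)) a b u -> is_RInt (fun x => snd (f x)) a b v ->
  is_CInt f a b (u, v).
Proof. intros; now apply (@is_RInt_fct_extend_pair R_NormedModule R_NormedModule). Qed.

Lemma is_CInt_fst (f : R -> C) (a b : R) (l : C) :
  is_CInt f a b l -> is_RInt (fun x => fst (f x)) a b (fst l).
Proof. intros; now apply (@is_RInt_fct_extend_fst R_NormedModule R_NormedModule). Qed.

Lemma is_CInt_snd (f : R -> C) (a b : R) (l : C) :
  is_CInt f a b l -> is_RInt (fun x => snd (f x)) a b (snd l).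
Proof. intros; now apply (@is_RInt_fct_extend_snd R_NormedModule R_NormedModule). Qed.

(** The integral lives in a real normed module; linearity over the complex numbers is recovered from
    the two components. *)
Lemma is_CInt_scal (c : C) (f : R -> C) (a b : R) (l : C) :
  is_CInt f a b l -> is_CInt (fun x => c * f x)%C a b (c * l)%C.
Proof.
  intros H. assert (H1 := is_CInt_fst _ _ _ _ H). assert (H2 := is_CInt_snd _ _ _ _ H).
  destruct c as [p q]. unfold Cmult; simpl. apply is_CInt_pair; simpl.
  - apply (@is_RInt_minus R_NormedModule); apply (@is_RInt_scal R_NormedModule); assumption.
  - apply (@is_RInt_plus R_NormedModule); apply (@is_RInt_scal R_NormedModule); assumption.
Qed.

Lemma CInt_plus (f g : R -> C) (a b : R) : ex_CInt f a b -> ex_CInt g a b ->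
  CInt (fun x => f x + g x)%C a b = (CInt f a b + CInt g a b)%C.
Proof. intros; apply CInt_unique, is_CInt_plus; now apply CInt_correct. Qed.

Lemma CInt_minus (f g : R -> C) (a b : R) : ex_CInt f a b -> ex_CInt g a b ->
  CInt (fun x => f x - g x)%C a b = (CInt f a b - CInt g a b)%C.
Proof. intros; apply CInt_unique, is_CInt_minus; now apply CInt_correct. Qed.

Lemma CInt_scal (c : C) (f : R -> C) (a b : R) : ex_CInt f a b ->
  CInt (fun x => c * f x)%C a b = (c * CInt f a b)%C.
Proof. intros; apply CInt_unique, is_CInt_scal; now apply CInt_correct. Qed.

Lemma ex_CInt_minus (f g : R -> C) (a b : R) : ex_CInt f a b -> ex_CInt g a b ->
  ex_CInt (fun x => f x - g x)%C a b.
Proof. intros; eexists; apply is_CInt_minus; now apply CInt_correct. Qed.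

Lemma CInt_bound (f : R -> C) (g : R -> R) (a b lg : R) :
  a <= b -> (forall x, a <= x <= b -> Cmod (f x) <= g x) ->
  ex_CInt f a b -> is_RInt g a b lg -> Cmod (CInt f a b) <= lg.
Proof.
  intros Hab Hb Hf Hg. rewrite Cmod_norm.
  apply (@norm_RInt_le C_R_NormedModule f g a b); trivial.
  - intros x Hx. rewrite <- Cmod_norm. now apply Hb.
  - now apply CInt_correct.
Qed.

Lemma CInt_bound_const (f : R -> C) (M a b : R) :
  a <= b -> (forall x, a <= x <= b -> Cmod (f x) <= M) ->
  ex_CInt f a b -> Cmod (CInt f a b) <= (b - a) * M.
Proof.
  intros Hab Hb Hf. rewrite Cmod_norm.
  apply (@norm_RInt_le_const C_R_NormedModule f a b); trivial.
  - intros x Hx. rewrite <- Cmod_norm. now apply Hb.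
  - now apply CInt_correct.
Qed.

(* Counterclockwise contour integral over the boundary of [a, b] x [c, d]. *)
Definition Irect (f : C -> C) (a b c d : R) : C :=
  (CInt (fun x => f (x, c)) a b - CInt (fun x => f (x, d)) a b
   + Ci * (CInt (fun y => f (b, y)) c d - CInt (fun y => f (a, y)) c d))%C.

Notation Ccont := (@continuous C_UniformSpace C_UniformSpace).

(** Splitting and linearity of [Irect] ask for regularity on the boundary only, which admits
    integrands with a pole inside the rectangle. *)
Definition on_sides (P : C -> Prop) (a b c d : R) : Prop :=
  (forall x, a <= x <= b -> P (x, c) /\ P (x, d)) /\
  (forall y, c <= y <= d -> P (a, y) /\ P (b, y)).

Definition in_rect (P : C -> Prop) (a b c d : R) : Prop :=
  forall x y, a <= x <= b -> c <= y <= d -> P (x, y).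

Lemma in_rect_sides (P : C -> Prop) (a b c d : R) :
  a <= b -> c <= d -> in_rect P a b c d -> on_sides P a b c d.
Proof. intros H1 H2 H; split; intros; split; apply H; lra. Qed.

Lemma in_rect_sub (P : C -> Prop) (a b c d a' b' c' d' : R) :
  a <= a' -> b' <= b -> c <= c' -> d' <= d ->
  in_rect P a b c d -> in_rect P a' b' c' d'.
Proof. intros H1 H2 H3 H4 H x y Hx Hy. apply H; lra. Qed.

Lemma Rcont_horizontal (f : C -> C) (x y : R) : Ccont f (x, y) -> Rcont (fun t => f (t, y)) x.
Proof.
  intros H. apply (continuous_comp (U := R_UniformSpace) (V := C_UniformSpace) (fun t => (t, y) : C) f x); [|exact H].
  apply (continuous_comp_2 (U := R_UniformSpace) (V := R_UniformSpace) (W := R_UniformSpace) (X := C_UniformSpace)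
    (fun t : R => t) (fun _ : R => y) (fun a b : R => (a, b) : C)).
  - apply continuous_id.
  - apply continuous_const.
  - intros P [del HP]. exists del. intros [u v] Huv. exact (HP (u, v) Huv).
Qed.

Lemma Rcont_vertical (f : C -> C) (x y : R) : Ccont f (x, y) -> Rcont (fun t => f (x, t)) y.
Proof.
  intros H. apply (continuous_comp (U := R_UniformSpace) (V := C_UniformSpace) (fun t => (x, t) : C) f y); [|exact H].
  apply (continuous_comp_2 (U := R_UniformSpace) (V := R_UniformSpace) (W := R_UniformSpace) (X := C_UniformSpace)
    (fun _ : R => x) (fun t : R => t) (fun a b : R => (a, b) : C)).
  - apply continuous_const.
  - apply continuous_id.
  - intros P [del HP]. exists del. intros [u v] Huv. exact (HP (u, v) Huv).
Qed.

Lemma ex_CInt_horizontal (f : C -> C) (a b c : R) :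
  a <= b -> (forall x, a <= x <= b -> ex_Cderive f (x, c)) -> ex_CInt (fun x => f (x, c)) a b.
Proof.
  intros H Hf. apply ex_CInt_cont; [exact H|]. intros x Hx.
  now apply Rcont_horizontal, ex_Cderive_continuous, Hf.
Qed.

Lemma ex_CInt_vertical (f : C -> C) (a c d : R) :
  c <= d -> (forall y, c <= y <= d -> ex_Cderive f (a, y)) -> ex_CInt (fun y => f (a, y)) c d.
Proof.
  intros H Hf. apply ex_CInt_cont; [exact H|]. intros x Hx.
  now apply Rcont_vertical, ex_Cderive_continuous, Hf.
Qed.

Lemma Irect_split_x (f : C -> C) (a m b c d : R) :
  a <= m <= b -> c <= d ->
  on_sides (ex_Cderive f) a m c d -> on_sides (ex_Cderive f) m b c d ->
  Irect f a b c d = (Irect f a m c d + Irect f m b c d)%C.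
Proof.
  intros Hm Hcd [H1 H2] [H3 H4]. unfold Irect.
  rewrite (CInt_Chasles (fun x => f (x, c)) a m b), (CInt_Chasles (fun x => f (x, d)) a m b);
    try (apply ex_CInt_horizontal; [lra|]; intros; first [now apply H1 | now apply H3]).
  ring.
Qed.

Lemma Irect_split_y (f : C -> C) (a b c m d : R) :
  a <= b -> c <= m <= d ->
  on_sides (ex_Cderive f) a b c m -> on_sides (ex_Cderive f) a b m d ->
  Irect f a b c d = (Irect f a b c m + Irect f a b m d)%C.
Proof.
  intros Hm Hcd [H1 H2] [H3 H4]. unfold Irect.
  rewrite (CInt_Chasles (fun x => f (a, x)) c m d), (CInt_Chasles (fun x => f (b, x)) c m d);
    try (apply ex_CInt_vertical; [lra|]; intros; first [now apply H2 | now apply H4]).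
  ring.
Qed.

Lemma Irect_plus (f g : C -> C) (a b c d : R) :
  a <= b -> c <= d ->
  on_sides (ex_Cderive f) a b c d -> on_sides (ex_Cderive g) a b c d ->
  Irect (fun z => f z + g z)%C a b c d = (Irect f a b c d + Irect g a b c d)%C.
Proof.
  intros Hm Hcd [H1 H2] [H3 H4]. unfold Irect.
  assert (Ex : forall y, y = c \/ y = d -> CInt (fun x => f (x, y) + g (x, y))%C a b
    = (CInt (fun x => f (x, y)) a b + CInt (fun x => g (x, y)) a b)%C).
  { intros y Hy. apply (CInt_plus (fun x => f (x, y)) (fun x => g (x, y)));
    (apply ex_CInt_horizontal; [lra|]; intros; destruct Hy; subst; first [now apply H1 | now apply H3]). }
  assert (Ey : forall x, x = a \/ x = b -> CInt (fun y => f (x, y) + g (x, y))%C c d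
    = (CInt (fun y => f (x, y)) c d + CInt (fun y => g (x, y)) c d)%C).
  { intros x Hx. apply (CInt_plus (fun y => f (x, y)) (fun y => g (x, y)));
    (apply ex_CInt_vertical; [lra|]; intros; destruct Hx; subst; first [now apply H2 | now apply H4]). }
  rewrite !Ex, !Ey by tauto. ring.
Qed.

Lemma Irect_scal (k : C) (f : C -> C) (a b c d : R) :
  a <= b -> c <= d -> on_sides (ex_Cderive f) a b c d ->
  Irect (fun z => k * f z)%C a b c d = (k * Irect f a b c d)%C.
Proof.
  intros Hm Hcd [H1 H2]. unfold Irect.
  assert (Ex : forall y, y = c \/ y = d ->
    CInt (fun x => k * f (x, y))%C a b = (k * CInt (fun x => f (x, y)) a b)%C).
  { intros y Hy. apply (CInt_scal k (fun x => f (x, y))).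
    apply ex_CInt_horizontal; [lra|]; intros; destruct Hy; subst; now apply H1. }
  assert (Ey : forall x, x = a \/ x = b ->
    CInt (fun y => k * f (x, y))%C c d = (k * CInt (fun y => f (x, y)) c d)%C).
  { intros x Hx. apply (CInt_scal k (fun y => f (x, y))).
    apply ex_CInt_vertical; [lra|]; intros; destruct Hx; subst; now apply H2. }
  rewrite !Ex, !Ey by tauto. ring.
Qed.

Lemma Irect_ext (f g : C -> C) (a b c d : R) :
  a <= b -> c <= d -> on_sides (fun z => f z = g z) a b c d -> Irect f a b c d = Irect g a b c d.
Proof.
  intros Hm Hcd [H1 H2]. unfold Irect.
  rewrite (CInt_ext (fun x => f (x, c)) (fun x => g (x, c)) a b),
    (CInt_ext (fun x => f (x, d)) (fun x => g (x, d)) a b),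
    (CInt_ext (fun y => f (a, y)) (fun y => g (a, y)) c d),
    (CInt_ext (fun y => f (b, y)) (fun y => g (b, y)) c d);
    trivial; intros; first [now apply H1 | now apply H2].
Qed.

Lemma Irect_const (k : C) (a b c d : R) : Irect (fun _ => k) a b c d = 0%C.
Proof. unfold Irect. ring. Qed.

Lemma Irect_id (a b c d : R) : Irect (fun z => z) a b c d = 0%C.
Proof.
  assert (Hx : forall u v, is_RInt (fun x : R => x) u v (v ^ 2 / 2 - u ^ 2 / 2)).
  { intros u v. apply (is_RInt_derive (V := R_CompleteNormedModule) (fun x => x ^ 2 / 2) (fun x => x)).
    - intros x _. auto_derive; [trivial|field].
    - intros x _. apply continuous_id. }
  assert (Hk : forall k u v : R, is_RInt (fun _ : R => k) u v ((v - u) * k)).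
  { intros k u v. apply (@is_RInt_const R_NormedModule). }
  unfold Irect.
  rewrite (CInt_unique (fun x => (x, c)) a b (b ^ 2 / 2 - a ^ 2 / 2, (b - a) * c)),
    (CInt_unique (fun x => (x, d)) a b (b ^ 2 / 2 - a ^ 2 / 2, (b - a) * d)),
    (CInt_unique (fun y => (a, y)) c d ((d - c) * a, d ^ 2 / 2 - c ^ 2 / 2)),
    (CInt_unique (fun y => (b, y)) c d ((d - c) * b, d ^ 2 / 2 - c ^ 2 / 2));
    try (apply is_CInt_pair; simpl; first [apply Hx | apply Hk]).
  unfold Cminus, Cplus, Copp, Cmult, Ci, RtoC; simpl. f_equal; field.
Qed.

Lemma Irect_bound (f : C -> C) (a b c d M : R) :
  a <= b -> c <= d -> on_sides (ex_Cderive f) a b c d ->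
  on_sides (fun z => Cmod (f z) <= M) a b c d ->
  Cmod (Irect f a b c d) <= 2 * ((b - a) + (d - c)) * M.
Proof.
  intros Hm Hcd [H1 H2] [H3 H4]. unfold Irect.
  assert (B1 : Cmod (CInt (fun x => f (x, c)) a b) <= (b - a) * M).
  { apply CInt_bound_const; trivial; [intros; now apply H3|]. apply ex_CInt_horizontal; trivial; intros; now apply H1. }
  assert (B2 : Cmod (CInt (fun x => f (x, d)) a b) <= (b - a) * M).
  { apply CInt_bound_const; trivial; [intros; now apply H3|]. apply ex_CInt_horizontal; trivial; intros; now apply H1. }
  assert (B3 : Cmod (CInt (fun y => f (a, y)) c d) <= (d - c) * M).
  { apply CInt_bound_const; trivial; [intros; now apply H4|]. apply ex_CInt_vertical; trivial; intros; now apply H2. }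
  assert (B4 : Cmod (CInt (fun y => f (b, y)) c d) <= (d - c) * M).
  { apply CInt_bound_const; trivial; [intros; now apply H4|]. apply ex_CInt_vertical; trivial; intros; now apply H2. }
  assert (Cmod Ci = 1).
  { unfold Cmod, Ci; simpl. transitivity (sqrt 1); [f_equal; ring|apply sqrt_1]. }
  eapply Rle_trans; [apply Cmod_triangle|]. rewrite Cmod_mult, H, Rmult_1_l.
  assert (T1 := Cmod_triangle (CInt (fun x => f (x, c)) a b) (- CInt (fun x => f (x, d)) a b)%C).
  assert (T2 := Cmod_triangle (CInt (fun y => f (b, y)) c d) (- CInt (fun y => f (a, y)) c d)%C).
  rewrite Cmod_opp in T1, T2. unfold Cminus. lra.
Qed.

(** * Goursat's theorem by repeated quartering *)

(** If [P] failed on the whole rectangle it would fail on one of its quarters, and so on; the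
    failing rectangles shrink to a point [(u, v)], where the local clause contradicts them. A
    rectangle is encoded by its lower left corner and its scale [s] relative to [W] by [H]. *)
Lemma bisection_induction (P : R -> R -> R -> Prop) (x0 y0 W H : R) :
  0 <= W -> 0 <= H ->
  (forall x y s, 0 < s -> P x y (s / 2) -> P (x + s / 2 * W) y (s / 2) ->
     P x (y + s / 2 * H) (s / 2) -> P (x + s / 2 * W) (y + s / 2 * H) (s / 2) -> P x y s) ->
  (forall u v, x0 <= u <= x0 + W -> y0 <= v <= y0 + H ->
     exists delta, 0 < delta /\ forall x y s, 0 < s < delta ->
       x <= u <= x + s * W -> y <= v <= y + s * H -> P x y s) ->
  P x0 y0 1.
Proof.
  intros HW HH Hdiv Hloc. apply NNPP. intros Hn.
  pose (Q := fun p : R * R * R => let '(x, y, s) := p in 0 < s /\ ~ P x y s).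
  pose (S := {p : R * R * R | Q p}).
  pose (rel := fun p q : R * R * R => let '(x, y, s) := p in let '(x', y', s') := q in
    s' = s / 2 /\ x <= x' /\ x' + s' * W <= x + s * W /\ y <= y' /\ y' + s' * H <= y + s * H).
  (* Description turns the existence of a failing quarter into a function, which can then be
     iterated. *)
  assert (step : forall p : S, {q : S | rel (proj1_sig p) (proj1_sig q)}).
  { intros [[[x y] s] [Hs Hp]]. apply constructive_indefinite_description.
    assert (Hs2 : 0 < s / 2) by lra.
    assert (0 <= s / 2 * W) by (apply Rmult_le_pos; lra).
    assert (0 <= s / 2 * H) by (apply Rmult_le_pos; lra).
    assert (E : ~ P x y (s / 2) \/ ~ P (x + s / 2 * W) y (s / 2) \/
      ~ P x (y + s / 2 * H) (s / 2) \/ ~ P (x + s / 2 * W) (y + s / 2 * H) (s / 2)).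
    { apply NNPP. intros E. apply Hp. apply Hdiv; trivial; apply NNPP; tauto. }
    destruct E as [E|[E|[E|E]]].
    - exists (exist Q (x, y, s / 2) (conj Hs2 E)). simpl. lra.
    - exists (exist Q (x + s / 2 * W, y, s / 2) (conj Hs2 E)). simpl. lra.
    - exists (exist Q (x, y + s / 2 * H, s / 2) (conj Hs2 E)). simpl. lra.
    - exists (exist Q (x + s / 2 * W, y + s / 2 * H, s / 2) (conj Hs2 E)). simpl. lra. }
  pose (seq := nat_rect (fun _ => S) (exist Q (x0, y0, 1) (conj Rlt_0_1 Hn))
    (fun _ p => proj1_sig (step p))).
  pose (xs := fun n => fst (fst (proj1_sig (seq n)))).
  pose (ys := fun n => snd (fst (proj1_sig (seq n)))).
  pose (ss := fun n => snd (proj1_sig (seq n))).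
  assert (Hrel : forall n, ss (Datatypes.S n) = ss n / 2 /\
    xs n <= xs (Datatypes.S n) /\ xs (Datatypes.S n) + ss (Datatypes.S n) * W <= xs n + ss n * W /\
    ys n <= ys (Datatypes.S n) /\ ys (Datatypes.S n) + ss (Datatypes.S n) * H <= ys n + ss n * H).
  { intros n. unfold xs, ys, ss. simpl. destruct (step (seq n)) as [q Hq]; simpl.
    unfold rel in Hq. destruct (proj1_sig (seq n)) as [[x y] s].
    destruct (proj1_sig q) as [[x' y'] s']. exact Hq. }
  assert (HQ : forall n, 0 < ss n /\ ~ P (xs n) (ys n) (ss n)).
  { intros n. unfold xs, ys, ss.
    destruct (seq n) as [[[x y] s] Hq]; exact Hq. }
  assert (Hs : forall n, ss n = (1 / 2) ^ n).
  { induction n as [|n IH]; [reflexivity|]. destruct (Hrel n) as [E _]. rewrite E, IH. simpl. field. }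
  (* Nested intervals in one coordinate: the supremum of the left ends lies in every interval. *)
  assert (Hlim : forall (z : nat -> R) (L z0 : R), 0 <= L -> z 0%nat = z0 ->
    (forall n, z n <= z (Datatypes.S n) /\ z (Datatypes.S n) + ss (Datatypes.S n) * L <= z n + ss n * L) ->
    exists u, forall n, z n <= u <= z n + ss n * L).
  { intros z L z0 HL Hz0 Hz.
    assert (Hpos : forall n, 0 <= ss n * L) by (intros n; apply Rmult_le_pos; [left; apply HQ|exact HL]).
    assert (Hdec : forall n k, z (n + k)%nat + ss (n + k)%nat * L <= z n + ss n * L).
    { intros n k; induction k as [|k IH]; [rewrite Nat.add_0_r; lra|].
      rewrite Nat.add_succ_r. destruct (Hz (n + k)%nat). lra. }
    assert (Hinc : forall n k, z n <= z (n + k)%nat).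
    { intros n k; induction k as [|k IH]; [rewrite Nat.add_0_r; lra|].
      rewrite Nat.add_succ_r. destruct (Hz (n + k)%nat). lra. }
    destruct (completeness (fun r => exists n, r = z n)) as [u [Hu1 Hu2]].
    - exists (z 0%nat + ss 0%nat * L). intros r [n ->]. specialize (Hdec 0%nat n). specialize (Hpos n). simpl in *. lra.
    - exists (z 0%nat), 0%nat; reflexivity.
    - exists u. intros n; split.
      + apply Hu1. now exists n.
      + apply Hu2. intros r [k ->].
        specialize (Hdec n k). specialize (Hinc k n). rewrite (Nat.add_comm k n) in Hinc.
        specialize (Hpos (n + k)%nat). lra. }
  destruct (Hlim xs W x0 HW eq_refl) as [u Hu]; [intros n; split; apply Hrel|].
  destruct (Hlim ys H y0 HH eq_refl) as [v Hv]; [intros n; split; apply Hrel|].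
  assert (Hu0 := Hu 0%nat). assert (Hv0 := Hv 0%nat). rewrite Hs in Hu0, Hv0.
  change (xs 0%nat) with x0 in Hu0. change (ys 0%nat) with y0 in Hv0. simpl in Hu0, Hv0.
  destruct (Hloc u v) as [delta [Hd Hdelta]]; [lra|lra|].
  destruct (pow_lt_1_zero (1 / 2) ltac:(rewrite Rabs_pos_eq; lra) delta Hd) as [n Hpow].
  specialize (Hpow n (le_n n)). rewrite <- Hs, Rabs_pos_eq in Hpow by (left; apply HQ).
  apply (proj2 (HQ n)). apply Hdelta; [split; [apply HQ|exact Hpow]|apply Hu|apply Hv].
Qed.

Lemma Cmod_le_Rabs (x y : R) : Cmod (x, y) <= Rabs x + Rabs y.
Proof.
  replace (x, y) with ((RtoC x) + (0, y))%C by (unfold RtoC, Cplus; simpl; f_equal; ring).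
  eapply Rle_trans; [apply Cmod_triangle|]. rewrite Cmod_R.
  apply Rplus_le_compat_l. unfold Cmod; simpl.
  replace (0 * (0 * 1) + y * (y * 1)) with (Rsqr y) by (unfold Rsqr; ring).
  rewrite sqrt_Rsqr_abs. lra.
Qed.

Theorem Goursat (f : C -> C) (a b c d : R) :
  a <= b -> c <= d -> in_rect (ex_Cderive f) a b c d -> Irect f a b c d = 0%C.
Proof.
  intros Hab Hcd Hf. apply Cmod_eq_0.
  apply Rle_antisym; [|apply Cmod_ge_0].
  apply le_epsilon. intros eta Heta. rewrite Rplus_0_l.
  set (W := b - a). set (H := d - c).
  assert (HW : 0 <= W) by (unfold W; lra). assert (HH : 0 <= H) by (unfold H; lra).
  (* The bound is quadratic in the scale because four quarters contribute
     [4 eta (s / 2)^2 = eta s^2]. *)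
  pose (P := fun x y s => a <= x -> x + s * W <= b -> c <= y -> y + s * H <= d ->
    Cmod (Irect f x (x + s * W) y (y + s * H)) <= eta * s ^ 2).
  assert (HP : P a c 1).
  { apply bisection_induction with (W := W) (H := H); trivial.
    - intros x y s Hs P1 P2 P3 P4 I1 I2 I3 I4.
      assert (0 <= s / 2 * W) by (apply Rmult_le_pos; lra).
      assert (0 <= s / 2 * H) by (apply Rmult_le_pos; lra).
      specialize (P1 ltac:(lra) ltac:(lra) ltac:(lra) ltac:(lra)).
      specialize (P2 ltac:(lra) ltac:(lra) ltac:(lra) ltac:(lra)).
      specialize (P3 ltac:(lra) ltac:(lra) ltac:(lra) ltac:(lra)).
      specialize (P4 ltac:(lra) ltac:(lra) ltac:(lra) ltac:(lra)).
      replace (x + s / 2 * W + s / 2 * W) with (x + s * W) in * by field.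
      replace (y + s / 2 * H + s / 2 * H) with (y + s * H) in * by field.
      assert (sides : forall a' b' c' d', a <= a' -> a' <= b' -> b' <= b -> c <= c' -> c' <= d' -> d' <= d ->
        on_sides (ex_Cderive f) a' b' c' d').
      { intros a' b' c' d' Q1 Q2 Q3 Q4 Q5 Q6. apply in_rect_sides; trivial.
        now apply in_rect_sub with a b c d. }
      rewrite (Irect_split_x f x (x + s / 2 * W)); try lra; try (apply sides; lra).
      rewrite (Irect_split_y f x _ y (y + s / 2 * H)), (Irect_split_y f (x + s / 2 * W) _ y (y + s / 2 * H));
        try lra; try (apply sides; lra).
      eapply Rle_trans; [apply Cmod_triangle|].
      eapply Rle_trans; [apply Rplus_le_compat; apply Cmod_triangle|]. nra.
    - intros u v Hu Hv.
      assert (Hfz : ex_Cderive f (u, v)) by (apply Hf; unfold W, H in *; lra).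
      destruct Hfz as [l Hl].
      set (D := W + H). assert (HD : 0 <= D) by (unfold D; lra).
      (* The boundary estimate [2 (s D)] times the remainder [e (s D)] has to stay below [eta s^2];
         the [+ 1] covers a degenerate rectangle with [D = 0]. *)
      set (e := eta / (2 * D ^ 2 + 1)).
      assert (He : 0 < e) by (apply Rdiv_lt_0_compat; nra).
      destruct (Hl e He) as [del [Hdel Hloc]].
      exists (del / (D + 1)). split; [apply Rdiv_lt_0_compat; lra|].
      intros x y s [Hs Hs2] Hux Hvy I1 I2 I3 I4.
      assert (HsD : s * D < del).
      { apply Rle_lt_trans with (s * (D + 1)); [nra|].
        apply Rmult_lt_reg_r with (/ (D + 1)); [apply Rinv_0_lt_compat; lra|].
        rewrite Rmult_assoc, Rinv_r by lra. unfold Rdiv in Hs2. lra. }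
      assert (0 <= s * W) by (apply Rmult_le_pos; lra).
      assert (0 <= s * H) by (apply Rmult_le_pos; lra).
      (* [r] is [f] minus its first-order expansion at [(u, v)]; the affine function removed has
         contour integral 0. *)
      set (r := fun z => (f z + ((l * (u, v) - f (u, v)) + (- l) * z))%C).
      assert (dsub : forall g, (forall z, ex_Cderive g z) -> on_sides (ex_Cderive g) x (x + s * W) y (y + s * H)).
      { intros g Hg; split; intros; split; apply Hg. }
      assert (daff : forall z, ex_Cderive (fun z => (l * (u, v) - f (u, v)) + (- l) * z)%C z).
      { intros z. apply ex_Cderive_plus; [apply ex_Cderive_const|].
        apply ex_Cderive_mult; [apply ex_Cderive_const|apply ex_Cderive_id]. }
      assert (df : on_sides (ex_Cderive f) x (x + s * W) y (y + s * H)).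
      { apply in_rect_sides; [lra|lra|]. now apply in_rect_sub with a b c d. }
      assert (E : Irect f x (x + s * W) y (y + s * H) = Irect r x (x + s * W) y (y + s * H)).
      { unfold r. rewrite Irect_plus; [|lra|lra|exact df|apply dsub, daff].
        rewrite Irect_plus; [|lra|lra|apply dsub; intros; apply ex_Cderive_const|].
        2:{ apply dsub. intros. apply ex_Cderive_mult; [apply ex_Cderive_const|apply ex_Cderive_id]. }
        rewrite Irect_const, Irect_scal, Irect_id; [ring|lra|lra|apply dsub; apply ex_Cderive_id]. }
      rewrite E.
      eapply Rle_trans.
      { apply Irect_bound with (M := e * (s * D)); [lra|lra| |].
        - unfold r. split; intros; split; (apply ex_Cderive_plus; [apply df; assumption|apply daff]).
        - assert (key : forall x' y', x <= x' <= x + s * W -> y <= y' <= y + s * H ->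
            Cmod (r (x', y')) <= e * (s * D)).
          { intros x' y' Hx' Hy'.
            assert (Hm : Cmod ((x', y') - (u, v))%C <= s * D).
            { eapply Rle_trans; [apply Cmod_le_Rabs|]. simpl. unfold D.
              assert (Rabs (x' + - u) <= s * W) by (apply Rabs_le_between; lra).
              assert (Rabs (y' + - v) <= s * H) by (apply Rabs_le_between; lra). lra. }
            replace (r (x', y')) with (f (x', y') - f (u, v) - l * ((x', y') - (u, v)))%C by (unfold r; ring).
            eapply Rle_trans; [apply Hloc; lra|]. apply Rmult_le_compat_l; lra. }
          split; intros; split; apply key; lra. }
      replace (x + s * W - x + (y + s * H - y)) with (s * D) by (unfold D; ring).
      replace (2 * (s * D) * (e * (s * D))) with (e * (2 * D ^ 2) * s ^ 2) by ring.
      apply Rmult_le_compat_r; [nra|].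
      unfold e. apply Rmult_le_reg_r with (2 * D ^ 2 + 1); [nra|].
      unfold Rdiv. replace (eta * / (2 * D ^ 2 + 1) * (2 * D ^ 2) * (2 * D ^ 2 + 1)) with (eta * (2 * D ^ 2))
        by (field; nra).
      nra. }
  unfold P in HP. rewrite !Rmult_1_l in HP.
  replace (a + W) with b in HP by (unfold W; ring).
  replace (c + H) with d in HP by (unfold H; ring).
  specialize (HP ltac:(lra) ltac:(lra) ltac:(lra) ltac:(lra)). lra.
Qed.

(* A bounded isolated singularity is cut out by a square whose contour integral tends to 0. *)
Lemma Goursat_bounded_singularity (f : C -> C) (a b c d x0 y0 M delta : R) :
  a < x0 < b -> c < y0 < d -> 0 < delta ->
  in_rect (fun z => z <> (x0, y0) -> ex_Cderive f z) a b c d ->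
  (forall z, z <> (x0, y0) -> Cmod (z - (x0, y0))%C < delta -> Cmod (f z) <= M) ->
  Irect f a b c d = 0%C.
Proof.
  intros Hx Hy Hdelta Hf HM. apply Cmod_eq_0.
  apply Rle_antisym; [|apply Cmod_ge_0].
  apply le_epsilon. intros eta Heta. rewrite Rplus_0_l.
  assert (HM0 : 0 <= Rabs M) by apply Rabs_pos.
  (* The square of half-side [r] must lie in the rectangle and in the disc of radius [delta], and
     its boundary estimate [8 r |M|] must not exceed [eta]. *)
  set (r := Rmin (Rmin (Rmin (x0 - a) (b - x0)) (Rmin (y0 - c) (d - y0)))
     (Rmin (delta / 4) (eta / (8 * (Rabs M + 1))))).
  assert (Hq : 0 < eta / (8 * (Rabs M + 1))) by (apply Rdiv_lt_0_compat; lra).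
  assert (Hr : 0 < r) by (unfold r; repeat apply Rmin_pos; lra).
  assert (R1 : r <= x0 - a) by (unfold r; do 3 (eapply Rle_trans; [apply Rmin_l|]); apply Rle_refl).
  assert (R2 : r <= b - x0) by (unfold r; do 2 (eapply Rle_trans; [apply Rmin_l|]); apply Rmin_r).
  assert (R3 : r <= y0 - c) by (unfold r; eapply Rle_trans; [apply Rmin_l|]; eapply Rle_trans; [apply Rmin_r|]; apply Rmin_l).
  assert (R4 : r <= d - y0) by (unfold r; eapply Rle_trans; [apply Rmin_l|]; eapply Rle_trans; [apply Rmin_r|]; apply Rmin_r).
  assert (R5 : r <= delta / 4) by (unfold r; eapply Rle_trans; [apply Rmin_r|]; apply Rmin_l).
  assert (R6 : r <= eta / (8 * (Rabs M + 1))) by (unfold r; eapply Rle_trans; [apply Rmin_r|]; apply Rmin_r).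
  assert (off : forall x y, a <= x <= b -> c <= y <= d -> x <> x0 \/ y <> y0 -> ex_Cderive f (x, y)).
  { intros x y I1 I2 I3. apply Hf; trivial. intros E. injection E. tauto. }
  assert (sq : on_sides (ex_Cderive f) (x0 - r) (x0 + r) (y0 - r) (y0 + r)).
  { split; intros; split; (apply off; [lra|lra|]); first [right; lra | left; lra]. }
  rewrite (Irect_split_y f a b c (y0 - r) d); [|lra|lra| |];
    try (split; intros; split; (apply off; [lra|lra|]); first [right; lra | left; lra]).
  rewrite (Irect_split_y f a b (y0 - r) (y0 + r) d); [|lra|lra| |];
    try (split; intros; split; (apply off; [lra|lra|]); first [right; lra | left; lra]).
  rewrite (Irect_split_x f a (x0 - r) b (y0 - r) (y0 + r)); [|lra|lra| |];
    try (split; intros; split; (apply off; [lra|lra|]); first [right; lra | left; lra]).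
  rewrite (Irect_split_x f (x0 - r) (x0 + r) b (y0 - r) (y0 + r)); [|lra|lra|exact sq|];
    try (split; intros; split; (apply off; [lra|lra|]); first [right; lra | left; lra]).
  rewrite (Goursat f a b c), (Goursat f a b (y0 + r)), (Goursat f a (x0 - r)), (Goursat f (x0 + r) b);
    try lra; try (intros x y Ix Iy; apply off; [lra|lra|]; first [right; lra | left; lra]).
  rewrite !Cplus_0_l, !Cplus_0_r.
  eapply Rle_trans; [apply Irect_bound with (M := Rabs M); [lra|lra|exact sq|]|].
  - assert (key : forall x y, Rabs (x - x0) <= r -> Rabs (y - y0) <= r -> x <> x0 \/ y <> y0 ->
      Cmod (f (x, y)) <= Rabs M).
    { intros x y I1 I2 I3. eapply Rle_trans; [apply HM|apply Rle_abs].
      - intros E; injection E; tauto.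
      - eapply Rle_lt_trans; [apply Cmod_le_Rabs|]. simpl. unfold Rminus in *. lra. }
    split; intros; split; (apply key; [apply Rabs_le_between; lra|apply Rabs_le_between; lra|]);
      first [right; lra | left; lra].
  - replace (2 * (x0 + r - (x0 - r) + (y0 + r - (y0 - r))) * Rabs M) with (8 * r * Rabs M) by ring.
    apply Rle_trans with (8 * (Rabs M + 1) * r); [nra|].
    apply Rmult_le_reg_r with (/ (8 * (Rabs M + 1))); [apply Rinv_0_lt_compat; lra|].
    replace (8 * (Rabs M + 1) * r * / (8 * (Rabs M + 1))) with r by (field; lra). exact R6.
Qed.

(** * The trapezoidal rule for functions holomorphic on a strip *)

Definition pexp (h : R) (z : C) : C := Cexp (((0, - (2 * PI / h))%R : C) * z)%C.

(* Simple poles at the multiples of [h], with residue [h / (2 i pi)]; tends to [0] high in the upper half-plane and to [1] low in the lower one. *)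
Definition pkernel (h : R) (z : C) : C := (/ (1 - pexp h z))%C.

Lemma pexp_xy (h x y : R) :
  pexp h (x, y) = (exp (2 * PI / h * y) * cos (2 * PI / h * x), - (exp (2 * PI / h * y) * sin (2 * PI / h * x))).
Proof.
  unfold pexp, Cexp, Cmult; simpl.
  replace (0 * x - - (2 * PI / h) * y) with (2 * PI / h * y) by ring.
  replace (0 * y + - (2 * PI / h) * x) with (- (2 * PI / h * x)) by ring.
  rewrite cos_neg, sin_neg. f_equal; ring.
Qed.

Lemma pexp_period (h x y : R) : 0 < h -> pexp h (x + h, y) = pexp h (x, y).
Proof.
  intros Hh. rewrite !pexp_xy.
  replace (2 * PI / h * (x + h)) with (2 * PI / h * x + 2 * PI) by (field; lra).
  rewrite cos_plus, sin_plus, cos_2PI, sin_2PI. f_equal; ring.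
Qed.

Lemma pexp_period_Z (h x y : R) (k : Z) : 0 < h -> pexp h (x + IZR k * h, y) = pexp h (x, y).
Proof.
  intros Hh. revert x. induction k using Z.peano_ind; intros x.
  - f_equal. f_equal. ring.
  - unfold Z.succ. rewrite plus_IZR.
    replace (x + (IZR k + 1) * h) with (x + IZR k * h + h) by ring.
    now rewrite pexp_period, IHk.
  - unfold Z.pred. rewrite plus_IZR. rewrite <- (pexp_period h _ y Hh).
    replace (x + (IZR k + -1) * h + h) with (x + IZR k * h) by ring. apply IHk.
Qed.

Lemma Cmod_pexp (h x y : R) : Cmod (pexp h (x, y)) = exp (2 * PI / h * y).
Proof. unfold pexp. rewrite Cmod_Cexp. f_equal. simpl. ring. Qed.

Lemma exp_gt_1_pos (h y : R) : 0 < h -> 0 < y -> 1 + 2 * PI / h * y <= exp (2 * PI / h * y) /\ 0 < 2 * PI / h * y.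
Proof.
  intros Hh Hy. split; [apply exp_ineq1_le|].
  apply Rmult_lt_0_compat; [|exact Hy]. apply Rdiv_lt_0_compat; [|exact Hh]. assert (H := PI_RGT_0). lra.
Qed.

Lemma pexp_neq_1_off_axis (h x y : R) : 0 < h -> y <> 0 -> (1 - pexp h (x, y))%C <> 0%C.
Proof.
  intros Hh Hy E.
  assert (E1 : pexp h (x, y) = 1%C) by (replace (pexp h (x, y)) with (1 - (1 - pexp h (x, y)))%C by ring; rewrite E; ring).
  assert (E2 := Cmod_pexp h x y). rewrite E1, Cmod_1 in E2.
  assert (E3 : 2 * PI / h * y = 0) by (apply exp_inv; rewrite exp_0; auto).
  assert (HP := PI_RGT_0).
  apply Rmult_integral in E3. destruct E3 as [E3|E3]; [|tauto].
  assert (0 < 2 * PI / h) by (apply Rdiv_lt_0_compat; lra). lra.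
Qed.

(** On the real axis, with [t] the distance to the sampling point, the value 1 would force
    [sin (PI t / h) = 0] while [|PI t / h| <= PI / 2], hence [t = 0]. *)
Lemma pexp_neq_1 (h x y : R) (k : Z) :
  0 < h -> IZR k * h - h / 2 <= x <= IZR k * h + h / 2 -> (x, y) <> (IZR k * h, 0) ->
  (1 - pexp h (x, y))%C <> 0%C.
Proof.
  intros Hh Hx Hne. destruct (Req_dec y 0) as [->|Hy]; [|now apply pexp_neq_1_off_axis].
  set (t := x - IZR k * h).
  assert (Ht : - (h / 2) <= t <= h / 2) by (unfold t; lra).
  assert (Ht0 : t <> 0) by (intros E; apply Hne; f_equal; unfold t in E; lra).
  replace x with (t + IZR k * h) by (unfold t; ring).
  rewrite pexp_period_Z, pexp_xy by exact Hh.
  rewrite Rmult_0_r, exp_0. intros E. injection E as E _.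
  assert (HP := PI_RGT_0).
  assert (Ec : cos (2 * PI / h * t) = 1) by lra.
  assert (Es : sin (PI / h * t) * sin (PI / h * t) = 0).
  { replace (2 * PI / h * t) with (2 * (PI / h * t)) in Ec by (field; lra). rewrite cos_2a_sin in Ec. lra. }
  assert (Es' : sin (PI / h * t) = 0) by (apply Rmult_integral in Es; tauto).
  assert (Hb : - (PI / 2) <= PI / h * t <= PI / 2).
  { assert (0 < PI / h) by (apply Rdiv_lt_0_compat; lra).
    replace (PI / 2) with (PI / h * (h / 2)) by (field; lra). nra. }
  assert (0 < PI / h) by (apply Rdiv_lt_0_compat; lra).
  destruct (Rtotal_order t 0) as [Hneg|[Hz|Hpos]]; [|tauto|].
  - assert (0 < sin (- (PI / h * t))) by (apply sin_gt_0; nra). rewrite sin_neg in H0. lra.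
  - assert (0 < sin (PI / h * t)) by (apply sin_gt_0; nra). lra.
Qed.

Lemma ex_Cderive_pexp (h : R) (z : C) : ex_Cderive (pexp h) z.
Proof.
  apply ex_Cderive_Cexp. apply ex_Cderive_mult; [apply ex_Cderive_const|apply ex_Cderive_id].
Qed.

Lemma ex_Cderive_pkernel (h : R) (z : C) : (1 - pexp h z)%C <> 0%C -> ex_Cderive (pkernel h) z.
Proof.
  intros H. apply (ex_Cderive_inv (fun z => 1 - pexp h z)%C); [exact H|].
  apply ex_Cderive_minus; [apply ex_Cderive_const|apply ex_Cderive_pexp].
Qed.

Lemma Cmod_pkernel_upper (h x y : R) : 0 < h -> 0 < y ->
  Cmod (pkernel h (x, y)) <= / (exp (2 * PI / h * y) - 1).
Proof.
  intros Hh Hy. destruct (exp_gt_1_pos h y Hh Hy) as [H1 H2].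
  unfold pkernel. rewrite Cmod_inv by (apply pexp_neq_1_off_axis; lra).
  apply Rinv_le_contravar; [lra|].
  assert (T := Cmod_triangle (pexp h (x, y) - 1)%C 1%C).
  replace (pexp h (x, y) - 1 + 1)%C with (pexp h (x, y)) in T by ring.
  rewrite Cmod_pexp, Cmod_1 in T.
  replace (1 - pexp h (x, y))%C with (- (pexp h (x, y) - 1))%C by ring. rewrite Cmod_opp. lra.
Qed.

Lemma pkernel_minus_1 (h : R) (z : C) : (1 - pexp h z)%C <> 0%C ->
  (pkernel h z - 1)%C = (pexp h z * / (1 - pexp h z))%C.
Proof. intros H. unfold pkernel. field. exact H. Qed.

Lemma Cmod_pkernel_lower (h x y : R) : 0 < h -> 0 < y ->
  Cmod (pkernel h (x, (- y)%R) - 1)%C <= / (exp (2 * PI / h * y) - 1).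
Proof.
  intros Hh Hy. destruct (exp_gt_1_pos h y Hh Hy) as [H1 H2].
  assert (Hne : (1 - pexp h (x, (- y)%R))%C <> 0%C) by (apply pexp_neq_1_off_axis; lra).
  rewrite pkernel_minus_1 by exact Hne.
  rewrite Cmod_mult, Cmod_inv by exact Hne.
  assert (T := Cmod_triangle (1 - pexp h (x, (- y)%R))%C (pexp h (x, (- y)%R))%C).
  replace (1 - pexp h (x, (- y)%R) + pexp h (x, (- y)%R))%C with (RtoC 1) in T by ring.
  rewrite Cmod_1 in T. rewrite Cmod_pexp in *.
  replace (2 * PI / h * - y) with (- (2 * PI / h * y)) in * by ring.
  rewrite exp_Ropp in *. set (E := exp (2 * PI / h * y)) in *.
  assert (E1 : 1 < E) by lra.
  assert (E2 : / E < 1) by (rewrite <- Rinv_1; apply Rinv_lt_contravar; lra).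
  apply Rle_trans with (/ E * / (1 - / E)).
  - apply Rmult_le_compat_l; [left; apply Rinv_0_lt_compat; lra|].
    apply Rinv_le_contravar; lra.
  - right. field. lra.
Qed.

(** Halfway between two sampling points [pexp] is real and negative, so the denominator exceeds 1 at
    every height. This is why rectangles are cut along these vertical lines. *)
Lemma Cmod_pkernel_half (h y : R) (k : Z) : 0 < h ->
  Cmod (pkernel h ((IZR k * h + h / 2)%R, y)) <= 1 /\ (1 - pexp h ((IZR k * h + h / 2)%R, y))%C <> 0%C.
Proof.
  intros Hh.
  assert (E : (1 - pexp h ((IZR k * h + h / 2)%R, y))%C = RtoC (1 + exp (2 * PI / h * y))).
  { rewrite Rplus_comm, pexp_period_Z, pexp_xy by exact Hh.
    replace (2 * PI / h * (h / 2)) with PI by (field; lra). rewrite cos_PI, sin_PI.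
    unfold RtoC, Cminus, Cplus, Copp; simpl. f_equal; ring. }
  assert (Hp := exp_pos (2 * PI / h * y)).
  assert (Hne : (1 - pexp h ((IZR k * h + h / 2)%R, y))%C <> 0%C).
  { rewrite E. intros E'. apply RtoC_inj in E'. lra. }
  split; [|exact Hne]. unfold pkernel. rewrite Cmod_inv by exact Hne.
  rewrite E, Cmod_R, Rabs_pos_eq by lra.
  rewrite <- Rinv_1. apply Rinv_le_contravar; lra.
Qed.

(** By periodicity the two vertical sides cancel in Cauchy's theorem, so the integral over one
    period does not depend on the height. *)
Lemma CInt_periodic_shift (g : C -> C) (a h c d : R) :
  0 < h -> c <= d -> in_rect (ex_Cderive g) a (a + h) c d ->
  (forall y, g ((a + h)%R, y) = g (a, y)) ->
  CInt (fun x => g (x, c)) a (a + h) = CInt (fun x => g (x, d)) a (a + h).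
Proof.
  intros Hh Hcd Hg Hper.
  assert (G := Goursat g a (a + h) c d ltac:(lra) Hcd Hg). unfold Irect in G.
  rewrite (CInt_ext (fun y => g ((a + h)%R, y)) (fun y => g (a, y)) c d) in G by (trivial; intros; apply Hper).
  replace (CInt (fun x => g (x, c)) a (a + h)) with
    ((CInt (fun x => g (x, c)) a (a + h) - CInt (fun x => g (x, d)) a (a + h)
     + Ci * (CInt (fun y => g (a, y)) c d - CInt (fun y => g (a, y)) c d))
     + CInt (fun x => g (x, d)) a (a + h))%C by ring.
  rewrite G. ring.
Qed.

Lemma le_div_large_le_0 (r C0 Y : R) : 0 < Y -> 0 <= C0 ->
  (forall T, Y <= T -> r <= C0 / T) -> r <= 0.
Proof.
  intros HY HC H. apply le_epsilon. intros eps He. rewrite Rplus_0_l.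
  set (T := Y + C0 / eps).
  assert (0 <= C0 / eps) by (apply Rdiv_le_0_compat; lra).
  eapply Rle_trans; [apply (H T); unfold T; lra|].
  apply Rmult_le_reg_r with T; [unfold T; lra|].
  unfold Rdiv at 1. rewrite Rmult_assoc, Rinv_l by (unfold T; lra). rewrite Rmult_1_r.
  unfold T. rewrite Rmult_plus_distr_l. replace (eps * (C0 / eps)) with C0 by (field; lra). nra.
Qed.

Lemma inv_exp_minus_1_le (h y : R) : 0 < h -> 0 < y ->
  / (exp (2 * PI / h * y) - 1) <= h / (2 * PI) / y.
Proof.
  intros Hh Hy. destruct (exp_gt_1_pos h y Hh Hy) as [H1 H2]. assert (HP := PI_RGT_0).
  replace (h / (2 * PI) / y) with (/ (2 * PI / h * y)) by (field; repeat split; lra).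
  apply Rinv_le_contravar; lra.
Qed.

(** The integral is the same at every height [T >= Y], where it is of order [1 / T]; so it is 0. *)
Lemma CInt_pkernel_upper (h a Y : R) : 0 < h -> 0 < Y ->
  CInt (fun x => pkernel h (x, Y)) a (a + h) = 0%C.
Proof.
  intros Hh HY. apply Cmod_eq_0. apply Rle_antisym; [|apply Cmod_ge_0].
  assert (HP := PI_RGT_0).
  apply (le_div_large_le_0 _ (h * (h / (2 * PI))) Y HY).
  { apply Rmult_le_pos; [lra|]. apply Rdiv_le_0_compat; lra. }
  intros T HT.
  rewrite (CInt_periodic_shift (pkernel h) a h Y T Hh HT).
  - replace (h * (h / (2 * PI)) / T) with ((a + h - a) * (h / (2 * PI) / T)) by (field; lra).
    apply CInt_bound_const; [lra| |].
    + intros x Hx. eapply Rle_trans; [apply Cmod_pkernel_upper; lra|]. apply inv_exp_minus_1_le; lra.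
    + apply ex_CInt_horizontal; [lra|]. intros. apply ex_Cderive_pkernel, pexp_neq_1_off_axis; lra.
  - intros x y Hx Hy. apply ex_Cderive_pkernel, pexp_neq_1_off_axis; lra.
  - intros y. unfold pkernel. now rewrite pexp_period.
Qed.

Lemma CInt_const (k : C) (a b : R) : CInt (fun _ => k) a b = (RtoC (b - a) * k)%C.
Proof.
  apply CInt_unique. destruct k as [p q].
  replace (RtoC (b - a) * (p, q))%C with ((b - a) * p, (b - a) * q)
    by (unfold RtoC, Cmult; simpl; f_equal; ring).
  apply is_CInt_pair; apply (@is_RInt_const R_NormedModule).
Qed.

Lemma ex_CInt_const (k : C) (a b : R) : ex_CInt (fun _ => k) a b.
Proof. apply (@ex_RInt_const C_R_NormedModule). Qed.

(** The same argument applied to [pkernel h - 1], which decays downwards; the constant 1 contributes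
    the period [h]. *)
Lemma CInt_pkernel_lower (h a Y : R) : 0 < h -> 0 < Y ->
  CInt (fun x => pkernel h (x, (- Y)%R)) a (a + h) = RtoC h.
Proof.
  intros Hh HY. assert (HP := PI_RGT_0).
  assert (ex : forall T, 0 < T -> ex_CInt (fun x => pkernel h (x, (- T)%R)) a (a + h)).
  { intros T HT. apply ex_CInt_horizontal; [lra|]. intros. apply ex_Cderive_pkernel, pexp_neq_1_off_axis; lra. }
  assert (Z : (CInt (fun x => pkernel h (x, (- Y)%R)) a (a + h) - RtoC h)%C = 0%C).
  { apply Cmod_eq_0. apply Rle_antisym; [|apply Cmod_ge_0].
    apply (le_div_large_le_0 _ (h * (h / (2 * PI))) Y HY).
    { apply Rmult_le_pos; [lra|]. apply Rdiv_le_0_compat; lra. }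
    intros T HT.
    rewrite <- (CInt_periodic_shift (pkernel h) a h (- T) (- Y) Hh); [|lra| |].
    - replace (h * (h / (2 * PI)) / T) with ((a + h - a) * (h / (2 * PI) / T)) by (field; lra).
      replace (CInt (fun x => pkernel h (x, (- T)%R)) a (a + h) - RtoC h)%C with
        (CInt (fun x => pkernel h (x, (- T)%R) - 1)%C a (a + h)).
      + apply CInt_bound_const; [lra| |].
        * intros x Hx. eapply Rle_trans; [apply Cmod_pkernel_lower; lra|]. apply inv_exp_minus_1_le; lra.
        * apply (ex_CInt_minus (fun x => pkernel h (x, (- T)%R)) (fun _ => 1%C)); [apply ex; lra|apply ex_CInt_const].
      + rewrite (CInt_minus (fun x => pkernel h (x, (- T)%R)) (fun _ => 1%C)); [|apply ex; lra|apply ex_CInt_const].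
        rewrite CInt_const. replace (a + h - a) with h by ring. ring.
    - intros x y Hx Hy. apply ex_Cderive_pkernel, pexp_neq_1_off_axis; lra.
    - intros y. unfold pkernel. now rewrite pexp_period. }
  replace (CInt (fun x => pkernel h (x, (- Y)%R)) a (a + h)) with
   ((CInt (fun x => pkernel h (x, (- Y)%R)) a (a + h) - RtoC h) + RtoC h)%C by ring.
  rewrite Z. ring.
Qed.

Lemma Irect_pkernel (h a Y : R) : 0 < h -> 0 < Y -> Irect (pkernel h) a (a + h) (- Y) Y = RtoC h.
Proof.
  intros Hh HY. unfold Irect.
  rewrite CInt_pkernel_lower, CInt_pkernel_upper by assumption.
  rewrite (CInt_ext (fun y => pkernel h ((a + h)%R, y)) (fun y => pkernel h (a, y)) (- Y) Y).
  - ring.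
  - lra.
  - intros y _. unfold pkernel. now rewrite pexp_period.
Qed.

(** Near [z0] the numerator is at most [(|l| + 1) |z - z0|] and the denominator at least
    [(|m| / 2) |z - z0|]. The denominator has this form to match [1 - pexp h z], as [pexp] is 1 at a
    sampling point. *)
Lemma quotient_bounded (F G : C -> C) (z0 : C) :
  ex_Cderive F z0 -> (exists m : C, m <> 0%C /\ is_Cderive G z0 m) ->
  exists M delta, 0 < delta /\ forall z, z <> z0 -> Cmod (z - z0)%C < delta ->
    Cmod ((F z - F z0) * / (G z0 - G z))%C <= M.
Proof.
  intros [l Hl] [m [Hm Hg]].
  assert (Hm0 : 0 < Cmod m) by now apply Cmod_gt_0.
  destruct (Hl 1 Rlt_0_1) as [d1 [Hd1 H1]].
  destruct (Hg (Cmod m / 2) ltac:(lra)) as [d2 [Hd2 H2]].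
  exists ((Cmod l + 1) * (2 / Cmod m)), (Rmin d1 d2). split; [now apply Rmin_pos|].
  intros z Hz Hd.
  specialize (H1 z ltac:(eapply Rlt_le_trans; [exact Hd|apply Rmin_l])).
  specialize (H2 z ltac:(eapply Rlt_le_trans; [exact Hd|apply Rmin_r])).
  assert (Hr : 0 < Cmod (z - z0)%C).
  { apply Cmod_gt_0. intros E. apply Hz. replace z with ((z - z0) + z0)%C by ring. rewrite E. ring. }
  set (r := Cmod (z - z0)%C) in *.
  assert (B1 : Cmod (F z - F z0)%C <= (Cmod l + 1) * r).
  { replace (F z - F z0)%C with ((F z - F z0 - l * (z - z0)) + l * (z - z0))%C by ring.
    eapply Rle_trans; [apply Cmod_triangle|]. rewrite Cmod_mult. fold r. lra. }
  assert (B2 : Cmod m / 2 * r <= Cmod (G z0 - G z)%C).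
  { assert (T := Cmod_triangle (G z0 - G z)%C (G z - G z0 - m * (z - z0))%C).
    replace (G z0 - G z + (G z - G z0 - m * (z - z0)))%C with (- (m * (z - z0)))%C in T by ring.
    rewrite Cmod_opp, Cmod_mult in T. fold r in T. lra. }
  assert (Hpos : 0 < Cmod (G z0 - G z)%C) by (eapply Rlt_le_trans; [|exact B2]; nra).
  rewrite Cmod_mult, Cmod_inv by now apply Cmod_gt_0.
  apply Rle_trans with ((Cmod l + 1) * r * / (Cmod m / 2 * r)).
  - apply Rmult_le_compat; trivial; try apply Cmod_ge_0.
    + left; now apply Rinv_0_lt_compat.
    + apply Rinv_le_contravar; [nra|exact B2].
  - right. field. lra.
Qed.

(** A residue computed without Laurent expansions: subtracting [F z0] leaves a bounded singularity,
    which integrates to 0, and the remaining multiple of the kernel is integrated by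
    [Irect_pkernel]. *)
Lemma Irect_cell (F : C -> C) (h Y : R) (k : Z) :
  0 < h -> 0 < Y ->
  in_rect (ex_Cderive F) (IZR k * h - h / 2) (IZR k * h + h / 2) (- Y) Y ->
  Irect (fun z => F z * pkernel h z)%C (IZR k * h - h / 2) (IZR k * h + h / 2) (- Y) Y
  = (RtoC h * F (RtoC (IZR k * h)))%C.
Proof.
  intros Hh HY HF.
  set (a := IZR k * h - h / 2) in *. set (b := IZR k * h + h / 2) in *.
  set (z0 := RtoC (IZR k * h)).
  assert (Hab : b = a + h) by (unfold a, b; field).
  assert (Hk : forall x y, a <= x <= b -> (x, y) <> z0 -> ex_Cderive (pkernel h) (x, y)).
  { intros x y Hx Hne. apply ex_Cderive_pkernel. now apply pexp_neq_1 with k. }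
  assert (E1 : pexp h z0 = 1%C).
  { unfold z0, RtoC. replace (IZR k * h) with (0 + IZR k * h) by ring.
    rewrite pexp_period_Z, pexp_xy by exact Hh. rewrite !Rmult_0_r, exp_0, cos_0, sin_0.
    unfold RtoC. f_equal; ring. }
  assert (Hs : Irect (fun z => (F z - F z0) * pkernel h z)%C a b (- Y) Y = 0%C).
  { destruct (quotient_bounded F (pexp h) z0) as [M [delta [Hd HM]]].
    - apply HF; unfold a, b; lra.
    (* The derivative of [pexp] at [z0]: the two factors 1 are the derivative of the identity and
       the value of [pexp] at [z0]. *)
    - exists (((0, - (2 * PI / h))%R : C) * 1 * 1)%C. split.
      + intros E. injection E as E. assert (HP := PI_RGT_0).
        assert (0 < 2 * PI / h) by (apply Rdiv_lt_0_compat; lra). lra.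
      + unfold pexp. eapply is_Cderive_eq.
        * apply (is_Cderive_comp Cexp (fun z => ((0, - (2 * PI / h))%R : C) * z)%C);
            [apply is_Cderive_Cexp|apply is_Cderive_scal, is_Cderive_id].
        * change (Cexp (((0, - (2 * PI / h))%R : C) * z0)) with (pexp h z0). rewrite E1. reflexivity.
    - apply Goursat_bounded_singularity with (IZR k * h) 0 M delta; [unfold a, b; lra|lra|exact Hd| |].
      + intros x y Hx Hy Hne. apply ex_Cderive_mult.
        * apply ex_Cderive_minus; [now apply HF|apply ex_Cderive_const].
        * now apply Hk.
      + intros z Hz Hdz. specialize (HM z Hz Hdz). rewrite E1 in HM. exact HM. }
  assert (side : on_sides (fun z => ex_Cderive F z /\ ex_Cderive (pkernel h) z) a b (- Y) Y).
  { split; intros; split; split; try (apply HF; lra);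
      apply Hk; try lra; intros E; injection E; unfold a, b in *; lra. }
  destruct side as [S1 S2].
  rewrite (Irect_ext _ (fun z => (F z - F z0) * pkernel h z + F z0 * pkernel h z)%C); [|lra|lra|].
  2:{ split; intros; split; ring. }
  rewrite (Irect_plus (fun z => (F z - F z0) * pkernel h z)%C (fun z => F z0 * pkernel h z)%C); [|lra|lra| |].
  - rewrite Hs, Irect_scal; [|lra|lra|split; intros; split; first [now apply S1 | now apply S2]].
    rewrite Hab, Irect_pkernel by assumption. ring.
  - split; intros; split; (apply ex_Cderive_mult; [apply ex_Cderive_minus; [|apply ex_Cderive_const]|]);
      first [now apply S1 | now apply S2].
  - split; intros; split; (apply ex_Cderive_mult; [apply ex_Cderive_const|]);
      first [now apply S1 | now apply S2].
Qed.

(** There are [p + 1] cells; neighbours share a vertical side halfway between sampling points, where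
    the kernel has no pole. *)
Lemma Irect_cells (F : C -> C) (h Y : R) (lo : Z) (p : nat) :
  0 < h -> 0 < Y ->
  (forall x y, - Y <= y <= Y -> ex_Cderive F (x, y)) ->
  Irect (fun z => F z * pkernel h z)%C (IZR lo * h - h / 2) (IZR (lo + Z.of_nat p) * h + h / 2) (- Y) Y
  = (RtoC h * sum_n_m (fun j => F (RtoC (IZR (lo + Z.of_nat j) * h))) 0 p)%C.
Proof.
  intros Hh HY HF.
  assert (Hhalf : forall k y, - Y <= y <= Y -> ex_Cderive (fun z => F z * pkernel h z)%C ((IZR k * h + h / 2)%R, y)).
  { intros k y Hy. apply ex_Cderive_mult; [now apply HF|]. apply ex_Cderive_pkernel.
    now apply Cmod_pkernel_half. }
  assert (Hoff : forall x y, y = - Y \/ y = Y -> ex_Cderive (fun z => F z * pkernel h z)%C (x, y)).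
  { intros x y Hy. apply ex_Cderive_mult; [apply HF; lra|]. apply ex_Cderive_pkernel.
    apply pexp_neq_1_off_axis; lra. }
  assert (Hlo : forall k, IZR k * h - h / 2 = IZR (k - 1) * h + h / 2).
  { intros k. rewrite minus_IZR. field. }
  induction p as [|p IH].
  - rewrite sum_n_n. replace (lo + Z.of_nat 0)%Z with lo by lia.
    apply Irect_cell; trivial. intros x y _ Hy. now apply HF.
  - rewrite sum_n_Sm by lia.
    change (plus ?u ?v) with (Cplus u v).
    rewrite Cmult_plus_distr_l, <- IH.
    assert (Hpos : 0 <= INR p * h) by (apply Rmult_le_pos; [apply pos_INR|lra]).
    rewrite (Irect_split_x _ _ (IZR (lo + Z.of_nat p) * h + h / 2)).
    + f_equal.
      replace (IZR (lo + Z.of_nat p) * h + h / 2) with (IZR (lo + Z.of_nat (S p)) * h - h / 2).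
      2:{ rewrite !plus_IZR, <- !INR_IZR_INZ, S_INR. field. }
      apply Irect_cell; trivial. intros x y _ Hy. now apply HF.
    + rewrite !plus_IZR, <- !INR_IZR_INZ, S_INR. nra.
    + lra.
    + split; intros; split; try (apply Hoff; tauto); [rewrite Hlo|]; now apply Hhalf.
    + split; intros; split; try (apply Hoff; tauto); now apply Hhalf.
Qed.

(** The term [6 Y m] collects the vertical sides: two of length [2 Y] from the integral with the
    kernel, two of length [Y] from the integral of [F] alone. *)
Theorem trapezoid_finite (F : C -> C) (g : R -> R) (h Y lg m : R) (lo : Z) (p : nat) :
  let A := IZR lo * h - h / 2 in
  let B := IZR (lo + Z.of_nat p) * h + h / 2 in
  0 < h -> 0 < Y ->
  (forall x y, - Y <= y <= Y -> ex_Cderive F (x, y)) ->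
  (forall x, A <= x <= B -> Cmod (F (x, Y)) <= g x /\ Cmod (F (x, (- Y)%R)) <= g x) ->
  is_RInt g A B lg ->
  (forall y, - Y <= y <= Y -> Cmod (F (A, y)) <= m /\ Cmod (F (B, y)) <= m) ->
  Cmod (RtoC h * sum_n_m (fun j => F (RtoC (IZR (lo + Z.of_nat j) * h))) 0 p
        - CInt (fun x => F (x, 0)) A B)%C
  <= 2 * (lg / (exp (2 * PI / h * Y) - 1)) + 6 * Y * m.
Proof.
  intros A B Hh HY HF Hg Hlg Hm.
  assert (HAB : A <= B).
  { unfold A, B. rewrite plus_IZR, <- INR_IZR_INZ. assert (H := pos_INR p). nra. }
  rewrite <- (Irect_cells F h Y lo p Hh HY HF). fold A B.
  (* Applied to [F] without the kernel on the lower half of the rectangle, Cauchy's theorem carries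
     the integral from height [- Y] to the real axis. *)
  assert (G := Goursat F A B (- Y) 0 HAB ltac:(lra) (fun x y _ Hy => HF x y ltac:(lra))).
  assert (HA : forall y, Cmod (pkernel h (A, y)) <= 1 /\ (1 - pexp h (A, y))%C <> 0%C).
  { intros y. replace A with (IZR (lo - 1) * h + h / 2) by (unfold A; rewrite minus_IZR; field).
    now apply Cmod_pkernel_half. }
  assert (HB : forall y, Cmod (pkernel h (B, y)) <= 1 /\ (1 - pexp h (B, y))%C <> 0%C)
    by (intros; now apply Cmod_pkernel_half).
  unfold Irect in *.
  set (q := / (exp (2 * PI / h * Y) - 1)).
  destruct (exp_gt_1_pos h Y Hh HY) as [Q1 Q2].
  assert (Hq : 0 < q) by (apply Rinv_0_lt_compat; lra).
  assert (exk : forall y, y = - Y \/ y = Y -> forall x, ex_Cderive (pkernel h) (x, y)).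
  { intros y Hy x. apply ex_Cderive_pkernel, pexp_neq_1_off_axis; lra. }
  assert (Elow : CInt (fun x => F (x, (- Y)%R) * pkernel h (x, (- Y)%R))%C A B =
    (CInt (fun x => F (x, (- Y)%R)) A B + CInt (fun x => F (x, (- Y)%R) * (pkernel h (x, (- Y)%R) - 1))%C A B)%C).
  { rewrite <- (CInt_plus (fun x => F (x, (- Y)%R)) (fun x => F (x, (- Y)%R) * (pkernel h (x, (- Y)%R) - 1))%C).
    - apply CInt_ext; [exact HAB|]. intros; ring.
    - apply ex_CInt_horizontal; trivial. intros; apply HF; lra.
    - apply (ex_CInt_horizontal (fun z => F z * (pkernel h z - 1))%C); trivial. intros x Hx.
      apply ex_Cderive_mult; [apply HF; lra|]. apply ex_Cderive_minus; [apply exk; tauto|apply ex_Cderive_const]. }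
  rewrite Elow.
  assert (Hlq : is_RInt (fun x => q * g x) A B (q * lg)) by (now apply (@is_RInt_scal R_NormedModule)).
  assert (B1 : Cmod (CInt (fun x => F (x, (- Y)%R) * (pkernel h (x, (- Y)%R) - 1))%C A B) <= q * lg).
  { apply CInt_bound with (fun x => q * g x); trivial.
    - intros x Hx. rewrite Cmod_mult, Rmult_comm.
      apply Rmult_le_compat; try apply Cmod_ge_0; [now apply Cmod_pkernel_lower|now apply Hg].
    - apply (ex_CInt_horizontal (fun z => F z * (pkernel h z - 1))%C); trivial. intros x Hx.
      apply ex_Cderive_mult; [apply HF; lra|]. apply ex_Cderive_minus; [apply exk; tauto|apply ex_Cderive_const]. }
  assert (B2 : Cmod (CInt (fun x => F (x, Y) * pkernel h (x, Y))%C A B) <= q * lg).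
  { apply CInt_bound with (fun x => q * g x); trivial.
    - intros x Hx. rewrite Cmod_mult, Rmult_comm.
      apply Rmult_le_compat; try apply Cmod_ge_0; [now apply Cmod_pkernel_upper|now apply Hg].
    - apply (ex_CInt_horizontal (fun z => F z * pkernel h z)%C); trivial. intros x Hx.
      apply ex_Cderive_mult; [apply HF; lra|]. apply exk; tauto. }
  assert (Hm0 : 0 <= m) by (eapply Rle_trans; [apply Cmod_ge_0|apply (Hm 0); lra]).
  assert (vert : forall X, (forall y, - Y <= y <= Y -> Cmod (F (X, y)) <= m) ->
    (forall y, Cmod (pkernel h (X, y)) <= 1 /\ (1 - pexp h (X, y))%C <> 0%C) ->
    Cmod (CInt (fun y => F (X, y) * pkernel h (X, y))%C (- Y) Y) <= (Y - - Y) * m /\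
    Cmod (CInt (fun y => F (X, y)) (- Y) 0) <= (0 - - Y) * m).
  { intros X HX1 HX2. split.
    - apply CInt_bound_const; [lra| |].
      + intros y Hy. rewrite Cmod_mult. specialize (HX1 y Hy). destruct (HX2 y) as [HX3 _].
        assert (P1 := Cmod_ge_0 (F (X, y))). assert (P2 := Cmod_ge_0 (pkernel h (X, y))). nra.
      + apply (ex_CInt_vertical (fun z => F z * pkernel h z)%C); [lra|]. intros y Hy.
        apply ex_Cderive_mult; [now apply HF|]. apply ex_Cderive_pkernel, HX2.
    - apply CInt_bound_const; [lra| |].
      + intros y Hy. apply HX1; lra.
      + apply ex_CInt_vertical; [lra|]. intros; apply HF; lra. }
  destruct (vert A (fun y Hy => proj1 (Hm y Hy)) HA) as [A1 A2].
  destruct (vert B (fun y Hy => proj2 (Hm y Hy)) HB) as [C1 C2].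
  revert B1 B2 A1 A2 C1 C2 G.
  generalize (CInt (fun x => F (x, (- Y)%R) * (pkernel h (x, (- Y)%R) - 1))%C A B) as i1.
  generalize (CInt (fun x => F (x, Y) * pkernel h (x, Y))%C A B) as i2.
  generalize (CInt (fun y => F (A, y) * pkernel h (A, y))%C (- Y) Y) as i3.
  generalize (CInt (fun y => F (A, y)) (- Y) 0) as i4.
  generalize (CInt (fun y => F (B, y) * pkernel h (B, y))%C (- Y) Y) as i5.
  generalize (CInt (fun y => F (B, y)) (- Y) 0) as i6.
  generalize (CInt (fun x => F (x, (- Y)%R)) A B) as i7.
  generalize (CInt (fun x => F (x, 0)) A B) as i8.
  intros i8 i7 i6 i5 i4 i3 i2 i1 B1 B2 A1 A2 C1 C2 G.
  replace (i7 + i1 - i2 + Ci * (i5 - i3) - i8)%C with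
    ((i7 - i8 + Ci * (i6 - i4)) + ((i1 + - i2) + Ci * ((i5 + - i3) + (- i6 + i4))))%C by ring.
  rewrite G, Cplus_0_l.
  assert (HCi : Cmod Ci = 1).
  { unfold Cmod, Ci; simpl. transitivity (sqrt 1); [f_equal; ring|apply sqrt_1]. }
  eapply Rle_trans; [apply Cmod_triangle|]. rewrite Cmod_mult, HCi, Rmult_1_l.
  assert (T1 := Cmod_triangle i1 (- i2)%C).
  assert (T2 := Cmod_triangle (i5 + - i3)%C (- i6 + i4)%C).
  assert (T3 := Cmod_triangle i5 (- i3)%C). assert (T4 := Cmod_triangle (- i6)%C i4).
  rewrite Cmod_opp in T1, T3, T4.
  change (lg / (exp (2 * PI / h * Y) - 1)) with (lg * q). lra.
Qed.

(** * The double exponential transformation *)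

Lemma MVT_is_derive (g dg : R -> R) (a b : R) : a < b ->
  (forall x, is_derive g x (dg x)) -> exists c, a < c < b /\ g b - g a = dg c * (b - a).
Proof.
  intros Hab Hg.
  destruct (MVT_cor2 g dg a b Hab) as [c [E Hc]].
  - intros x _. apply is_derive_Reals, Hg.
  - exists c. split; assumption.
Qed.

Lemma exp_le_compat (x y : R) : x <= y -> exp x <= exp y.
Proof. intros [H| ->]; [left; now apply exp_increasing|apply Rle_refl]. Qed.

Lemma u_cos_le (u : R) : 0 <= u <= PI / 2 -> u * cos u <= (PI ^ 2 / 4 - u ^ 2) * sin u.
Proof.
  intros [Hu0 Hu1].
  destruct (Req_dec u 0) as [->|N0]; [rewrite sin_0; lra|].
  destruct (Req_dec u (PI / 2)) as [->|N1]; [rewrite cos_PI2; right; field|].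
  pose (k := fun u => (PI ^ 2 / 4 - u ^ 2) * sin u - u * cos u).
  pose (k1 := fun u => (PI ^ 2 / 4 - 1 - u ^ 2) * cos u - u * sin u).
  pose (k2 := fun u => - (3 * u * cos u + (PI ^ 2 / 4 - u ^ 2) * sin u)).
  assert (D1 : forall x, is_derive k x (k1 x)).
  { intros x. unfold k, k1. auto_derive; [trivial|field]. }
  assert (D2 : forall x, is_derive k1 x (k2 x)).
  { intros x. unfold k1, k2. auto_derive; [trivial|field]. }
  (* [k] vanishes at both ends. A negative value at [u] would give a negative slope before [u], a
     positive one after it, and so a positive second derivative in between. *)
  apply Rnot_lt_le. intros Hk.
  assert (Hku : k u < 0) by (unfold k; lra).
  assert (K0 : k 0 = 0) by (unfold k; rewrite sin_0; ring).
  assert (K1 : k (PI / 2) = 0) by (unfold k; rewrite sin_PI2, cos_PI2; field).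
  destruct (MVT_is_derive k k1 0 u ltac:(lra) D1) as [c1 [C1 E1]].
  destruct (MVT_is_derive k k1 u (PI / 2) ltac:(lra) D1) as [c2 [C2 E2]].
  destruct (MVT_is_derive k1 k2 c1 c2 ltac:(lra) D2) as [c3 [C3 E3]].
  assert (H1 : k1 c1 < 0) by nra. assert (H2 : 0 < k1 c2) by nra.
  assert (H3 : k2 c3 <= 0).
  { unfold k2. assert (0 <= sin c3) by (apply sin_ge_0; lra). assert (0 <= cos c3) by (apply cos_ge_0; lra).
    assert (0 <= PI ^ 2 / 4 - c3 ^ 2) by nra.
    assert (0 <= 3 * c3 * cos c3) by (apply Rmult_le_pos; lra).
    assert (0 <= (PI ^ 2 / 4 - c3 ^ 2) * sin c3) by (apply Rmult_le_pos; lra). lra. }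
  nra.
Qed.

(** Up to [PI] this is the concavity of the sine. Beyond [PI], [X - u >= 1] and
    [sin u + cos u >= 1], so the tangent line is already above 1. *)
Lemma Rabs_sin_le_tangent (u X : R) : 0 <= u <= PI / 2 -> u <= X ->
  Rabs (sin X) <= sin u + cos u * (X - u).
Proof.
  intros Hu HX. assert (HP := PI2_1).
  assert (S0 : 0 <= sin u) by (apply sin_ge_0; lra). assert (C0 : 0 <= cos u) by (apply cos_ge_0; lra).
  destruct (Rle_dec X PI) as [HXP|HXP].
  - rewrite Rabs_pos_eq by (apply sin_ge_0; lra).
    destruct HX as [HX| <-]; [|lra].
    destruct (MVT_is_derive sin cos u X HX) as [c [Hc E]].
    { intros x. apply is_derive_Reals, derivable_pt_lim_sin. }
    assert (cos c <= cos u) by (apply cos_decr_1; lra). nra.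
  - assert (B := SIN_bound X). apply Rle_trans with 1; [apply Rabs_le_between; lra|].
    assert (E := sin2_cos2 u). unfold Rsqr in E.
    assert (sin u <= 1) by apply SIN_bound. assert (cos u <= 1) by apply COS_bound. nra.
Qed.

Lemma is_derive_sinh (x : R) : is_derive sinh x (cosh x).
Proof. unfold sinh, cosh. auto_derive; [trivial|field]. Qed.

Lemma cosh_sqr (x : R) : cosh x ^ 2 = 1 + sinh x ^ 2.
Proof.
  unfold cosh, sinh. assert (E : exp x * exp (- x) = 1) by (rewrite <- exp_plus, <- exp_0; f_equal; ring).
  nra.
Qed.

Lemma cosh_ge_1 (x : R) : 1 <= cosh x.
Proof.
  assert (E := cosh_sqr x). assert (0 < cosh x).
  { unfold cosh. assert (H1 := exp_pos x). assert (H2 := exp_pos (- x)). lra. }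
  nra.
Qed.

Lemma sinh_opp (x : R) : sinh (- x) = - sinh x.
Proof. unfold sinh. rewrite Ropp_involutive. field. Qed.

Lemma cosh_opp (x : R) : cosh (- x) = cosh x.
Proof. unfold cosh. rewrite Ropp_involutive. field. Qed.

Lemma sinh_ge_id (x : R) : 0 <= x -> x <= sinh x.
Proof.
  intros [Hx| <-]; [|rewrite sinh_0; lra].
  destruct (MVT_is_derive sinh cosh 0 x Hx is_derive_sinh) as [c [_ E]].
  rewrite sinh_0 in E. assert (H := cosh_ge_1 c). nra.
Qed.

(** From [cosh t = 1 + 2 sinh (t / 2)^2] and [|sinh s| >= |s|]. *)
Lemma cosh_ge_quadratic (t : R) : 1 + t ^ 2 / 2 <= cosh t.
Proof.
  assert (E : cosh t = 1 + 2 * sinh (t / 2) ^ 2).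
  { replace (cosh t) with (cosh (t / 2) ^ 2 + sinh (t / 2) ^ 2); [rewrite cosh_sqr; ring|].
    unfold cosh, sinh. replace t with (t / 2 + t / 2) at 5 by field.
    replace (- t) with (- (t / 2) + - (t / 2)) by field. rewrite !exp_plus. field. }
  assert (Hs : forall s, s ^ 2 <= sinh s ^ 2).
  { intros s. destruct (Rle_dec 0 s) as [H|H].
    - assert (H1 := sinh_ge_id s H). apply pow_incr; lra.
    - assert (H1 := sinh_ge_id (- s) ltac:(lra)). rewrite sinh_opp in H1.
      replace (s ^ 2) with ((- s) ^ 2) by ring. replace (sinh s ^ 2) with ((- sinh s) ^ 2) by ring.
      apply pow_incr; lra. }
  specialize (Hs (t / 2)). rewrite E. nra.
Qed.

(** The tangent is taken at [u = (PI / 2) sin y], which leaves [u cos u (cosh x - 1)] to be bounded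
    by the quadratic term of [cosh]. The square there equals [(PI^2 / 4 - u^2) (cosh x^2 - 1)], so
    [u_cos_le] reduces the claim to [cosh x - 1 <= (cosh x^2 - 1) / 2]. *)
Lemma Rabs_sin_cosh_le (x y : R) : 0 <= y < PI / 2 ->
  Rabs (sin (PI / 2 * cosh x * sin y)) <= sin (PI / 2 * sin y) * cosh (PI / 2 * sinh x * cos y).
Proof.
  intros Hy. assert (HP := PI2_1).
  assert (S0 : 0 <= sin y) by (apply sin_ge_0; lra). assert (S1 : sin y <= 1) by apply SIN_bound.
  set (u := PI / 2 * sin y). assert (Hu : 0 <= u <= PI / 2) by (unfold u; nra).
  assert (HC := cosh_ge_1 x).
  replace (PI / 2 * cosh x * sin y) with (u * cosh x) by (unfold u; ring).
  eapply Rle_trans; [apply (Rabs_sin_le_tangent u); [exact Hu|nra]|].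
  assert (Su : 0 <= sin u) by (apply sin_ge_0; lra).
  assert (Hk := u_cos_le u Hu).
  apply Rle_trans with (sin u * (1 + (PI / 2 * sinh x * cos y) ^ 2 / 2)).
  2:{ apply Rmult_le_compat_l; [exact Su|apply cosh_ge_quadratic]. }
  assert (E : (PI / 2 * sinh x * cos y) ^ 2 = (PI ^ 2 / 4 - u ^ 2) * (cosh x ^ 2 - 1)).
  { rewrite cosh_sqr. assert (E := sin2_cos2 y). unfold Rsqr in E. unfold u.
    replace ((PI / 2 * sinh x * cos y) ^ 2) with (PI ^ 2 / 4 * sinh x ^ 2 * (cos y * cos y)) by field.
    replace (cos y * cos y) with (1 - sin y * sin y) by lra. field. }
  rewrite E.
  set (A := (PI ^ 2 / 4 - u ^ 2) * sin u) in *.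
  replace (sin u * (1 + (PI ^ 2 / 4 - u ^ 2) * (cosh x ^ 2 - 1) / 2)) with (sin u + A * ((cosh x ^ 2 - 1) / 2))
    by (unfold A; field).
  assert (0 <= A) by (unfold A; apply Rmult_le_pos; nra).
  assert (cosh x - 1 <= (cosh x ^ 2 - 1) / 2) by nra.
  apply Rle_trans with (sin u + A * (cosh x - 1)); [|nra].
  replace (cos u * (u * cosh x - u)) with (u * cos u * (cosh x - 1)) by ring. nra.
Qed.

Lemma Csinh_xy (x y : R) : Csinh (x, y) = (sinh x * cos y, cosh x * sin y).
Proof.
  unfold Csinh, Cexp, sinh, cosh. simpl. rewrite cos_neg, sin_neg.
  unfold Cdiv, Cinv, Cmult, Cminus, Cplus, Copp; simpl. f_equal; field.
Qed.

Definition Ccosh (z : C) : C := ((Cexp z + Cexp (- z)) / 2)%C.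

Lemma Ccosh_xy (x y : R) : Ccosh (x, y) = (cosh x * cos y, sinh x * sin y).
Proof.
  unfold Ccosh, Cexp, sinh, cosh. simpl. rewrite cos_neg, sin_neg.
  unfold Cdiv, Cinv, Cmult, Cminus, Cplus, Copp; simpl. f_equal; field.
Qed.

Lemma Cmod_Ccosh_le (x y : R) : Cmod (Ccosh (x, y)) <= cosh x.
Proof.
  rewrite Ccosh_xy. unfold Cmod; simpl.
  assert (HC := cosh_ge_1 x). apply Rle_trans with (sqrt (cosh x ^ 2)); [apply sqrt_le_1_alt|rewrite sqrt_pow2; lra].
  assert (E := sin2_cos2 y). unfold Rsqr in E. assert (E2 := cosh_sqr x).
  replace (cosh x * cos y * (cosh x * cos y * 1) + sinh x * sin y * (sinh x * sin y * 1))
    with (cosh x ^ 2 * (cos y * cos y) + sinh x ^ 2 * (sin y * sin y)) by ring.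
  replace (cos y * cos y) with (1 - sin y * sin y) by lra. nra.
Qed.

(** The formula for the derivative of [psiC], written out because its modulus is needed; on the real
    axis it agrees with [Derive psiR] by [dpsi_real]. *)
Definition dpsi (z : C) : C := (psiC z * (RtoC (PI / 2) * Ccosh z))%C.

Lemma ex_Cderive_psiC (z : C) : ex_Cderive psiC z.
Proof.
  apply (ex_Cderive_Cexp (fun z => RtoC (PI / 2) * Csinh z)%C).
  apply ex_Cderive_mult; [apply ex_Cderive_const|]. unfold Csinh, Cdiv.
  apply ex_Cderive_mult; [|apply ex_Cderive_const].
  apply ex_Cderive_minus; [apply ex_Cderive_Cexp, ex_Cderive_id|].
  apply ex_Cderive_Cexp. exists (- (1))%C. apply is_Cderive_opp, is_Cderive_id.
Qed.

Lemma ex_Cderive_dpsi (z : C) : ex_Cderive dpsi z.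
Proof.
  apply ex_Cderive_mult; [apply ex_Cderive_psiC|].
  apply ex_Cderive_mult; [apply ex_Cderive_const|]. unfold Ccosh, Cdiv.
  apply ex_Cderive_mult; [|apply ex_Cderive_const].
  apply ex_Cderive_plus; [apply ex_Cderive_Cexp, ex_Cderive_id|].
  apply ex_Cderive_Cexp. exists (- (1))%C. apply is_Cderive_opp, is_Cderive_id.
Qed.

Lemma psiC_xy (x y : R) : psiC (x, y) = Cexp (PI / 2 * sinh x * cos y, PI / 2 * cosh x * sin y).
Proof.
  unfold psiC. rewrite Csinh_xy. f_equal. unfold RtoC, Cmult; simpl. f_equal; ring.
Qed.

Lemma Cmod_psiC (x y : R) : Cmod (psiC (x, y)) = exp (PI / 2 * sinh x * cos y).
Proof. rewrite psiC_xy. apply Cmod_Cexp. Qed.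

Lemma psiC_real (x : R) : psiC (RtoC x) = RtoC (psiR x).
Proof.
  unfold RtoC at 1. rewrite psiC_xy, sin_0, cos_0. unfold Cexp, psiR; simpl.
  rewrite Rmult_0_r, sin_0, cos_0, !Rmult_1_r, Rmult_0_r. reflexivity.
Qed.

Lemma is_derive_psiR (x : R) : is_derive psiR x (psiR x * (PI / 2 * cosh x)).
Proof.
  unfold psiR. evar_last.
  - apply (is_derive_comp exp (fun t => PI / 2 * sinh t)).
    + apply is_derive_exp.
    + apply is_derive_scal, is_derive_sinh.
  - unfold scal; simpl; unfold mult; simpl. ring.
Qed.

Lemma dpsi_real (x : R) : dpsi (RtoC x) = RtoC (Derive psiR x).
Proof.
  rewrite (is_derive_unique _ _ _ (is_derive_psiR x)). unfold dpsi. rewrite psiC_real.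
  unfold RtoC at 3. rewrite Ccosh_xy, sin_0, cos_0.
  unfold RtoC, Cmult; simpl. f_equal; ring.
Qed.

Lemma cos_half_pi_sin_pos (y : R) : Rabs y < PI / 2 -> 0 < cos (PI / 2 * sin y).
Proof.
  intros Hy. assert (HP := PI2_1). apply Rabs_def2 in Hy. destruct Hy as [Hy1 Hy2].
  assert (sin y < 1) by (rewrite <- sin_PI2; apply sin_increasing_1; lra).
  assert (-1 < sin y).
  { assert (E : sin (- (PI / 2)) = -1) by (rewrite sin_neg, sin_PI2; ring).
    rewrite <- E; apply sin_increasing_1; lra. }
  apply cos_gt_0; nra.
Qed.

(** With [psi = exp (a + i b)], the square of the modulus is
    [(1 + exp (2 a))^2 - 4 exp (2 a) sin b^2], and [(1 + exp (2 a))^2 = 4 exp (2 a) cosh a^2]. The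
    claim thus becomes [sin b^2 <= sin th^2 cosh a^2], the square of [Rabs_sin_cosh_le]. *)
Lemma Cmod_1_plus_psi_sqr (x y : R) : Rabs y < PI / 2 ->
  (1 + exp (2 * (PI / 2 * sinh x * cos y))) * cos (PI / 2 * sin y)
  <= Cmod (1 + psiC (x, y) * psiC (x, y))%C.
Proof.
  intros Hy. assert (Hc := cos_half_pi_sin_pos y Hy).
  assert (core : sin (PI / 2 * cosh x * sin y) ^ 2
     <= sin (PI / 2 * sin y) ^ 2 * cosh (PI / 2 * sinh x * cos y) ^ 2).
  { assert (H : sin (PI / 2 * cosh x * sin (Rabs y)) ^ 2
       <= sin (PI / 2 * sin (Rabs y)) ^ 2 * cosh (PI / 2 * sinh x * cos (Rabs y)) ^ 2).
    { rewrite <- Rpow_mult_distr, <- (pow2_abs (sin (_ * sin (Rabs y)))).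
      apply pow_incr. split; [apply Rabs_pos|]. apply Rabs_sin_cosh_le.
      split; [apply Rabs_pos|exact Hy]. }
    destruct (Rle_dec 0 y) as [H0|H0]; [now rewrite Rabs_pos_eq in H|].
    rewrite Rabs_left, sin_neg, cos_neg, !Ropp_mult_distr_r_reverse, !sin_neg in H by lra.
    nra. }
  rewrite psiC_xy, <- Cexp_plus.
  set (a := PI / 2 * sinh x * cos y) in *. set (b := PI / 2 * cosh x * sin y) in *.
  set (th := PI / 2 * sin y) in *.
  assert (Hp := exp_pos (2 * a)).
  unfold Cmod. apply Rsqr_incr_0_var; [|apply sqrt_pos].
  unfold Cexp; simpl. rewrite Rsqr_sqrt by (rewrite !Rmult_1_r; apply Rplus_le_le_0_compat; apply Rle_0_sqr).
  replace (a + a) with (2 * a) by ring. replace (b + b) with (2 * b) by ring.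
  assert (E2 := sin2_cos2 (2 * b)). assert (E1 := sin2_cos2 th). assert (E3 := cos_2a_sin b).
  unfold Rsqr in *.
  replace ((1 + exp (2 * a) * cos (2 * b)) * ((1 + exp (2 * a) * cos (2 * b)) * 1) +
     (0 + exp (2 * a) * sin (2 * b)) * ((0 + exp (2 * a) * sin (2 * b)) * 1))
   with (1 + 2 * exp (2 * a) * cos (2 * b) + exp (2 * a) ^ 2 * (sin (2 * b) * sin (2 * b) + cos (2 * b) * cos (2 * b))) by ring.
  rewrite E2, E3.
  assert (Eh : (1 + exp (2 * a)) ^ 2 = 4 * exp (2 * a) * cosh a ^ 2).
  { unfold cosh. replace (2 * a) with (a + a) by ring. rewrite exp_plus, exp_Ropp. assert (H := exp_pos a).
    field. lra. }
  replace ((1 + exp (2 * a)) * cos th * ((1 + exp (2 * a)) * cos th)) with ((1 + exp (2 * a)) ^ 2 * (1 - sin th * sin th)).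
  2:{ replace (1 - sin th * sin th) with (cos th * cos th) by lra. ring. }
  replace ((1 + exp (2 * a)) ^ 2 * (1 - sin th * sin th)) with ((1 + exp (2 * a)) ^ 2 - (1 + exp (2 * a)) ^ 2 * sin th ^ 2) by ring.
  rewrite Eh at 2. nra.
Qed.

Lemma Cmod_Cppow_real (z : C) (s : R) : z <> 0%C -> Cmod (Cppow z (RtoC s)) = Rpower (Cmod z) s.
Proof.
  intros Hz. unfold Cppow. destruct (Req_EM_T (Cmod z) 0) as [E|_].
  - apply Cmod_eq_0 in E. tauto.
  - rewrite Cmod_Cexp. unfold Rpower. f_equal. simpl. ring.
Qed.

(** The factor [cosh x], inherited from the derivative of the transformation, makes this an exact
    derivative, so its integrals are explicit. *)
Definition tail (c x : R) : R := cosh x * exp (- (c * sinh x)).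

(** * Decay of the transformed integrand in the strip *)

Section Integrand.

Variables (d K alpha beta : R) (f : C -> C).
Hypothesis Hd : d < PI / 2.
Hypothesis Hf : analytic_on (psi_strip d) f.
Hypothesis HK : 0 < K.
Hypothesis Ha : 0 < alpha.
Hypothesis Hb : 0 < beta.
Hypothesis Hbound : forall z : C, psi_strip d z ->
     Cmod (f z) <= K * Cmod (Cppow z (RtoC (alpha - 1))
                          / Cppow (1 + z * z)%C (RtoC ((alpha + beta) / 2)))%C.

Definition integrand (z : C) : C := (f (psiC z) * dpsi z)%C.

Lemma ex_Cderive_integrand (x y : R) : Rabs y < d -> ex_Cderive integrand (x, y).
Proof.
  intros Hy. apply ex_Cderive_mult; [|apply ex_Cderive_dpsi].
  apply (ex_Cderive_comp f psiC); [|apply ex_Cderive_psiC].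
  destruct (Hf (psiC (x, y))) as [l Hl].
  - now exists (x, y).
  - exists l. now apply is_Cderive_of_derive.
Qed.

(** The factor of the bound that depends on the height only: [PI / 2] comes from [dpsi], the power
    from the lower bound for [1 + psi^2]. *)
Definition amplitude (y : R) : R :=
  K * (PI / 2) / Rpower (cos (PI / 2 * sin y)) ((alpha + beta) / 2).

(** The factor [psi] inside [dpsi] raises [|psi|^(alpha - 1)] to [|psi|^alpha]. The logarithm is
    kept so that the decay on both half-lines can be read off from one estimate. *)
Lemma Cmod_integrand_le (x y : R) : Rabs y < d ->
  Cmod (integrand (x, y)) <=
    amplitude y * (cosh x * exp (alpha * (PI / 2 * sinh x * cos y) -
      (alpha + beta) / 2 * ln (1 + exp (2 * (PI / 2 * sinh x * cos y))))).
Proof.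
  intros Hy. assert (Hy2 : Rabs y < PI / 2) by lra.
  assert (Hc := cos_half_pi_sin_pos y Hy2).
  assert (Hm := Cmod_1_plus_psi_sqr x y Hy2).
  set (p := (alpha + beta) / 2) in *. assert (Hp : 0 < p) by (unfold p; lra).
  set (a := PI / 2 * sinh x * cos y) in *.
  assert (Hea := exp_pos (2 * a)).
  assert (Hpos : 0 < (1 + exp (2 * a)) * cos (PI / 2 * sin y)) by (apply Rmult_lt_0_compat; lra).
  assert (Hne : (1 + psiC (x, y) * psiC (x, y))%C <> 0%C) by (apply Cmod_gt_0; lra).
  assert (Hz : psiC (x, y) <> 0%C) by apply Cexp_neq_0.
  assert (B := Hbound (psiC (x, y)) (ex_intro _ (x, y) (conj Hy eq_refl))). fold p in B.
  assert (Hq : forall z : C, z <> 0%C -> Cppow z (RtoC p) <> 0%C).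
  { intros z Hz'. apply Cmod_gt_0. rewrite Cmod_Cppow_real by exact Hz'. apply exp_pos. }
  rewrite Cmod_div, !Cmod_Cppow_real in B by auto.
  rewrite Cmod_psiC in B. fold a in B.
  unfold integrand, dpsi. rewrite !Cmod_mult, Cmod_psiC, Cmod_R. fold a.
  assert (HP := PI_RGT_0). rewrite (Rabs_pos_eq (PI / 2)) by lra.
  assert (HR : Rpower (cos (PI / 2 * sin y)) p * exp (p * ln (1 + exp (2 * a)))
     <= Rpower (Cmod (1 + psiC (x, y) * psiC (x, y))%C) p).
  { apply Rle_trans with (Rpower ((1 + exp (2 * a)) * cos (PI / 2 * sin y)) p).
    - right. change (exp (p * ln (1 + exp (2 * a)))) with (Rpower (1 + exp (2 * a)) p).
      rewrite Rpower_mult_distr by lra. f_equal. ring.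
    - apply Rle_Rpower_l; lra. }
  set (Q := Rpower (cos (PI / 2 * sin y)) p) in *.
  assert (HQ : 0 < Q) by apply exp_pos.
  set (D := Rpower (Cmod (1 + psiC (x, y) * psiC (x, y))%C) p) in *.
  set (L := p * ln (1 + exp (2 * a))) in *. assert (HL := exp_pos L).
  assert (EN : Rpower (exp a) (alpha - 1) * exp a = exp (alpha * a)).
  { unfold Rpower. rewrite ln_exp, <- exp_plus. f_equal. ring. }
  assert (HCC := Cmod_Ccosh_le x y). assert (HC1 := cosh_ge_1 x).
  assert (Hexa := exp_pos a). assert (HNpos : 0 < Rpower (exp a) (alpha - 1)) by apply exp_pos.
  assert (Hinv : / D <= / Q * exp (- L)).
  { rewrite exp_Ropp, <- Rinv_mult. apply Rinv_le_contravar; [apply Rmult_lt_0_compat; assumption|exact HR]. }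
  apply Rle_trans with (K * (Rpower (exp a) (alpha - 1) * (/ Q * exp (- L))) * (exp a * (PI / 2 * cosh x))).
  - apply Rmult_le_compat; [apply Cmod_ge_0| | |].
    + apply Rmult_le_pos; [lra|]. apply Rmult_le_pos; [lra|apply Cmod_ge_0].
    + eapply Rle_trans; [exact B|]. apply Rmult_le_compat_l; [lra|].
      apply Rmult_le_compat_l; [lra|exact Hinv].
    + apply Rmult_le_compat_l; [lra|]. apply Rmult_le_compat_l; lra.
  - right. unfold amplitude. fold p Q. fold L.
    replace (exp (alpha * a - L)) with (exp (alpha * a) * exp (- L)) by (rewrite <- exp_plus; reflexivity).
    rewrite <- EN. unfold Rdiv. ring.
Qed.

Lemma amplitude_pos (y : R) : 0 < amplitude y.
Proof.
  unfold amplitude. assert (HP := PI_RGT_0).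
  apply Rdiv_lt_0_compat; [nra|apply exp_pos].
Qed.

Lemma cos_le_cos_abs (y Y : R) : Rabs y <= Y -> Y <= PI -> cos Y <= cos y.
Proof.
  intros Hy HY. replace (cos y) with (cos (Rabs y)).
  - assert (H := Rabs_pos y). apply cos_decr_1; lra.
  - unfold Rabs. destruct (Rcase_abs y); [apply cos_neg|reflexivity].
Qed.

Lemma amplitude_le (y Y : R) : Rabs y <= Y -> Y < PI / 2 -> amplitude y <= amplitude Y.
Proof.
  intros Hy HY. assert (HP := PI2_1). assert (H0 := Rabs_pos y).
  unfold amplitude, Rdiv. change (PI * / 2) with (PI / 2). apply Rmult_le_compat_l; [nra|].
  apply Rinv_le_contravar; [apply exp_pos|]. apply Rle_Rpower_l; [lra|]. split.
  - apply cos_half_pi_sin_pos. rewrite Rabs_pos_eq; lra.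
  - assert (sin (Rabs y) <= sin Y) by (destruct Hy as [Hy| ->]; [left; apply sin_increasing_1|]; lra).
    assert (0 <= sin (Rabs y)) by (apply sin_ge_0; lra).
    assert (sin Y <= 1) by apply SIN_bound.
    apply cos_le_cos_abs; [|nra].
    rewrite Rabs_mult, (Rabs_pos_eq (PI / 2)) by lra. apply Rmult_le_compat_l; [lra|].
    replace (Rabs (sin y)) with (sin (Rabs y)); [assumption|].
    unfold Rabs at 1. destruct (Rcase_abs y) as [C|C].
    + rewrite Rabs_left1; [now rewrite sin_neg|]. rewrite <- (Ropp_involutive y), sin_neg.
      assert (0 <= sin (- y)); [|lra]. rewrite <- Rabs_left by exact C. assumption.
    + rewrite Rabs_pos_eq; [reflexivity|]. rewrite Rabs_pos_eq in H1 by lra. assumption.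
Qed.

(** The first bound turns the exponent [alpha a] into [- beta a] on the right half-line; the second
    leaves [alpha a], which is negative on the left one. *)
Lemma ln_1_exp_ge (a : R) : 2 * a <= ln (1 + exp (2 * a)) /\ 0 <= ln (1 + exp (2 * a)).
Proof.
  assert (H := exp_pos (2 * a)). split.
  - rewrite <- (ln_exp (2 * a)) at 1. apply ln_le; lra.
  - rewrite <- ln_1. apply ln_le; lra.
Qed.

Lemma Cmod_integrand_right (x y Y : R) : 0 <= x -> Rabs y <= Y -> Y < d ->
  Cmod (integrand (x, y)) <= amplitude Y * tail (PI / 2 * beta * cos Y) x.
Proof.
  intros Hx Hy HY. eapply Rle_trans; [apply Cmod_integrand_le; lra|].
  assert (HC := cosh_ge_1 x). assert (HP := PI_RGT_0).
  apply Rmult_le_compat.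
  - left; apply amplitude_pos.
  - apply Rmult_le_pos; [lra|left; apply exp_pos].
  - apply amplitude_le; lra.
  - apply Rmult_le_compat_l; [lra|].
    assert (Hc := cos_le_cos_abs y Y Hy ltac:(lra)).
    assert (Hs : 0 <= sinh x) by (eapply Rle_trans; [exact Hx|now apply sinh_ge_id]).
    destruct (ln_1_exp_ge (PI / 2 * sinh x * cos y)) as [L _].
    assert (E : beta * (PI / 2 * sinh x) * cos Y <= beta * (PI / 2 * sinh x) * cos y).
    { apply Rmult_le_compat_l; [|exact Hc]. apply Rmult_le_pos; [lra|]. apply Rmult_le_pos; lra. }
    apply exp_le_compat. nra.
Qed.

Lemma Cmod_integrand_left (x y Y : R) : x <= 0 -> Rabs y <= Y -> Y < d ->
  Cmod (integrand (x, y)) <= amplitude Y * tail (PI / 2 * alpha * cos Y) (- x).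
Proof.
  intros Hx Hy HY. eapply Rle_trans; [apply Cmod_integrand_le; lra|].
  assert (HC := cosh_ge_1 x). assert (HP := PI_RGT_0).
  unfold tail. rewrite cosh_opp, sinh_opp.
  apply Rmult_le_compat.
  - left; apply amplitude_pos.
  - apply Rmult_le_pos; [lra|left; apply exp_pos].
  - apply amplitude_le; lra.
  - apply Rmult_le_compat_l; [lra|].
    assert (Hc := cos_le_cos_abs y Y Hy ltac:(lra)).
    assert (Hs : 0 <= - sinh x) by (rewrite <- sinh_opp; apply Rle_trans with (- x); [lra|apply sinh_ge_id; lra]).
    destruct (ln_1_exp_ge (PI / 2 * sinh x * cos y)) as [_ L].
    assert (E : alpha * (PI / 2 * - sinh x) * cos Y <= alpha * (PI / 2 * - sinh x) * cos y).
    { apply Rmult_le_compat_l; [|exact Hc]. apply Rmult_le_pos; [lra|]. apply Rmult_le_pos; lra. }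
    apply exp_le_compat. nra.
Qed.

End Integrand.

(** * Truncation *)

Lemma is_derive_tail_primitive (c x : R) : c <> 0 ->
  is_derive (fun x => - (exp (- (c * sinh x)) / c)) x (tail c x).
Proof.
  intros Hc. unfold tail. auto_derive; [trivial|field; exact Hc].
Qed.

Lemma continuous_tail (c x : R) : continuous (tail c) x.
Proof.
  apply (ex_derive_continuous (tail c)). unfold tail. now auto_derive.
Qed.

Lemma is_RInt_tail (c a b : R) : c <> 0 ->
  is_RInt (tail c) a b ((exp (- (c * sinh a)) - exp (- (c * sinh b))) / c).
Proof.
  intros Hc. evar_last.
  - apply (is_RInt_derive (V := R_CompleteNormedModule) (fun x => - (exp (- (c * sinh x)) / c)) (tail c)).
    + intros x _. now apply is_derive_tail_primitive.
    + intros x _. apply continuous_tail.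
  - unfold minus, plus, opp; simpl. field. exact Hc.
Qed.

Lemma tail_pos (c x : R) : 0 < tail c x.
Proof. unfold tail. apply Rmult_lt_0_compat; [assert (H := cosh_ge_1 x); lra|apply exp_pos]. Qed.

(** A crude rate that suffices to make tails vanish, from [cosh x <= 2 sinh x] for [x >= 1] and
    [exp t >= (t / 2)^2] for [t >= 0]. *)
Lemma tail_le_inv (c x : R) : 0 < c -> 1 <= x -> tail c x <= 8 / (c ^ 2 * x).
Proof.
  intros Hc Hx. unfold tail.
  assert (Hs := sinh_ge_id x ltac:(lra)). set (s := sinh x) in *.
  assert (Hcosh : cosh x <= 2 * s).
  { assert (E := cosh_sqr x). assert (H1 := cosh_ge_1 x). fold s in E. nra. }
  assert (He : (c * s / 2) ^ 2 <= exp (c * s)).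
  { replace (exp (c * s)) with (exp (c * s / 2) ^ 2).
    - assert (H := exp_ineq1_le (c * s / 2)). assert (0 <= c * s / 2) by nra. apply pow_incr; lra.
    - simpl. rewrite Rmult_1_r, <- exp_plus. f_equal. field. }
  rewrite exp_Ropp.
  assert (Hp : 0 < (c * s / 2) ^ 2) by (apply pow_lt; nra).
  assert (HC := cosh_ge_1 x).
  apply Rle_trans with (2 * s * / (c * s / 2) ^ 2).
  - apply Rmult_le_compat; [lra|left; apply Rinv_0_lt_compat, exp_pos|exact Hcosh|].
    apply Rinv_le_contravar; assumption.
  - replace (2 * s * / (c * s / 2) ^ 2) with (8 * / (c ^ 2 * s)) by (field; lra).
    unfold Rdiv. apply Rmult_le_compat_l; [lra|].
    apply Rinv_le_contravar; [apply Rmult_lt_0_compat; nra|]. apply Rmult_le_compat_l; nra.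
Qed.

Lemma nondecreasing_of_derive (g dg : R -> R) (a b : R) :
  (forall x, is_derive g x (dg x)) -> a <= b -> (forall x, a < x < b -> 0 <= dg x) -> g a <= g b.
Proof.
  intros Hg [Hab| ->] Hpos; [|lra].
  destruct (MVT_is_derive g dg a b Hab Hg) as [c [Hc E]]. specialize (Hpos c Hc). nra.
Qed.

Lemma nonincreasing_of_derive (g dg : R -> R) (a b : R) :
  (forall x, is_derive g x (dg x)) -> a <= b -> (forall x, a < x < b -> dg x <= 0) -> g b <= g a.
Proof.
  intros Hg [Hab| ->] Hpos; [|lra].
  destruct (MVT_is_derive g dg a b Hab Hg) as [c [Hc E]]. specialize (Hpos c Hc). nra.
Qed.

(** The square of [tail (p / 2)] in the variable [s = sinh x]. Squaring removes the root from
    [cosh], and the sign of the derivative becomes that of a quadratic polynomial. *)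
Definition sqr_tail (p s : R) : R := (1 + s ^ 2) * exp (- (p * s)).

Lemma is_derive_sqr_tail (p s : R) :
  is_derive (sqr_tail p) s ((2 * s - p * (1 + s ^ 2)) * exp (- (p * s))).
Proof. unfold sqr_tail. auto_derive; [trivial|ring]. Qed.

Lemma tail_sqr (p x : R) : tail (p / 2) x ^ 2 = sqr_tail p (sinh x).
Proof.
  unfold tail, sqr_tail. rewrite Rpow_mult_distr, cosh_sqr. f_equal.
  simpl. rewrite Rmult_1_r, <- exp_plus. f_equal. field.
Qed.

Lemma sinh_le_mono (x y : R) : x <= y -> sinh x <= sinh y.
Proof. intros [H| ->]; [left; now apply sinh_lt|apply Rle_refl]. Qed.

Lemma tail_le_of_sqr (p rho x y : R) : 0 <= rho ->
  sqr_tail p (sinh y) <= rho ^ 2 * sqr_tail p (sinh x) -> tail (p / 2) y <= rho * tail (p / 2) x.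
Proof.
  intros Hr H. rewrite <- !tail_sqr in H.
  assert (H1 := tail_pos (p / 2) x). assert (H2 := tail_pos (p / 2) y).
  apply Rsqr_incr_0_var; [|apply Rmult_le_pos; lra].
  rewrite !Rsqr_pow2, Rpow_mult_distr. exact H.
Qed.

(** For [p >= 1] the quadratic [2 s - p (1 + s^2)] is at most [- (s - 1)^2]. *)
Lemma tail_decreasing (p x y : R) : 1 <= p -> x <= y -> tail (p / 2) y <= tail (p / 2) x.
Proof.
  intros Hp Hxy. rewrite <- (Rmult_1_l (tail (p / 2) x)). apply tail_le_of_sqr; [lra|].
  rewrite pow1, Rmult_1_l.
  apply (nonincreasing_of_derive _ _ _ _ (is_derive_sqr_tail p)); [now apply sinh_le_mono|].
  intros s _. assert (H := exp_pos (- (p * s))).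
  assert (H1 : 0 <= (p - 1) * (1 + s ^ 2)) by (apply Rmult_le_pos; nra).
  assert (H2 := pow2_ge_0 (s - 1)).
  assert (2 * s - p * (1 + s ^ 2) <= 0) by nra. nra.
Qed.

(** With [p = 2 PI gamma], the argument of [arcsinh] in [x_gamma] is [crit p / p], whereas
    [sqr_tail p] has its maximum at [(crit p)^2 / p]. *)
Definition crit (p : R) : R := sqrt (1 + sqrt (1 - p ^ 2)).

Lemma crit_spec (p : R) : 0 < p < 1 ->
  exists r, 0 <= r <= 1 /\ r ^ 2 = 1 - p ^ 2 /\ crit p ^ 2 = 1 + r /\ 1 <= crit p.
Proof.
  intros Hp. exists (sqrt (1 - p ^ 2)).
  assert (H0 := sqrt_pos (1 - p ^ 2)).
  assert (E : sqrt (1 - p ^ 2) ^ 2 = 1 - p ^ 2) by (apply pow2_sqrt; nra).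
  assert (E2 : crit p ^ 2 = 1 + sqrt (1 - p ^ 2)) by (apply pow2_sqrt; lra).
  repeat split; trivial; [nra|].
  assert (0 <= crit p) by apply sqrt_pos. nra.
Qed.

(** Half of [2 (q - 1) - (q^2 - q)], a bound for the logarithm of the rise of [sqr_tail p] from
    [q / p] to [q^2 / p], where [q = crit p]. *)
Definition slack (q : R) : R := (q - 1) * (2 - q) / 2.

(* [x_gamma] lies below the maximiser of [tail] (its formula has an extra square root), so beyond it [tail] is only decreasing up to the factor [exp (slack (crit p))]. *)
Lemma tail_quasi_decreasing (p x y : R) : 0 < p < 1 -> crit p / p <= sinh x -> x <= y ->
  tail (p / 2) y <= exp (slack (crit p)) * tail (p / 2) x.
Proof.
  intros Hp Hx Hxy. destruct (crit_spec p Hp) as [r [Hr [Er [Eq Hq]]]].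
  set (q := crit p) in *.
  assert (Hq2 : q <= 3 / 2) by nra.
  apply tail_le_of_sqr; [left; apply exp_pos|].
  assert (Hst := sinh_le_mono x y Hxy).
  set (s := sinh x) in *. set (t := sinh y) in *.
  assert (Hpos : forall s, 0 < sqr_tail p s).
  { intros v. unfold sqr_tail. apply Rmult_lt_0_compat; [nra|apply exp_pos]. }
  set (s1 := q / p) in *. set (s2 := q ^ 2 / p).
  assert (Hs1 : p * s1 = q) by (unfold s1; field; lra).
  assert (Hs2 : p * s2 = 1 + r) by (unfold s2; rewrite <- Eq; field; lra).
  assert (Hs12 : s1 <= s2).
  { apply Rmult_le_reg_l with p; [lra|]. rewrite Hs1, Hs2, <- Eq. nra. }
  assert (Hs1pos : 0 < s1) by (apply Rdiv_lt_0_compat; lra).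
  (* The quadratic in the derivative has the roots [(1 - r) / p] and [(1 + r) / p = s2], and [s1]
     lies between them. *)
  assert (up : forall v v', s1 <= v -> v <= v' -> v' <= s2 -> sqr_tail p v <= sqr_tail p v').
  { intros v v' H1 H2 H3. apply (nondecreasing_of_derive _ _ _ _ (is_derive_sqr_tail p)); [exact H2|].
    intros z Hz. apply Rmult_le_pos; [|left; apply exp_pos].
    apply Rmult_le_reg_l with p; [lra|]. rewrite Rmult_0_r.
    replace (p * (2 * z - p * (1 + z ^ 2))) with ((1 + r - p * z) * (p * z - (1 - r)) + (1 - p ^ 2 - r ^ 2)) by ring.
    assert (p * z <= 1 + r) by (rewrite <- Hs2; apply Rmult_le_compat_l; lra).
    assert (q <= p * z) by (rewrite <- Hs1; apply Rmult_le_compat_l; lra). nra. }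
  assert (down : forall v v', s2 <= v -> v <= v' -> sqr_tail p v' <= sqr_tail p v).
  { intros v v' H1 H2. apply (nonincreasing_of_derive _ _ _ _ (is_derive_sqr_tail p)); [exact H2|].
    intros z Hz. assert (He := exp_pos (- (p * z))).
    assert (p * (2 * z - p * (1 + z ^ 2)) <= 0).
    { replace (p * (2 * z - p * (1 + z ^ 2))) with ((1 + r - p * z) * (p * z - (1 - r)) + (1 - p ^ 2 - r ^ 2)) by ring.
      assert (1 + r <= p * z) by (rewrite <- Hs2; apply Rmult_le_compat_l; lra). nra. }
    nra. }
  (* As [s2 = q s1] with [q >= 1], the polynomial factor grows by at most [q^2 <= exp (2 (q - 1))];
     the exponential factor falls by [exp (q - q^2)]. *)
  assert (peak : sqr_tail p s2 <= exp (slack q) ^ 2 * sqr_tail p s1).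
  { unfold sqr_tail. rewrite Hs1, Hs2.
    assert (H1 : 1 + s2 ^ 2 <= q ^ 2 * (1 + s1 ^ 2)).
    { replace (s2 ^ 2) with (q ^ 2 * s1 ^ 2) by (unfold s1, s2; field; lra). nra. }
    assert (H2 : q ^ 2 <= exp (2 * (q - 1))).
    { replace (exp (2 * (q - 1))) with (exp (q - 1) ^ 2).
      - assert (H := exp_ineq1_le (q - 1)). apply pow_incr; lra.
      - simpl. rewrite Rmult_1_r, <- exp_plus. f_equal. ring. }
    assert (E3 : exp (2 * (q - 1)) * exp (- (1 + r)) = exp (slack q) ^ 2 * exp (- q)).
    { simpl. rewrite Rmult_1_r, <- !exp_plus. f_equal. rewrite <- Eq. unfold slack. field. }
    assert (P1 := exp_pos (- (1 + r))). assert (P2 := exp_pos (2 * (q - 1))).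
    apply Rle_trans with (exp (2 * (q - 1)) * (1 + s1 ^ 2) * exp (- (1 + r))).
    - apply Rmult_le_compat_r; [lra|]. eapply Rle_trans; [exact H1|]. apply Rmult_le_compat_r; nra.
    - right. replace (exp (2 * (q - 1)) * (1 + s1 ^ 2) * exp (- (1 + r))) with
        ((1 + s1 ^ 2) * (exp (2 * (q - 1)) * exp (- (1 + r)))) by ring. rewrite E3. ring. }
  assert (Hrho : 1 <= exp (slack q) ^ 2).
  { assert (0 <= slack q) by (unfold slack; nra). assert (H1 := exp_ineq1_le (slack q)). nra. }
  assert (Hs := Hpos s). assert (Hs1' := Hpos s1).
  destruct (Rle_dec s2 s) as [C|C].
  - assert (H := down s t C Hst). nra.
  - assert (H1 : sqr_tail p t <= sqr_tail p s2).
    { destruct (Rle_dec t s2); [apply up|apply down]; lra. }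
    assert (H2 := up s1 s ltac:(lra) ltac:(lra) ltac:(lra)).
    assert (exp (slack q) ^ 2 * sqr_tail p s1 <= exp (slack q) ^ 2 * sqr_tail p s) by (apply Rmult_le_compat_l; lra).
    lra.
Qed.

(** Each value is sampled at the right end of an interval of length [h] and is at most [rho] times
    the tail anywhere on it; the integrals over these intervals telescope. *)
Lemma tail_sum_le_exp (c rho X h : R) (m : nat) : 0 < c -> 0 < h -> 0 <= rho ->
  (forall x y, X <= x -> x <= y -> tail c y <= rho * tail c x) ->
  h * sum_n_m (fun j => tail c (X + INR (S j) * h)) 0 m <= rho * exp (- (c * sinh X)) / c.
Proof.
  intros Hc Hh Hrho Ht.
  assert (step : forall x, X <= x -> h * tail c (x + h) <= rho * ((exp (- (c * sinh x)) - exp (- (c * sinh (x + h)))) / c)).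
  { intros x Hx.
    assert (H := is_RInt_le (fun _ => tail c (x + h)) (fun t => rho * tail c t) x (x + h)
       ((x + h - x) * tail c (x + h)) (rho * ((exp (- (c * sinh x)) - exp (- (c * sinh (x + h)))) / c))).
    replace (x + h - x) with h in H by ring. apply H; [lra| | |].
    - replace (h * tail c (x + h)) with (scal (x + h - x) (tail c (x + h)) : R)
        by (unfold scal; simpl; unfold mult; simpl; ring).
      apply (@is_RInt_const R_NormedModule).
    - apply (@is_RInt_scal R_NormedModule). apply is_RInt_tail. lra.
    - intros t Hxt. apply Ht; lra. }
  assert (main : h * sum_n_m (fun j => tail c (X + INR (S j) * h)) 0 m
     <= rho * ((exp (- (c * sinh X)) - exp (- (c * sinh (X + INR (S m) * h)))) / c)).
  { induction m as [|m IH].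
    - rewrite sum_n_n. simpl INR. rewrite Rmult_1_l. apply step. lra.
    - rewrite sum_n_Sm by lia. change (plus ?a ?b) with (a + b).
      rewrite Rmult_plus_distr_l.
      assert (S1 := step (X + INR (S m) * h)).
      replace (X + INR (S m) * h + h) with (X + INR (S (S m)) * h) in S1 by (rewrite (S_INR (S m)); ring).
      assert (0 <= INR (S m) * h) by (apply Rmult_le_pos; [apply pos_INR|lra]).
      specialize (S1 ltac:(lra)).
      eapply Rle_trans; [apply Rplus_le_compat; [exact IH|exact S1]|].
      right. field. lra. }
  eapply Rle_trans; [exact main|].
  assert (He := exp_pos (- (c * sinh (X + INR (S m) * h)))).
  unfold Rdiv. rewrite <- Rmult_assoc. apply Rmult_le_compat_r; [left; now apply Rinv_0_lt_compat|].
  apply Rmult_le_compat_l; lra.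
Qed.

(** * Numerical estimates that absorb the slack *)

Lemma pow_exp (x : R) (n : nat) : exp x ^ n = exp (INR n * x).
Proof.
  induction n as [|n IH]; [simpl; rewrite Rmult_0_l; now rewrite exp_0|].
  rewrite S_INR, <- tech_pow_Rmult, IH, <- exp_plus. f_equal. ring.
Qed.

Lemma exp_1_bounds : 2.6 <= exp 1 <= 2.745.
Proof.
  split.
  - replace (exp 1) with (exp (/ 16) ^ 16).
    + apply Rle_trans with ((1 + / 16) ^ 16); [lra|]. apply pow_incr.
      assert (H := exp_ineq1_le (/ 16)). lra.
    + rewrite pow_exp. f_equal. simpl. field.
  - replace (exp 1) with (/ (exp (- / 64) ^ 64)).
    + apply Rle_trans with (/ (1 - / 64) ^ 64); [|lra].
      apply Rinv_le_contravar; [lra|]. apply pow_incr.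
      assert (H := exp_ineq1_le (- / 64)). lra.
    + rewrite pow_exp, <- exp_Ropp. f_equal. simpl. field.
Qed.

(** With [w = exp l] and [1 <= l <= 2], this follows from [exp (2 - l) >= 3 - l] and
    [l (3 - l) >= 2]. *)
Lemma ratio_le (w : R) : exp 1 <= w -> w < exp 2 -> w / ln w <= exp 2 / 2.
Proof.
  intros H1 H2.
  assert (Hw : 0 < w) by (assert (H := exp_pos 1); lra).
  set (l := ln w).
  assert (L1 : 1 <= l) by (unfold l; rewrite <- (ln_exp 1); apply ln_le; [apply exp_pos|exact H1]).
  assert (L2 : l < 2) by (unfold l; rewrite <- (ln_exp 2); apply ln_increasing; assumption).
  assert (Ew : w = exp 2 * exp (- (2 - l))).
  { rewrite <- exp_plus. replace (2 + - (2 - l)) with l by ring. unfold l. now rewrite exp_ln. }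
  assert (Hp := exp_pos 2).
  assert (Hb : exp (- (2 - l)) <= / (3 - l)).
  { rewrite exp_Ropp. apply Rinv_le_contravar; [lra|]. assert (H := exp_ineq1_le (2 - l)). lra. }
  assert (Hc : / (3 - l) <= l / 2).
  { apply Rmult_le_reg_r with (3 - l); [lra|]. rewrite Rinv_l by lra. nra. }
  apply Rmult_le_reg_r with l; [lra|]. unfold Rdiv at 1. rewrite Rmult_assoc, Rinv_l, Rmult_1_r by lra.
  rewrite Ew at 1. nra.
Qed.

(* [kappa] stands for [(p / 2) sinh X], bounded below through both hypotheses on [X]; [exp L] is the ratio of the two decay exponents. *)
Lemma slack_absorbed (p w L kappa q : R) :
  0 < p < 1 -> q = crit p -> exp 1 <= w -> 0 <= L ->
  q / 2 <= kappa -> p / 4 * (w - / w) <= kappa ->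
  slack q - kappa <= L + p / 4 - p / 4 * (w / (ln w + L)).
Proof.
  intros Hp Hq Hw HL K1 K2.
  destruct (crit_spec p Hp) as [r [Hr [Er [Eq Hq1]]]]. rewrite <- Hq in Eq, Hq1.
  assert (EB := exp_1_bounds).
  assert (L1 : 1 <= ln w) by (rewrite <- (ln_exp 1); apply ln_le; [apply exp_pos|exact Hw]).
  assert (R1 : w / (ln w + L) <= w / ln w).
  { unfold Rdiv. apply Rmult_le_compat_l; [lra|]. apply Rinv_le_contravar; lra. }
  assert (Hinv : / w <= / 2.6) by (apply Rinv_le_contravar; lra).
  assert (Hinv0 : 0 < / w) by (apply Rinv_0_lt_compat; lra).
  assert (Rw : w / ln w <= w).
  { apply Rle_trans with (w / 1); [|lra]. unfold Rdiv. apply Rmult_le_compat_l; [lra|].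
    apply Rinv_le_contravar; lra. }
  assert (Hq2 : q <= 1.4143) by nra.
  (* For large [p] the slack is at most 0.11 and the second bound on [kappa] suffices. For small [p]
     the first one, [q / 2], suffices as long as [w < exp 2]; the threshold 0.72 meets both needs
     narrowly. *)
  destruct (Rle_dec 0.72 p) as [C|C].
  - assert (Hr2 : r <= 0.694) by nra. assert (Hq3 : q <= 1.302) by nra.
    assert (slack q <= 0.11) by (unfold slack; nra).
    assert (0.11 <= p / 4 * (1 - / w)) by nra. nra.
  - assert (slack q <= 0.1214) by (unfold slack; nra).
    destruct (Rlt_dec w (exp 2)) as [C2|C2].
    + assert (Hrat := ratio_le w Hw C2).
      assert (E2 : exp 2 <= 7.54).
      { replace 2 with (1 + 1) by ring. rewrite exp_plus. nra. }
      assert (1 / 2 <= q / 2 - slack q) by (unfold slack; nra).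
      assert (p / 4 * (w / ln w - 1) <= 1 / 2) by nra. nra.
    (* Here [w / ln w] is at most half of [w], so the average of the two lower bounds on [kappa] is
       enough. *)
    + assert (L2 : 2 <= ln w) by (rewrite <- (ln_exp 2); apply ln_le; [apply exp_pos|lra]).
      assert (w / ln w <= w / 2).
      { unfold Rdiv. apply Rmult_le_compat_l; [lra|]. apply Rinv_le_contravar; lra. }
      nra.
Qed.

Lemma sinh_ln (w : R) : 0 < w -> sinh (ln w) = (w - / w) / 2.
Proof. intros Hw. unfold sinh. rewrite exp_Ropp, exp_ln by exact Hw. reflexivity. Qed.

(** The hypothesis [ln w <= X] bounds [sinh X] below by [(w - 1 / w) / 2]. Summation yields the
    factor [1 / sigma]; it becomes [1 / mu] through [exp L = sigma / mu], so that both ends get the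
    same bound. *)
Lemma tail_sum_le (mu sigma w X h : R) (m : nat) :
  0 < mu <= sigma -> exp 1 <= w -> 0 < h -> ln w <= X -> x_gamma (sigma / 2) <= X ->
  PI / 2 * (h * sum_n_m (fun j => tail (PI / 2 * sigma) (X + INR (S j) * h)) 0 m)
  <= / mu * exp (PI * sigma / 4 - PI * sigma / 4 * (w / (ln w + ln (sigma / mu)))).
Proof.
  intros [Hmu Hms] Hw Hh HX1 HX2. assert (HP := PI_RGT_0).
  set (p := PI * sigma). assert (Hp : 0 < p) by (unfold p; nra).
  replace (PI / 2 * sigma) with (p / 2) by (unfold p; field).
  set (L := ln (sigma / mu)).
  assert (Hrat : 1 <= sigma / mu).
  { apply Rmult_le_reg_r with mu; [lra|]. unfold Rdiv. rewrite Rmult_assoc, Rinv_l; lra. }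
  assert (HL : 0 <= L) by (unfold L; rewrite <- ln_1; apply ln_le; lra).
  assert (EL : exp L = sigma / mu) by (apply exp_ln; lra).
  set (kappa := p / 2 * sinh X).
  assert (Hwpos : 0 < w) by (assert (H := exp_pos 1); lra).
  assert (K2 : p / 4 * (w - / w) <= kappa).
  { unfold kappa. assert (H := sinh_le_mono _ _ HX1). rewrite sinh_ln in H by exact Hwpos. nra. }
  assert (core : exists rho, 0 <= rho /\ (forall x y, X <= x -> x <= y -> tail (p / 2) y <= exp rho * tail (p / 2) x)
    /\ rho - kappa <= L + p / 4 - p / 4 * (w / (ln w + L))).
  { destruct (Rlt_dec p 1) as [C|C].
    - assert (K1 : crit p / p <= sinh X).
      { unfold x_gamma in HX2. replace (2 * PI * (sigma / 2)) with p in HX2 by (unfold p; field).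
        destruct (Rlt_dec (sigma / 2) (1 / (2 * PI))) as [_|N].
        - apply sinh_le_mono in HX2. rewrite sinh_arcsinh in HX2. exact HX2.
        - exfalso. apply N. apply Rmult_lt_reg_l with (2 * PI); [lra|].
          replace (2 * PI * (1 / (2 * PI))) with 1 by (field; lra). unfold p in C. lra. }
      exists (slack (crit p)). destruct (crit_spec p (conj Hp C)) as [r [Hr [Er [Eq Hq1]]]].
      split; [unfold slack; nra|]. split.
      + intros x y H1 H2. apply tail_quasi_decreasing; [lra| |exact H2].
        eapply Rle_trans; [exact K1|]. now apply sinh_le_mono.
      + apply slack_absorbed; trivial; [lra|]. unfold kappa.
        replace (crit p / 2) with (p / 2 * (crit p / p)) by (field; lra).
        apply Rmult_le_compat_l; lra.
    (* For [p >= 1] the tail decreases everywhere, and [p / 4] outweighs the loss [p / (4 w)]. *)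
    - exists 0. split; [lra|]. split.
      + intros x y H1 H2. rewrite exp_0, Rmult_1_l. apply tail_decreasing; lra.
      + assert (L1 : 1 <= ln w) by (rewrite <- (ln_exp 1); apply ln_le; [apply exp_pos|exact Hw]).
        assert (R1 : w / (ln w + L) <= w).
        { apply Rle_trans with (w / 1); [|lra]. unfold Rdiv. apply Rmult_le_compat_l; [lra|].
          apply Rinv_le_contravar; lra. }
        assert (/ w <= 1).
        { rewrite <- Rinv_1. apply Rinv_le_contravar; [lra|]. assert (H := exp_ineq1_le 1). lra. }
        nra. }
  destruct core as [rho [Hr0 [Hr1 Hr2]]].
  assert (S1 := tail_sum_le_exp (p / 2) (exp rho) X h m ltac:(lra) Hh ltac:(left; apply exp_pos) Hr1).
  fold kappa in S1.
  apply Rle_trans with (PI / 2 * (exp rho * exp (- kappa) / (p / 2))).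
  { apply Rmult_le_compat_l; [lra|exact S1]. }
  rewrite <- exp_plus. fold (rho - kappa).
  replace (PI / 2 * (exp (rho - kappa) / (p / 2))) with (/ sigma * exp (rho - kappa)).
  2:{ unfold p. field. lra. }
  apply Rle_trans with (/ sigma * exp (L + (p / 4 - p / 4 * (w / (ln w + L))))).
  { apply Rmult_le_compat_l; [left; apply Rinv_0_lt_compat; lra|]. apply exp_le_compat. lra. }
  rewrite exp_plus, EL. right. field. lra.
Qed.

(** * The improper integral *)

Lemma tail_vanishes (c k eps : R) : 0 < c -> 0 < eps ->
  exists T, 1 <= T /\ forall x, T <= x -> k * tail c x <= eps.
Proof.
  intros Hc He.
  set (q := Rabs k * 8 / c ^ 2).
  assert (Hc2 : 0 < c ^ 2) by (apply pow_lt; lra).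
  assert (Hq : 0 <= q) by (apply Rdiv_le_0_compat; [assert (H := Rabs_pos k); lra|exact Hc2]).
  exists (1 + q / eps). assert (Hqe : 0 <= q / eps) by (now apply Rdiv_le_0_compat).
  split; [lra|]. intros x Hx.
  assert (Ht := tail_le_inv c x Hc ltac:(lra)). assert (Hp := tail_pos c x).
  apply Rle_trans with (Rabs k * tail c x); [apply Rmult_le_compat_r; [lra|apply Rle_abs]|].
  apply Rle_trans with (Rabs k * (8 / (c ^ 2 * x))).
  { apply Rmult_le_compat_l; [apply Rabs_pos|exact Ht]. }
  replace (Rabs k * (8 / (c ^ 2 * x))) with (q / x) by (unfold q; field; lra).
  apply Rmult_le_reg_r with x; [lra|]. unfold Rdiv. rewrite Rmult_assoc, Rinv_l, Rmult_1_r by lra.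
  apply Rle_trans with (eps * (q / eps)); [right; field; lra|]. apply Rmult_le_compat_l; lra.
Qed.

Lemma exp_sinh_le_tail (c x : R) : exp (- (c * sinh x)) <= tail c x.
Proof.
  unfold tail. assert (H := cosh_ge_1 x). assert (H1 := exp_pos (- (c * sinh x))). nra.
Qed.

Lemma CInt_swap (f : R -> C) (a b : R) : ex_CInt f a b -> CInt f b a = (- CInt f a b)%C.
Proof.
  intros H. apply CInt_unique. apply (@is_RInt_swap C_R_NormedModule). now apply CInt_correct.
Qed.

(** Cauchy's criterion for both endpoints at once: moving them beyond [- T] and [T] changes the
    integral by two pieces, each controlled by a tail. *)
Lemma improper_integral_exists (G : R -> C) (k ca cb : R) :
  0 < ca -> 0 < cb -> 0 <= k -> (forall x, Rcont G x) ->
  (forall x, 0 <= x -> Cmod (G x) <= k * tail cb x) ->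
  (forall x, x <= 0 -> Cmod (G x) <= k * tail ca (- x)) ->
  exists I : C, forall eps, 0 < eps -> exists T, 1 <= T /\
    forall u v, u <= - T -> T <= v -> Cmod (CInt G u v - I)%C <= eps.
Proof.
  intros Hca Hcb Hk Hc Hr Hl.
  assert (ex : forall u v, ex_CInt G u v).
  { intros u v. apply (@ex_RInt_continuous C_R_CompleteNormedModule). intros; apply Hc. }
  assert (Bw : forall u v, 0 <= u <= v -> Cmod (CInt G u v) <= k / cb * tail cb u).
  { intros u v Huv.
    apply Rle_trans with (k * ((exp (- (cb * sinh u)) - exp (- (cb * sinh v))) / cb)).
    - apply CInt_bound with (fun x => k * tail cb x); [lra| |apply ex|].
      + intros x Hx. apply Hr; lra.
      + apply (@is_RInt_scal R_NormedModule), is_RInt_tail; lra.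
    - assert (H1 := exp_pos (- (cb * sinh v))). assert (H2 := exp_sinh_le_tail cb u).
      replace (k / cb * tail cb u) with (k * (tail cb u / cb)) by (field; lra).
      apply Rmult_le_compat_l; [exact Hk|]. unfold Rdiv. apply Rmult_le_compat_r; [left; now apply Rinv_0_lt_compat|lra]. }
  assert (Bl : forall u v, u <= v <= 0 -> Cmod (CInt G u v) <= k / ca * tail ca (- v)).
  { intros u v Huv.
    apply Rle_trans with (k * ((exp (- (ca * sinh (- v))) - exp (- (ca * sinh (- u)))) / ca)).
    - apply CInt_bound with (fun x => k * tail ca (- x)); [lra| |apply ex|].
      + intros x Hx. apply Hl; lra.
      + apply (@is_RInt_scal R_NormedModule).
        replace ((exp (- (ca * sinh (- v))) - exp (- (ca * sinh (- u)))) / ca) with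
          (opp ((exp (- (ca * sinh (- u))) - exp (- (ca * sinh (- v)))) / ca))
          by (unfold opp; simpl; field; lra).
        apply (is_RInt_ext (fun y => opp (opp (tail ca (- y))))).
        { intros; apply opp_opp. }
        apply (@is_RInt_opp R_NormedModule).
        apply (@is_RInt_comp_opp R_NormedModule (tail ca)). apply is_RInt_tail; lra.
    - assert (H1 := exp_pos (- (ca * sinh (- u)))). assert (H2 := exp_sinh_le_tail ca (- v)).
      replace (k / ca * tail ca (- v)) with (k * (tail ca (- v) / ca)) by (field; lra).
      apply Rmult_le_compat_l; [exact Hk|]. unfold Rdiv. apply Rmult_le_compat_r; [left; now apply Rinv_0_lt_compat|lra]. }
  assert (HB : forall eps, 0 < eps -> exists T, 1 <= T /\ forall u v u' v',
    u <= - T -> u' <= - T -> T <= v -> T <= v' -> Cmod (CInt G u v - CInt G u' v')%C <= eps).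
  { intros eps He.
    destruct (tail_vanishes cb (k / cb) (eps / 2) Hcb ltac:(lra)) as [T1 [HT1 H1]].
    destruct (tail_vanishes ca (k / ca) (eps / 2) Hca ltac:(lra)) as [T2 [HT2 H2]].
    exists (Rmax T1 T2).
    assert (M1 := Rmax_l T1 T2). assert (M2 := Rmax_r T1 T2). split; [lra|].
    intros u v u' v' Hu Hu' Hv Hv'.
    assert (E : (CInt G u v - CInt G u' v')%C = (CInt G u u' + CInt G v' v)%C).
    { rewrite (CInt_Chasles G u u' v), (CInt_Chasles G u' v' v) by apply ex. ring. }
    rewrite E. eapply Rle_trans; [apply Cmod_triangle|].
    replace eps with (eps / 2 + eps / 2) by field. apply Rplus_le_compat.
    - destruct (Rle_dec u u') as [L|L].
      + eapply Rle_trans; [apply Bl; lra|]. apply H2; lra.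
      + rewrite (CInt_swap G u' u), Cmod_opp by apply ex. eapply Rle_trans; [apply Bl; lra|]. apply H2; lra.
    - destruct (Rle_dec v' v) as [L|L].
      + eapply Rle_trans; [apply Bw; lra|]. apply H1; lra.
      + rewrite (CInt_swap G v v'), Cmod_opp by apply ex. eapply Rle_trans; [apply Bw; lra|]. apply H1; lra. }
  destruct (proj1 (filterlim_locally_cauchy (U := C_R_CompleteNormedModule)
     (F := filter_prod (Rbar_locally m_infty) (Rbar_locally p_infty))
     (fun uv => CInt G (fst uv) (snd uv)))) as [I HI].
  { intros eps. destruct (HB (eps / 2) ltac:(assert (H := cond_pos eps); lra)) as [T [HT H]].
    exists (fun uv => fst uv <= - T /\ T <= snd uv). split.
    - apply Filter_prod with (fun u => u <= - T) (fun v => T <= v).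
      + exists (- T). intros; lra.
      + exists T. intros; lra.
      + intros; split; assumption.
    - intros [u v] [u' v'] [H1 H2] [H3 H4]. simpl in *.
      apply (@norm_compat1 R_AbsRing C_R_NormedModule). rewrite <- Cmod_norm.
      eapply Rle_lt_trans; [apply (H u' v' u v); assumption|]. assert (H' := cond_pos eps). lra. }
  exists I. intros eps He.
  destruct (HB (eps / 2) ltac:(lra)) as [T [HT H]].
  exists T. split; [exact HT|]. intros u v Hu Hv.
  assert (Hloc : locally (T := C_R_CompleteNormedModule) I (fun z => Cmod (z - I)%C < eps / 2)).
  { apply (@locally_le_locally_norm R_AbsRing C_R_NormedModule).
    exists (mkposreal (eps / 2) ltac:(lra)). intros z Hz.
    change (norm (minus z I : C_R_NormedModule) < eps / 2) in Hz. rewrite <- Cmod_norm in Hz. exact Hz. }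
  specialize (HI _ Hloc). destruct HI as [Q R [T1 HQ] [T2 HR] HQR].
  (* Endpoints far enough out for the Cauchy bound and for the limit alike; they link the integral
     from [u] to [v] with [I]. *)
  set (u' := Rmin (- T) (T1 - 1)). set (v' := Rmax T (T2 + 1)).
  assert (U1 := Rmin_l (- T) (T1 - 1)). assert (U2 := Rmin_r (- T) (T1 - 1)).
  assert (V1 := Rmax_l T (T2 + 1)). assert (V2 := Rmax_r T (T2 + 1)).
  fold u' in U1, U2. fold v' in V1, V2.
  assert (N := HQR u' v' (HQ u' ltac:(lra)) (HR v' ltac:(lra))). simpl in N.
  assert (N2 := H u v u' v' Hu U1 Hv V1).
  replace (CInt G u v - I)%C with ((CInt G u v - CInt G u' v') + (CInt G u' v' - I))%C by ring.
  eapply Rle_trans; [apply Cmod_triangle|]. lra.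
Qed.

(** * Change of variables on the positive axis *)

Lemma psiR_pos (x : R) : 0 < psiR x.
Proof. apply exp_pos. Qed.

Lemma psiR_lt (x y : R) : x < y -> psiR x < psiR y.
Proof.
  intros H. apply exp_increasing. apply Rmult_lt_compat_l; [assert (HP := PI_RGT_0); lra|now apply sinh_lt].
Qed.

Definition psiR_inv (t : R) : R := arcsinh (2 / PI * ln t).

Lemma psiR_inv_spec (t : R) : 0 < t -> psiR (psiR_inv t) = t.
Proof.
  intros Ht. assert (HP := PI_RGT_0). unfold psiR, psiR_inv. rewrite sinh_arcsinh.
  replace (PI / 2 * (2 / PI * ln t)) with (ln t) by (field; lra). now apply exp_ln.
Qed.

Lemma psiR_le_inv (x y : R) : psiR x <= psiR y -> x <= y.
Proof.
  intros H. apply Rnot_lt_le. intros C. assert (N := psiR_lt y x C). lra.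
Qed.

Lemma psi_strip_real (d t : R) : 0 < d -> 0 < t -> psi_strip d (RtoC t).
Proof.
  intros Hd Ht. exists (RtoC (psiR_inv t)). split.
  - unfold strip. simpl. rewrite Rabs_R0. exact Hd.
  - now rewrite psiC_real, psiR_inv_spec.
Qed.

Lemma Rcont_positive_axis (d : R) (f : C -> C) (t : R) : 0 < d -> analytic_on (psi_strip d) f ->
  0 < t -> Rcont (fun t : R => f (RtoC t)) t.
Proof.
  intros Hd Hf Ht. apply (Rcont_horizontal f t 0). apply ex_Cderive_continuous.
  destruct (Hf (RtoC t) (psi_strip_real d t Hd Ht)) as [l Hl].
  exists l. now apply is_Cderive_of_derive.
Qed.

Lemma substitution (d : R) (f : C -> C) (u v : R) : 0 < d -> analytic_on (psi_strip d) f ->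
  CInt (fun t => f (RtoC t)) (psiR u) (psiR v) = CInt (fun x => integrand f (x, 0)) u v.
Proof.
  intros Hd Hf. symmetry. apply CInt_unique.
  apply (@is_RInt_ext C_R_NormedModule
    (fun x => @scal R_AbsRing C_R_NormedModule (psiR x * (PI / 2 * cosh x)) (f (RtoC (psiR x))))).
  - intros x _. unfold integrand. change (x, 0) with (RtoC x).
    rewrite psiC_real, dpsi_real, (is_derive_unique _ _ _ (is_derive_psiR x)).
    destruct (f (RtoC (psiR x))) as [p q].
    unfold Cmult, RtoC; simpl. unfold scal; simpl; unfold prod_scal; simpl. unfold scal; simpl; unfold mult; simpl.
    f_equal; ring.
  - apply (@is_RInt_comp C_R_CompleteNormedModule (fun t => f (RtoC t))).
    + intros x _. apply (Rcont_positive_axis d f); trivial. apply psiR_pos.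
    + intros x _. split; [apply is_derive_psiR|].
      apply (ex_derive_continuous (fun x => psiR x * (PI / 2 * cosh x))). unfold psiR. now auto_derive.
Qed.

(** The increasing bijection [psiR] matches right neighbourhoods of 0 and neighbourhoods of infinity
    with the two half-lines beyond [- T] and [T]. *)
Lemma is_RInt_gen_of_substitution (d : R) (f : C -> C) (I : C) :
  0 < d -> analytic_on (psi_strip d) f ->
  (forall eps, 0 < eps -> exists T, 1 <= T /\ forall u v, u <= - T -> T <= v ->
    Cmod (CInt (fun x => integrand f (x, 0)) u v - I)%C <= eps) ->
  is_RInt_gen (fun t : R => f (RtoC t)) (at_right 0) (Rbar_locally p_infty) I.
Proof.
  intros Hd Hf HI P HP.
  apply (@locally_norm_le_locally R_AbsRing C_R_NormedModule) in HP.
  destruct HP as [eps HP].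
  destruct (HI (eps / 2) ltac:(assert (H := cond_pos eps); lra)) as [T [HT H]].
  apply Filter_prod with (fun a => 0 < a <= psiR (- T)) (fun b => psiR T <= b).
  - exists (mkposreal _ (psiR_pos (- T))). intros a Ha Ha0.
    change (Rabs (a - 0) < psiR (- T)) in Ha. rewrite Rminus_0_r, Rabs_pos_eq in Ha by lra. lra.
  - exists (psiR T). intros; lra.
  - intros a b [Ha0 Ha] Hb. simpl.
    assert (Hb0 : 0 < b) by (assert (N := psiR_pos T); lra).
    exists (CInt (fun t => f (RtoC t)) a b). split.
    + apply CInt_correct. apply ex_CInt_cont.
      * apply Rle_trans with (psiR (- T)); [exact Ha|]. apply Rle_trans with (psiR T); [|exact Hb].
        left; apply psiR_lt; lra.
      * intros x Hx. apply (Rcont_positive_axis d f); trivial; lra.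
    + apply HP. change (norm (minus (CInt (fun t => f (RtoC t)) a b) I : C_R_NormedModule) < eps).
      rewrite <- Cmod_norm.
      apply Rle_lt_trans with (eps / 2); [|assert (N := cond_pos eps); lra].
      rewrite <- (psiR_inv_spec a), <- (psiR_inv_spec b) by assumption.
      rewrite (substitution d f) by assumption.
      apply H; apply psiR_le_inv; rewrite psiR_inv_spec; assumption.
Qed.

(** * Reindexing of finite sums *)

Lemma sum_n_m_rev {G : AbelianMonoid} (b : nat -> G) (m : nat) :
  sum_n_m (fun j => b (m - j)%nat) 0 m = sum_n_m b 0 m.
Proof.
  induction m as [|m IH]; [now rewrite !sum_n_n|].
  rewrite sum_Sn_m by lia. rewrite <- sum_n_m_S.
  rewrite (sum_n_Sm b 0 m) by lia. rewrite <- IH, plus_comm. reflexivity.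
Qed.

Lemma sum_n_m_shift {G : AbelianMonoid} (b : nat -> G) (q r : nat) :
  sum_n_m b q (q + r) = sum_n_m (fun j => b (q + j)%nat) 0 r.
Proof.
  revert b; induction q as [|q IH]; intros b; [reflexivity|].
  change (S q + r)%nat with (S (q + r)). rewrite <- sum_n_m_S. apply IH.
Qed.

Lemma Cmod_sum_n_m (b : nat -> C) (g : nat -> R) (m : nat) :
  (forall j, (j <= m)%nat -> Cmod (b j) <= g j) -> Cmod (sum_n_m b 0 m) <= sum_n_m g 0 m.
Proof.
  induction m as [|m IH]; intros H.
  - rewrite !sum_n_n. apply H; lia.
  - rewrite !sum_n_Sm by lia. eapply Rle_trans; [apply Cmod_triangle|].
    apply Rplus_le_compat; [apply IH; intros; apply H; lia|apply H; lia].
Qed.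

(** The range [- M .. N] is widened by [m + 1] indices on each side. The left block is reversed so
    that both outer sums run away from the range, as the tail estimates require. *)
Lemma sum_window (a : Z -> C) (M N : Z) (m : nat) : (0 <= M + N)%Z ->
  sum_n_m (fun j => a (- M - 1 - Z.of_nat m + Z.of_nat j)%Z) 0 (S m + (Z.to_nat (M + N) + S m))
  = (sum_n_m (fun j => a (- (M + 1 + Z.of_nat j))%Z) 0 m + zsum a (- M) N
    + sum_n_m (fun j => a (N + 1 + Z.of_nat j)%Z) 0 m)%C.
Proof.
  intros HMN. set (r := Z.to_nat (M + N)).
  assert (Hr : Z.of_nat r = (M + N)%Z) by (apply Z2Nat.id; lia).
  set (b := fun j => a (- M - 1 - Z.of_nat m + Z.of_nat j)%Z).
  rewrite (sum_n_m_Chasles b 0 m) by lia.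
  rewrite (sum_n_m_Chasles b (S m) (S m + r)) by lia.
  replace (S m + (r + S m))%nat with (S (S m + r) + m)%nat by lia.
  rewrite !sum_n_m_shift.
  change (plus ?u (plus ?v ?w)) with (Cplus u (Cplus v w)).
  rewrite Cplus_assoc. f_equal; [f_equal|].
  - rewrite <- (sum_n_m_rev b). apply sum_n_m_ext_loc. intros j Hj. unfold b. f_equal. lia.
  - unfold zsum. destruct (Z.ltb_spec N (- M)) as [L|L]; [lia|].
    replace (Z.to_nat (N - - M)) with r by (unfold r; f_equal; lia).
    apply sum_n_m_ext_loc. intros j Hj. unfold b. f_equal. lia.
  - apply sum_n_m_ext_loc. intros j Hj. unfold b. f_equal. lia.
Qed.

Lemma is_RInt_two_tails (ca cb A B : R) : 0 < ca -> 0 < cb -> A <= 0 <= B ->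
  exists lg, is_RInt (fun x => if Rle_dec 0 x then tail cb x else tail ca (- x)) A B lg
    /\ lg <= / ca + / cb.
Proof.
  intros Ha Hb HAB.
  exists (plus ((exp (- (ca * sinh 0)) - exp (- (ca * sinh (- A)))) / ca)
      ((exp (- (cb * sinh 0)) - exp (- (cb * sinh B))) / cb)).
  split.
  - apply (@is_RInt_Chasles R_NormedModule) with 0.
    + apply (is_RInt_ext (fun x => tail ca (- x))).
      { rewrite Rmin_left, Rmax_right by lra. intros x Hx. destruct (Rle_dec 0 x); [lra|reflexivity]. }
      replace ((exp (- (ca * sinh 0)) - exp (- (ca * sinh (- A)))) / ca) with
        (opp ((exp (- (ca * sinh (- A))) - exp (- (ca * sinh (- 0)))) / ca))
        by (rewrite Ropp_0; unfold opp; simpl; field; lra).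
      apply (is_RInt_ext (fun y => opp (opp (tail ca (- y))))).
      { intros; apply opp_opp. }
      apply (@is_RInt_opp R_NormedModule).
      apply (@is_RInt_comp_opp R_NormedModule (tail ca)). apply is_RInt_tail; lra.
    + apply (is_RInt_ext (tail cb)).
      { rewrite Rmin_left, Rmax_right by lra. intros x Hx. destruct (Rle_dec 0 x); [reflexivity|lra]. }
      apply is_RInt_tail; lra.
  - change (plus ?u ?v) with (u + v). rewrite sinh_0, !Rmult_0_r, Ropp_0, exp_0.
    assert (H1 := exp_pos (- (ca * sinh (- A)))). assert (H2 := exp_pos (- (cb * sinh B))).
    assert (0 < / ca) by now apply Rinv_0_lt_compat. assert (0 < / cb) by now apply Rinv_0_lt_compat.
    unfold Rdiv. nra.
Qed.

(** * The quadrature error *)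

Section Quadrature.

Variables (d K alpha beta : R) (f : C -> C).
Hypothesis Hd0 : 0 < d.
Hypothesis Hd : d < PI / 2.
Hypothesis Hf : analytic_on (psi_strip d) f.
Hypothesis HK : 0 < K.
Hypothesis Ha : 0 < alpha.
Hypothesis Hb : 0 < beta.
Hypothesis Hbound : forall z : C, psi_strip d z ->
     Cmod (f z) <= K * Cmod (Cppow z (RtoC (alpha - 1))
                          / Cppow (1 + z * z)%C (RtoC ((alpha + beta) / 2)))%C.

Let F := integrand f.

Lemma Cmod_integrand_right_real (x : R) : 0 <= x ->
  Cmod (F (RtoC x)) <= K * (PI / 2 * tail (PI / 2 * beta) x).
Proof.
  intros Hx. eapply Rle_trans.
  - apply (Cmod_integrand_right d K alpha beta f) with (Y := 0); trivial; rewrite ?Rabs_R0; lra.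
  - unfold amplitude. rewrite sin_0, Rmult_0_r, cos_0, Rmult_1_r.
    unfold Rpower. rewrite ln_1, Rmult_0_r, exp_0. right. field.
Qed.

Lemma Cmod_integrand_left_real (x : R) : x <= 0 ->
  Cmod (F (RtoC x)) <= K * (PI / 2 * tail (PI / 2 * alpha) (- x)).
Proof.
  intros Hx. eapply Rle_trans.
  - apply (Cmod_integrand_left d K alpha beta f) with (Y := 0); trivial; rewrite ?Rabs_R0; lra.
  - unfold amplitude. rewrite sin_0, Rmult_0_r, cos_0, Rmult_1_r.
    unfold Rpower. rewrite ln_1, Rmult_0_r, exp_0. right. field.
Qed.

Lemma integral_exists : exists I : C, forall eps, 0 < eps -> exists T, 1 <= T /\
  forall u v, u <= - T -> T <= v -> Cmod (CInt (fun x => F (x, 0)) u v - I)%C <= eps.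
Proof.
  assert (HP := PI_RGT_0).
  apply (improper_integral_exists (fun x => F (x, 0)) (K * (PI / 2)) (PI / 2 * alpha) (PI / 2 * beta)).
  - nra.
  - nra.
  - nra.
  - intros x. apply (Rcont_horizontal F x 0), ex_Cderive_continuous, (ex_Cderive_integrand d f Hf).
    rewrite Rabs_R0. exact Hd0.
  - intros x Hx. rewrite Rmult_assoc. now apply Cmod_integrand_right_real.
  - intros x Hx. rewrite Rmult_assoc. now apply Cmod_integrand_left_real.
Qed.

(** The amplitude times the tail integrals over the two half-lines, each [1 / c]: a bound for the
    integral of [|F|] along height [Y] or [- Y]. *)
Definition line_bound (Y : R) : R :=
  amplitude K alpha beta Y * (/ (PI / 2 * alpha * cos Y) + / (PI / 2 * beta * cos Y)).

(** The finite trapezoidal estimate is applied to a window so wide that its vertical sides and the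
    missing part of the integral cost at most [eps]. As [TL] and [TR] bound all partial tail sums,
    the width of the window drops out. *)
Lemma quadrature_error (I : C) (Y h TL TR : R) (M N : Z) :
  0 < Y < d -> 0 < h -> (0 <= M)%Z -> (0 <= N)%Z ->
  (forall eps, 0 < eps -> exists T, 1 <= T /\
     forall u v, u <= - T -> T <= v -> Cmod (CInt (fun x => F (x, 0)) u v - I)%C <= eps) ->
  (forall m, PI / 2 * (h * sum_n_m (fun j => tail (PI / 2 * alpha) (IZR M * h + INR (S j) * h)) 0 m) <= TL) ->
  (forall m, PI / 2 * (h * sum_n_m (fun j => tail (PI / 2 * beta) (IZR N * h + INR (S j) * h)) 0 m) <= TR) ->
  Cmod (I - RtoC h * zsum (fun k => F (RtoC (IZR k * h))) (- M) N)%C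
  <= 2 * (line_bound Y / (exp (2 * PI / h * Y) - 1)) + K * (TL + TR).
Proof.
  intros HY Hh HM HN HI HTL HTR. assert (HP := PI_RGT_0).
  assert (HcY : 0 < cos Y) by (apply cos_gt_0; lra).
  set (ca := PI / 2 * alpha * cos Y). set (cb := PI / 2 * beta * cos Y).
  assert (Hca : 0 < ca) by (unfold ca; apply Rmult_lt_0_compat; [nra|exact HcY]).
  assert (Hcb : 0 < cb) by (unfold cb; apply Rmult_lt_0_compat; [nra|exact HcY]).
  assert (HA : 0 < amplitude K alpha beta Y) by (now apply amplitude_pos).
  assert (right_bound := fun x y => Cmod_integrand_right d K alpha beta f Hd HK Ha Hb Hbound x y Y).
  assert (left_bound := fun x y => Cmod_integrand_left d K alpha beta f Hd HK Ha Hb Hbound x y Y).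
  set (AY := amplitude K alpha beta Y) in *. fold ca in left_bound. fold cb in right_bound. fold F in left_bound, right_bound.
  apply le_epsilon. intros eps He.
  destruct (HI (eps / 2) ltac:(lra)) as [T1 [HT1 H1]].
  (* Half of [eps] went to the integral outside the window; the vertical sides, with the coefficient
     [6 Y] of [trapezoid_finite], get a quarter each. *)
  destruct (tail_vanishes ca (6 * Y * AY) (eps / 4) Hca ltac:(lra)) as [T2 [HT2 H2]].
  destruct (tail_vanishes cb (6 * Y * AY) (eps / 4) Hcb ltac:(lra)) as [T3 [HT3 H3]].
  set (T := T1 + T2 + T3).
  destruct (nfloor_ex (T / h)) as [m0 [_ Hm0]].
  { apply Rdiv_le_0_compat; unfold T; lra. }
  set (m := S m0).
  assert (Hm : T <= INR m * h).
  { unfold m. rewrite S_INR. apply Rmult_le_reg_r with (/ h); [now apply Rinv_0_lt_compat|].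
    rewrite Rmult_assoc, Rinv_r, Rmult_1_r by lra. unfold Rdiv in Hm0. lra. }
  set (a := fun k : Z => F (RtoC (IZR k * h))).
  (* The window has [m + 1] indices beyond [- M] and beyond [N]; the contour lies another half step
     further out. *)
  set (lo := (- M - 1 - Z.of_nat m)%Z). set (p := (S m + (Z.to_nat (M + N) + S m))%nat).
  assert (Hlop : (lo + Z.of_nat p)%Z = (N + 1 + Z.of_nat m)%Z).
  { unfold lo, p. rewrite !Nat2Z.inj_add, !Nat2Z.inj_succ, Z2Nat.id by lia. lia. }
  assert (HMr : 0 <= IZR M) by (now apply IZR_le). assert (HNr : 0 <= IZR N) by (now apply IZR_le).
  set (A := IZR lo * h - h / 2). set (B := IZR (lo + Z.of_nat p) * h + h / 2).
  assert (HAT : A <= - T).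
  { unfold A, lo. rewrite !minus_IZR, opp_IZR, <- INR_IZR_INZ. nra. }
  assert (HBT : T <= B).
  { unfold B. rewrite Hlop, !plus_IZR, <- INR_IZR_INZ. nra. }
  assert (HTs : 3 <= T) by (unfold T; lra).
  destruct (is_RInt_two_tails ca cb A B Hca Hcb ltac:(lra)) as [lg [Hlg Hlg2]].
  assert (trap := trapezoid_finite F
    (fun x => AY * (if Rle_dec 0 x then tail cb x else tail ca (- x))) h Y (AY * lg)
    (AY * tail ca (- A) + AY * tail cb B) lo p Hh (proj1 HY)).
  fold A B in trap.
  assert (Pa := tail_pos ca (- A)). assert (Pb := tail_pos cb B).
  specialize (trap (fun x y Hy => ex_Cderive_integrand d f Hf x y ltac:(apply Rabs_def1; lra))).
  assert (RY : Rabs Y <= Y) by (rewrite Rabs_pos_eq; lra).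
  assert (RY' : Rabs (- Y) <= Y) by (rewrite Rabs_Ropp; exact RY).
  specialize (trap ltac:(intros x _; cbv beta;
    destruct (Rle_dec 0 x); split; first [apply right_bound; lra | apply left_bound; lra])).
  specialize (trap (@is_RInt_scal R_NormedModule _ _ _ AY _ Hlg)).
  specialize (trap ltac:(intros y Hy; assert (Rabs y <= Y) by (apply Rabs_le_between; lra); split;
    [apply Rle_trans with (AY * tail ca (- A)); [apply left_bound; lra|nra]
    |apply Rle_trans with (AY * tail cb B); [apply right_bound; lra|nra]])).
  change (fun j : nat => F (RtoC (IZR (lo + Z.of_nat j) * h))) with (fun j : nat => a (lo + Z.of_nat j)%Z) in trap.
  unfold lo at 1, p at 1 in trap.
  rewrite sum_window in trap by lia.
  assert (HL : h * Cmod (sum_n_m (fun j => a (- (M + 1 + Z.of_nat j))%Z) 0 m) <= K * TL).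
  { apply Rle_trans with (h * sum_n_m (fun j => K * (PI / 2 * tail (PI / 2 * alpha) (IZR M * h + INR (S j) * h))) 0 m).
    - apply Rmult_le_compat_l; [lra|]. apply Cmod_sum_n_m. intros j _. unfold a.
      eapply Rle_trans; [apply Cmod_integrand_left_real|].
      + rewrite opp_IZR, !plus_IZR, <- INR_IZR_INZ. assert (Hj := pos_INR j). nra.
      + right. do 3 f_equal. rewrite opp_IZR, !plus_IZR, <- INR_IZR_INZ, S_INR. ring.
    - assert (E := sum_n_m_mult_l (K := R_Ring) (K * (PI / 2)) (fun j => tail (PI / 2 * alpha) (IZR M * h + INR (S j) * h)) 0 m).
      rewrite (sum_n_m_ext _ (fun j => mult (K * (PI / 2)) (tail (PI / 2 * alpha) (IZR M * h + INR (S j) * h)))).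
      2:{ intros j. exact (eq_sym (Rmult_assoc _ _ _)). }
      rewrite E. change (mult ?u ?v) with (u * v).
      rewrite <- Rmult_assoc, (Rmult_comm h), Rmult_assoc, Rmult_assoc.
      apply Rmult_le_compat_l; [lra|apply HTL]. }
  assert (HR : h * Cmod (sum_n_m (fun j => a (N + 1 + Z.of_nat j)%Z) 0 m) <= K * TR).
  { apply Rle_trans with (h * sum_n_m (fun j => K * (PI / 2 * tail (PI / 2 * beta) (IZR N * h + INR (S j) * h))) 0 m).
    - apply Rmult_le_compat_l; [lra|]. apply Cmod_sum_n_m. intros j _. unfold a.
      eapply Rle_trans; [apply Cmod_integrand_right_real|].
      + rewrite !plus_IZR, <- INR_IZR_INZ. assert (Hj := pos_INR j). nra.
      + right. do 3 f_equal. rewrite !plus_IZR, <- INR_IZR_INZ, S_INR. ring.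
    - assert (E := sum_n_m_mult_l (K := R_Ring) (K * (PI / 2)) (fun j => tail (PI / 2 * beta) (IZR N * h + INR (S j) * h)) 0 m).
      rewrite (sum_n_m_ext _ (fun j => mult (K * (PI / 2)) (tail (PI / 2 * beta) (IZR N * h + INR (S j) * h)))).
      2:{ intros j. exact (eq_sym (Rmult_assoc _ _ _)). }
      rewrite E. change (mult ?u ?v) with (u * v).
      rewrite <- Rmult_assoc, (Rmult_comm h), Rmult_assoc, Rmult_assoc.
      apply Rmult_le_compat_l; [lra|apply HTR]. }
  specialize (H1 A B ltac:(unfold T in *; lra) ltac:(unfold T in *; lra)).
  specialize (H2 (- A) ltac:(unfold T in *; lra)). specialize (H3 B ltac:(unfold T in *; lra)).
  destruct (exp_gt_1_pos h Y Hh (proj1 HY)) as [Q1 Q2].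
  assert (Q3 : AY * lg / (exp (2 * PI / h * Y) - 1) <= line_bound Y / (exp (2 * PI / h * Y) - 1)).
  { unfold line_bound. fold AY ca cb. unfold Rdiv. apply Rmult_le_compat_r; [left; apply Rinv_0_lt_compat; lra|].
    apply Rmult_le_compat_l; lra. }
  revert trap HL HR H1.
  generalize (sum_n_m (fun j => a (- (M + 1 + Z.of_nat j))%Z) 0 m) as sl.
  generalize (sum_n_m (fun j => a (N + 1 + Z.of_nat j)%Z) 0 m) as sr.
  generalize (CInt (fun x => F (x, 0)) A B) as J.
  generalize (zsum a (- M) N) as z.
  intros z J sr sl trap HL HR H1.
  change (scal AY lg) with (AY * lg) in trap.
  replace (I - RtoC h * z)%C with (- (J - I) + (- (RtoC h * (sl + z + sr) - J) + (RtoC h * sl + RtoC h * sr)))%C by ring.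
  assert (C1 := Cmod_triangle (- (J - I))%C (- (RtoC h * (sl + z + sr) - J) + (RtoC h * sl + RtoC h * sr))%C).
  assert (C2 := Cmod_triangle (- (RtoC h * (sl + z + sr) - J))%C (RtoC h * sl + RtoC h * sr)%C).
  assert (C3 := Cmod_triangle (RtoC h * sl)%C (RtoC h * sr)%C).
  rewrite !Cmod_mult, Cmod_R, Rabs_pos_eq in C3 by lra.
  rewrite Cmod_opp in C1, C2.
  lra.
Qed.

(** The explicit right-hand side is continuous at [d]: if [c] exceeded its value there, it would
    exceed it at some [Y] slightly below [d] too. *)
Lemma line_bound_limit (h c : R) : 0 < h ->
  (forall Y, 0 < Y < d -> c <= 2 * (line_bound Y / (exp (2 * PI / h * Y) - 1))) ->
  c <= 2 * (line_bound d / (exp (2 * PI / h * d) - 1)).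
Proof.
  intros Hh H. assert (HP := PI_RGT_0). set (D := fun Y => 2 * (line_bound Y / (exp (2 * PI / h * Y) - 1))).
  assert (Hcd : 0 < cos d) by (apply cos_gt_0; lra).
  assert (Hq : 0 < cos (PI / 2 * sin d)) by (apply cos_half_pi_sin_pos; rewrite Rabs_pos_eq; lra).
  destruct (exp_gt_1_pos h d Hh Hd0) as [Q1 Q2].
  assert (cont : continuous D d).
  { apply (ex_derive_continuous D). unfold D, line_bound, amplitude, Rpower. auto_derive.
    repeat split; trivial; try (apply Rgt_not_eq, exp_pos); try lra; apply Rgt_not_eq.
    - apply Rmult_lt_0_compat; [apply Rmult_lt_0_compat; lra|exact Hcd].
    - apply Rmult_lt_0_compat; [apply Rmult_lt_0_compat; lra|exact Hcd]. }
  apply Rnot_lt_le. intros N.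
  assert (L : locally d (fun Y => D Y < c)).
  { apply (cont (fun y => y < c)). exact (open_lt c _ N). }
  destruct L as [del L].
  (* Positive, below [d], and within [del] of it. *)
  set (Y := Rmax (d / 2) (d - del / 2)). assert (Hdel := cond_pos del).
  assert (Y1 := Rmax_l (d / 2) (d - del / 2)). assert (Y2 := Rmax_r (d / 2) (d - del / 2)). fold Y in Y1, Y2.
  assert (Y3 : Y < d) by (unfold Y; apply Rmax_lub_lt; lra).
  specialize (H Y ltac:(lra)). specialize (L Y).
  assert (D Y < c); [|unfold D in *; lra].
  apply L. change (Rabs (Y - d) < del). rewrite Rabs_left by lra. lra.
Qed.

End Quadrature.

(** * The choice of [h], [M], [N] and the final constant *)

Lemma zsum_ext (a b : Z -> C) (lo hi : Z) : (forall k, a k = b k) -> zsum a lo hi = zsum b lo hi.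
Proof.
  intros E. unfold zsum. destruct (Z.ltb hi lo); [reflexivity|].
  apply sum_n_m_ext. intros j. apply E.
Qed.

(** The origin of [PI mu e / 4] in the constant: with [u = 8 d n / mu] the final exponent is
    [(PI mu / 4) (u / ln u)]. The proof is [ln u <= exp (ln u - 1)]. *)
Lemma ln_le_x_div_e (u : R) : exp 1 <= u -> exp 1 <= u / ln u.
Proof.
  intros Hu. assert (Hp := exp_pos 1).
  assert (L1 : 1 <= ln u) by (rewrite <- (ln_exp 1); apply ln_le; [apply exp_pos|exact Hu]).
  apply Rmult_le_reg_r with (ln u); [lra|]. unfold Rdiv. rewrite Rmult_assoc, Rinv_l, Rmult_1_r by lra.
  replace u with (exp 1 * exp (ln u - 1)) at 2.
  - apply Rmult_le_compat_l; [lra|]. assert (H := exp_ineq1_le (ln u - 1)). lra.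
  - rewrite <- exp_plus. replace (1 + (ln u - 1)) with (ln u) by ring. apply exp_ln. lra.
Qed.

(** Rounding down can only push the truncation point outwards. With [x = ln (sigma / mu)] and
    [lu = ln (8 d n / mu)], the lower bound is [ln (8 d n / sigma)]. *)
Lemma mul_floor_le (x lu h : R) (n : nat) : 0 < h -> INR n * h = lu ->
  lu - x <= IZR (Z.of_nat n - Int_part (x / h)) * h.
Proof.
  intros Hh Hl. rewrite minus_IZR, <- INR_IZR_INZ.
  destruct (base_Int_part (x / h)) as [H _].
  assert (IZR (Int_part (x / h)) * h <= x).
  { apply Rle_trans with (x / h * h); [apply Rmult_le_compat_r; lra|right; field; lra]. }
  lra.
Qed.

Theorem theorem8 (d K alpha beta : R) (f : C -> C) (n : nat) :
  0 < d -> d < PI / 2 ->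
  analytic_on (psi_strip d) f ->
  0 < K -> 0 < alpha -> 0 < beta ->
  (forall z : C, psi_strip d z ->
     Cmod (f z) <= K * Cmod (Cppow z (RtoC (alpha - 1))
                          / Cppow (1 + z * z)%C (RtoC ((alpha + beta) / 2)))%C) ->
  (0 < n)%nat ->
  let mu := Rmin alpha beta in
  let nu := Rmax alpha beta in
  let h := ln (8 * d * INR n / mu) / INR n in
  let M : Z := if Rle_dec alpha beta then Z.of_nat n
               else (Z.of_nat n - Int_part (ln (alpha / beta) / h))%Z in
  let N : Z := if Rle_dec alpha beta
               then (Z.of_nat n - Int_part (ln (beta / alpha) / h))%Z
               else Z.of_nat n in
  INR n >= nu * exp 1 / (8 * d) ->
  IZR M * h >= x_gamma (alpha / 2) ->
  IZR N * h >= x_gamma (beta / 2) ->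
  let C2 := 2 * K / mu *
      (2 / ((1 - exp (- (PI * mu * exp 1 / 4)))
            * Rpower (cos (PI / 2 * sin d)) ((alpha + beta) / 2) * cos d)
       + exp (PI * nu / 4)) in
  exists I : C,
    is_RInt_gen (fun t : R => f (RtoC t)) (at_right 0) (Rbar_locally p_infty) I /\
    Cmod (I - (RtoC h * zsum (fun k : Z =>
                 f (RtoC (psiR (IZR k * h))) * RtoC (Derive psiR (IZR k * h)))%C
               (- M) N))%C
    <= C2 * exp (- (2 * PI * d * INR n) / ln (8 * d * INR n / mu)).
Proof.
  intros Hd0 Hd Hf HK Ha Hb Hbound Hn mu nu h M N Hnn HM HN C2.
  assert (HP := PI_RGT_0). assert (He := exp_pos 1). assert (Hn0 := lt_0_INR n Hn).
  destruct (integral_exists d K alpha beta f Hd0 Hd Hf HK Ha Hb Hbound) as [I HI].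
  exists I. split; [now apply (is_RInt_gen_of_substitution d f I)|].
  assert (Hmu : 0 < mu) by (now apply Rmin_pos).
  assert (Hmua : mu <= alpha) by apply Rmin_l. assert (Hmub : mu <= beta) by apply Rmin_r.
  assert (Hnua : alpha <= nu) by apply Rmax_l. assert (Hnub : beta <= nu) by apply Rmax_r.
  assert (Hdn : nu * exp 1 <= 8 * d * INR n).
  { apply Rge_le in Hnn. apply (Rmult_le_compat_l (8 * d)) in Hnn; [|lra].
    replace (8 * d * (nu * exp 1 / (8 * d))) with (nu * exp 1) in Hnn by (field; lra). lra. }
  assert (Hw : forall sigma, 0 < sigma <= nu -> exp 1 <= 8 * d * INR n / sigma).
  { intros sigma Hs. apply Rmult_le_reg_r with sigma; [lra|]. unfold Rdiv.
    rewrite Rmult_assoc, Rinv_l, Rmult_1_r by lra. nra. }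
  set (u := 8 * d * INR n / mu) in *. set (lu := ln u) in *.
  assert (Hu : exp 1 <= u) by (apply Hw; lra).
  assert (Hlu : 1 <= lu) by (unfold lu; rewrite <- (ln_exp 1); apply ln_le; assumption).
  assert (Hh : 0 < h) by (apply Rdiv_lt_0_compat; lra).
  assert (Hnh : INR n * h = lu) by (unfold h; field; lra).
  assert (Hlog : forall sigma, 0 < sigma -> ln (8 * d * INR n / sigma) + ln (sigma / mu) = lu).
  { intros sigma Hs. rewrite <- ln_mult.
    - unfold lu, u. f_equal. field. lra.
    - apply Rdiv_lt_0_compat; [nra|exact Hs].
    - now apply Rdiv_lt_0_compat. }
  (* Each truncation point reaches [ln (8 d n / sigma)] for its own rate [sigma]: with equality for
     the smaller rate, through the floor for the other. *)
  assert (HMw : ln (8 * d * INR n / alpha) <= IZR M * h).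
  { assert (E := Hlog alpha Ha). unfold M. destruct (Rle_dec alpha beta) as [L|L].
    - assert (Em : mu = alpha) by (now apply Rmin_left).
      rewrite <- INR_IZR_INZ, Hnh. unfold lu, u. rewrite Em. apply Rle_refl.
    - assert (Em : mu = beta) by (apply Rmin_right; lra). rewrite Em in E.
      eapply Rle_trans; [|apply (mul_floor_le _ lu h n Hh Hnh)]. lra. }
  assert (HNw : ln (8 * d * INR n / beta) <= IZR N * h).
  { assert (E := Hlog beta Hb). unfold N. destruct (Rle_dec alpha beta) as [L|L].
    - assert (Em : mu = alpha) by (now apply Rmin_left). rewrite Em in E.
      eapply Rle_trans; [|apply (mul_floor_le _ lu h n Hh Hnh)]. lra.
    - assert (Em : mu = beta) by (apply Rmin_right; lra).
      rewrite <- INR_IZR_INZ, Hnh. unfold lu, u. rewrite Em. apply Rle_refl. }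
  (* From here on [M] and [N] enter only through lower bounds on their multiples of [h]. *)
  clearbody M N.
  assert (Hpos : forall (k : Z) sigma, 0 < sigma <= nu -> ln (8 * d * INR n / sigma) <= IZR k * h -> (0 <= k)%Z).
  { intros k sigma Hs Hk. apply le_IZR.
    assert (1 <= ln (8 * d * INR n / sigma)) by (rewrite <- (ln_exp 1); apply ln_le; [exact He|now apply Hw]).
    nra. }
  (* [E] is the exponent of the claim; it equals [2 PI d / h] and, by [HE], also the exponent in
     [tail_sum_le] for either rate. *)
  set (E := 2 * PI * d * INR n / lu).
  assert (HE : forall sigma, 0 < sigma ->
    PI * sigma / 4 * (8 * d * INR n / sigma / (ln (8 * d * INR n / sigma) + ln (sigma / mu))) = E).
  { intros sigma Hs. rewrite Hlog by exact Hs. unfold E. field. lra. }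
  set (TT := / mu * (exp (PI * nu / 4) * exp (- E))).
  assert (HT : forall sigma (k : Z), mu <= sigma -> sigma <= nu -> ln (8 * d * INR n / sigma) <= IZR k * h ->
    x_gamma (sigma / 2) <= IZR k * h -> forall m,
    PI / 2 * (h * sum_n_m (fun j => tail (PI / 2 * sigma) (IZR k * h + INR (S j) * h)) 0 m) <= TT).
  { intros sigma k H1 H2 H3 H4 m.
    eapply Rle_trans; [apply (tail_sum_le mu sigma (8 * d * INR n / sigma)); trivial|].
    - lra.
    - apply Hw; lra.
    - rewrite HE by lra. unfold TT. rewrite <- exp_plus.
      apply Rmult_le_compat_l; [left; now apply Rinv_0_lt_compat|]. apply exp_le_compat.
      assert (PI * sigma <= PI * nu) by (apply Rmult_le_compat_l; lra). lra. }
  rewrite (zsum_ext _ (fun k => integrand f (RtoC (IZR k * h)))).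
  2:{ intros k. unfold integrand. now rewrite psiC_real, dpsi_real. }
  (* The truncation terms do not depend on [Y]; on the left side they become part of the constant
     [c] of the limit lemma. *)
  assert (Q : Cmod (I - RtoC h * zsum (fun k => integrand f (RtoC (IZR k * h))) (- M) N)%C - K * (TT + TT)
    <= 2 * (line_bound K alpha beta d / (exp (2 * PI / h * d) - 1))).
  { apply line_bound_limit; trivial. intros Y HY.
    assert (B := quadrature_error d K alpha beta f Hd0 Hd Hf HK Ha Hb Hbound I Y h TT TT M N HY Hh
      (Hpos M alpha ltac:(lra) HMw) (Hpos N beta ltac:(lra) HNw) HI
      (HT alpha M Hmua Hnua HMw ltac:(lra)) (HT beta N Hmub Hnub HNw ltac:(lra))).
    lra. }
  replace (2 * PI / h * d) with E in Q by (unfold E, h; field; lra).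
  replace (- (2 * PI * d * INR n) / lu) with (- E) by (unfold E; field; lra).
  assert (Hcd : 0 < cos d) by (apply cos_gt_0; lra).
  set (R0 := Rpower (cos (PI / 2 * sin d)) ((alpha + beta) / 2)) in *.
  assert (HR0 : 0 < R0) by apply exp_pos.
  (* Replacing both rates by [mu] gives two equal terms, and the factors [PI / 2] cancel. *)
  assert (LB : line_bound K alpha beta d <= 2 * K / mu * / (R0 * cos d)).
  { unfold line_bound, amplitude. fold R0.
    assert (inv : forall sigma, mu <= sigma -> / (PI / 2 * sigma * cos d) <= / (PI / 2 * mu * cos d)).
    { intros sigma Hs. assert (0 < PI / 2 * mu) by nra. assert (PI / 2 * mu <= PI / 2 * sigma) by nra.
      apply Rinv_le_contravar; nra. }
    assert (I1 := inv alpha Hmua). assert (I2 := inv beta Hmub).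
    replace (2 * K / mu * / (R0 * cos d)) with
      (K * (PI / 2) / R0 * (/ (PI / 2 * mu * cos d) + / (PI / 2 * mu * cos d))) by (field; lra).
    apply Rmult_le_compat_l; [|lra]. apply Rdiv_le_0_compat; [nra|exact HR0]. }
  set (P := PI * mu * exp 1 / 4) in *.
  (* This makes the constant independent of [n]: [1 / (exp E - 1)] is [exp (- E) / (1 - exp (- E))],
     and the denominator is bounded below through [P]. *)
  assert (HPE : P <= E).
  { assert (H := ln_le_x_div_e u Hu). fold lu in H.
    replace E with (PI * mu / 4 * (u / lu)) by (unfold E, u; field; lra).
    replace P with (PI * mu / 4 * exp 1) by (unfold P; field).
    apply Rmult_le_compat_l; [nra|exact H]. }
  assert (HP0 : 0 < P) by (unfold P; assert (0 < PI * mu * exp 1) by (apply Rmult_lt_0_compat; [apply Rmult_lt_0_compat; lra|exact He]); lra).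
  assert (HeP : exp (- P) < 1) by (rewrite <- exp_0; apply exp_increasing; lra).
  assert (HeE : exp (- E) <= exp (- P)) by (apply exp_le_compat; lra).
  assert (G : / (exp E - 1) <= exp (- E) * / (1 - exp (- P))).
  { assert (1 < exp E) by (rewrite <- exp_0; apply exp_increasing; lra).
    replace (/ (exp E - 1)) with (exp (- E) * / (1 - exp (- E))).
    - apply Rmult_le_compat_l; [left; apply exp_pos|]. apply Rinv_le_contravar; lra.
    - rewrite exp_Ropp. field. lra. }
  apply Rle_trans with (2 * (2 * K / mu * / (R0 * cos d) * (exp (- E) * / (1 - exp (- P)))) + K * (TT + TT)).
  - assert (2 * (line_bound K alpha beta d / (exp E - 1)) <=
      2 * (2 * K / mu * / (R0 * cos d) * (exp (- E) * / (1 - exp (- P))))); [|lra].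
    apply Rmult_le_compat_l; [lra|]. unfold Rdiv at 1.
    assert (1 < exp E) by (rewrite <- exp_0; apply exp_increasing; lra).
    assert (0 < 2 * K / mu * / (R0 * cos d)).
    { apply Rmult_lt_0_compat; [apply Rdiv_lt_0_compat; lra|apply Rinv_0_lt_compat, Rmult_lt_0_compat; assumption]. }
    apply Rle_trans with (2 * K / mu * / (R0 * cos d) * / (exp E - 1)).
    + apply Rmult_le_compat_r; [left; apply Rinv_0_lt_compat; lra|exact LB].
    + apply Rmult_le_compat_l; lra.
  (* The two truncation bounds add up to [(2 K / mu) exp (PI nu / 4) exp (- E)], the second summand
     of [C2]. *)
  - right. unfold C2, TT. field. repeat split; lra.
Qed.
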